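(* Let $\Bbbk$ be an algebraically closed field of characteristic $p>2$, let $\widetilde D$ and $D(H)$ be the Hopf algebras defined in the context and let $\pi:\widetilde D\twoheadrightarrow D(H)$ be the Hopf algebra epimorphism with $\mathbf g\mapsto g$, $x\mapsto x$, $y\mapsto y$, $\zeta\mapsto\zeta$, $u\mapsto u$, $v\mapsto v$. Let $Z$ be the subalgebra of $\widetilde D$ generated by the elements $\mathbf g^{\pm p}$, $x^p$, $y^p$, $u^p$, $v^p$ and $\zeta^{(p)}:=\prod_{i=1}^p(\zeta+i-1)=\zeta^p-\zeta$, and let $\iota:Z\to\widetilde D$ be the inclusion. Then: (i) $Z$ is a central Hopf subalgebra of $\widetilde D$. (ii) $\widetilde D$ is a finitely generated free $Z$-module. (iii) $Z\xrightarrow{\iota}\widetilde D\xrightarrow{\pi}D(H)$ is a short exact sequence of Hopf algebras. (iv) $Z\simeq\Bbbk[T^{\pm1}]\otimes\Bbbk[X_1,\dots,X_5]$ as an algebra. In particular $Z$ is a domain. (v) $Z\simeq\mathcal O(\mathbf B)$ as Hopf algebras, where $\mathbf B=\big((\mathbf G_a\times\mathbf G_a)\rtimes\mathbf G_m\big)\times\mathbf H_3$.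
   Context: $\widetilde D$ (the double of the Jordan plane) is the Hopf algebra presented by generators $u,v,\zeta,\mathbf g^{\pm1},x,y$ and relations \begin{align*} & \mathbf g^{\pm1}\mathbf g^{\mp1}=1,\ \mathbf gx=x\mathbf g,\ \mathbf gy=y\mathbf g+x\mathbf g,\ yx=xy-\tfrac12x^2,\ v\zeta=\zeta v+v,\ u\zeta=\zeta u+u,\ vu=uv-\tfrac12u^2,\\ & \zeta y=y\zeta+y,\ \zeta x=x\zeta+x,\ v\mathbf g=\mathbf gv+\mathbf gu,\ u\mathbf g=\mathbf gu,\ vx=xv+(1-\mathbf g)+xu,\ ux=xu,\\ & uy=yu+(1-\mathbf g),\ vy=yv-\mathbf g\zeta+yu,\ \zeta\mathbf g=\mathbf g\zeta, \end{align*} with coproduct $\Delta(\mathbf g)=\mathbf g\otimes\mathbf g$, $\Delta(x)=x\otimes1+\mathbf g\otimes x$, $\Delta(y)=y\otimes1+\mathbf g\otimes y$, $\Delta(\zeta)=\zeta\otimes1+1\otimes\zeta$, $\Delta(u)=u\otimes1+1\otimes u$, $\Delta(v)=v\otimes1+1\otimes v+\zeta\otimes u$. It has basis $\{x^ny^r\mathbf g^m\zeta^ku^iv^j: i,j,k,n,r\in\mathbb N_0,\ m\in\mathbb Z\}$. $D(H)$ (the Drinfeld double of the bosonization of the restricted Jordan plane) is the Hopf algebra of dimension $p^6$ with generators $u,v,\zeta,g,x,y$, the same relations with $\mathbf g$ replaced by $g$ together with $g^p=1$, $x^p=y^p=u^p=v^p=0$, $\zeta^p=\zeta$, and the same coproduct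 formulas. A sequence of Hopf algebra maps $A\xrightarrow{\iota}C\xrightarrow{\pi}B$ is (short) exact if $\iota$ is injective, $\pi$ is surjective, $\ker\pi=C\iota(A)^+$ (where $A^+=\ker\varepsilon$) and $\iota(A)=C^{\mathrm{co}\,\pi}=\{c\in C:(\mathrm{id}\otimes\pi)\Delta(c)=c\otimes1\}$. $\mathbf G_a=(\Bbbk,+)$, $\mathbf G_m=(\Bbbk^\times,\cdot)$, $\mathcal O(G)$ is the Hopf algebra of regular functions on the affine algebraic group $G$. In $\mathbf B$, $\mathbf G_m$ acts on $\mathbf G_a\times\mathbf G_a$ by $\lambda\cdot(r_1,r_2)=(\lambda r_1,\lambda r_2)$, and $\mathbf H_3$ is the Heisenberg group of upper triangular $3\times3$ matrices with ones on the diagonal. *)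

(* Defs.v *)
From HB Require Import structures.
From mathcomp Require Import all_boot all_algebra.
From mathcomp Require Import zify.
From mathcomp Require Import boolp classical_sets functions.
From mathcomp Require Import finfield monalg mpoly.

Set Implicit Arguments.
Unset Strict Implicit.
Unset Printing Implicit Defensive.

Import GRing.Theory.
Local Open Scope quotient_scope.
Local Open Scope ring_scope.

Definition is_bilinear (k : fieldType) (U V W : lmodType k) (f : U -> V -> W) :=
  (forall v, linear (f^~ v)) /\ (forall u, linear (f u)).

Section Bilinear.
Variables (k : fieldType) (U V W : lmodType k) (f : U -> V -> W).
Hypothesis fB : is_bilinear f.

Lemma bilDl u1 u2 v : f (u1 + u2) v = f u1 v + f u2 v.
Proof. by have := fB.1 v 1 u1 u2; rewrite !scale1r. Qed.

Lemma bilDr u v1 v2 : f u (v1 + v2) = f u v1 + f u v2.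
Proof. by have := fB.2 u 1 v1 v2; rewrite !scale1r. Qed.

Lemma bil0l v : f 0 v = 0.
Proof. by apply: (@addrI _ (f 0 v)); rewrite -bilDl !addr0. Qed.

Lemma bil0r u : f u 0 = 0.
Proof. by apply: (@addrI _ (f u 0)); rewrite -bilDr !addr0. Qed.

Lemma bilZl c u v : f (c *: u) v = c *: f u v.
Proof. by have := fB.1 v c u 0; rewrite !addr0 bil0l addr0. Qed.

Lemma bilZr c u v : f u (c *: v) = c *: f u v.
Proof. by have := fB.2 u c v 0; rewrite !addr0 bil0r addr0. Qed.

Lemma bil_suml (I : Type) (r : seq I) (F : I -> U) v :
  f (\sum_(i <- r) F i) v = \sum_(i <- r) f (F i) v.
Proof.
elim: r => [|i r IH]; first by rewrite !big_nil bil0l.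
by rewrite !big_cons bilDl IH.
Qed.

Lemma bil_sumr (I : Type) (r : seq I) (F : I -> V) u :
  f u (\sum_(i <- r) F i) = \sum_(i <- r) f u (F i).
Proof.
elim: r => [|i r IH]; first by rewrite !big_nil bil0r.
by rewrite !big_cons bilDr IH.
Qed.

End Bilinear.

Section Tensor.
Variables (k : fieldType) (U V : lmodType k).

(* The list [:: (u1, v1); ...; (un, vn)] stands for the formal sum of the     *)
(* u_i (x) v_i; two such sums are identified when no bilinear map separates   *)
(* them, i.e., modulo the kernel of the universal bilinear map.               *)
Definition tens_eval (W : lmodType k) (f : U -> V -> W) (s : seq (U * V)) : W :=
  \sum_(uv <- s) f uv.1 uv.2.

Definition tens_eq (s t : seq (U * V)) : bool :=
  `[< forall (W : lmodType k) (f : U -> V -> W),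
        is_bilinear f -> tens_eval f s = tens_eval f t >].

Lemma tens_eq_equiv : equiv_class_of tens_eq.
Proof.
split=> [s|s t|t s r].
- by apply/asboolP.
- by apply/idP/idP => /asboolP H; apply/asboolP => W f fB; rewrite H.
- by move=> /asboolP H1 /asboolP H2; apply/asboolP => W f fB; rewrite H1 ?H2.
Qed.

Canonical tens_equiv := EquivRelPack tens_eq_equiv.

Definition tensor := {eq_quot tens_eq}.

HB.instance Definition _ := Choice.on tensor.
HB.instance Definition _ := EqQuotient.on tensor.

Definition tsum (s : seq (U * V)) : tensor := \pi_tensor s.

Definition tens (u : U) (v : V) : tensor := tsum [:: (u, v)].

(* The linear map induced by f (which should be bilinear). *)
Definition tens_lift (W : lmodType k) (f : U -> V -> W) (t : tensor) : W :=
  tens_eval f (repr t).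

Lemma tsumP s t : (forall (W : lmodType k) (f : U -> V -> W),
  is_bilinear f -> tens_eval f s = tens_eval f t) <-> tsum s = tsum t.
Proof.
split=> [H | /eqmodP /asboolP //].
by apply/eqmodP/asboolP.
Qed.

Lemma tens_lift_tsum (W : lmodType k) (f : U -> V -> W) s :
  is_bilinear f -> tens_lift f (tsum s) = tens_eval f s.
Proof. by move=> fB; apply: (tsumP _ _).2 fB; rewrite /tsum reprK. Qed.

Lemma tens_liftE (W : lmodType k) (f : U -> V -> W) u v :
  is_bilinear f -> tens_lift f (tens u v) = f u v.
Proof. by move=> fB; rewrite tens_lift_tsum // /tens_eval big_seq1. Qed.

Lemma tensor_ext (t1 t2 : tensor) :
  (forall (W : lmodType k) (f : U -> V -> W),
     is_bilinear f -> tens_lift f t1 = tens_lift f t2) -> t1 = t2.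
Proof.
move=> H; rewrite -(reprK t1) -(reprK t2); apply/tsumP => W f fB.
exact: H.
Qed.

Definition tzero : tensor := tsum [::].
Definition tadd (t1 t2 : tensor) : tensor := tsum (repr t1 ++ repr t2).
Definition tscale (c : k) (t : tensor) : tensor :=
  tsum [seq (c *: uv.1, uv.2) | uv <- repr t].
Definition topp (t : tensor) : tensor := tscale (-1) t.

Section LiftE.
Variables (W : lmodType k) (f : U -> V -> W).
Hypothesis fB : is_bilinear f.

Lemma lift_tzero : tens_lift f tzero = 0.
Proof. by rewrite tens_lift_tsum // /tens_eval big_nil. Qed.

Lemma lift_tadd t1 t2 : tens_lift f (tadd t1 t2) = tens_lift f t1 + tens_lift f t2.
Proof. by rewrite tens_lift_tsum // /tens_eval big_cat. Qed.

Lemma lift_tscale c t : tens_lift f (tscale c t) = c *: tens_lift f t.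
Proof.
rewrite tens_lift_tsum // /tens_eval big_map /tens_lift /tens_eval scaler_sumr.
by apply: eq_bigr => uv _ /=; rewrite bilZl.
Qed.

End LiftE.

Lemma taddA : associative tadd.
Proof. by move=> a b c; apply: tensor_ext => W f fB; rewrite !lift_tadd // addrA. Qed.
Lemma taddC : commutative tadd.
Proof. by move=> a b; apply: tensor_ext => W f fB; rewrite !lift_tadd // addrC. Qed.
Lemma tadd0 : left_id tzero tadd.
Proof.
by move=> a; apply: tensor_ext => W f fB; rewrite lift_tadd // lift_tzero // add0r.
Qed.
Lemma taddN : left_inverse tzero topp tadd.
Proof.
move=> a; apply: tensor_ext => W f fB.
by rewrite lift_tadd // lift_tzero // lift_tscale // scaleN1r addNr.
Qed.

HB.instance Definition _ := GRing.isZmodule.Build tensor taddA taddC tadd0 taddN.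

Lemma tscaleA c d t : tscale c (tscale d t) = tscale (c * d) t.
Proof. by apply: tensor_ext => W f fB; rewrite !lift_tscale // scalerA. Qed.
Lemma tscale1 : left_id 1 tscale.
Proof. by move=> t; apply: tensor_ext => W f fB; rewrite lift_tscale // scale1r. Qed.
Lemma tscaleDr : right_distributive tscale +%R.
Proof.
move=> c s t; apply: tensor_ext => W f fB.
by rewrite !(lift_tadd, lift_tscale) // scalerDr.
Qed.
Lemma tscaleDl t : {morph tscale^~ t : c d / c + d}.
Proof.
move=> c d; apply: tensor_ext => W f fB.
by rewrite !(lift_tadd, lift_tscale) // scalerDl.
Qed.

HB.instance Definition _ :=
  GRing.Zmodule_isLmodule.Build k tensor tscaleA tscale1 tscaleDr tscaleDl.

Lemma tens_lift_linear (W : lmodType k) (f : U -> V -> W) :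
  is_bilinear f -> linear (tens_lift f).
Proof. by move=> fB c s t; rewrite lift_tadd // lift_tscale. Qed.

Lemma tens_liftD (W : lmodType k) (f : U -> V -> W) s t : is_bilinear f ->
  tens_lift f (s + t) = tens_lift f s + tens_lift f t.
Proof. by move=> fB; exact: (lift_tadd fB). Qed.

Lemma tens_liftZ (W : lmodType k) (f : U -> V -> W) c t : is_bilinear f ->
  tens_lift f (c *: t) = c *: tens_lift f t.
Proof. by move=> fB; exact: (lift_tscale fB). Qed.

Lemma tens_bilinear : is_bilinear tens.
Proof.
split=> [v c u1 u2 | u c v1 v2]; apply: tensor_ext => W f fB;
  rewrite tens_lift_linear // !tens_liftE //; first by rewrite (bilDl fB) (bilZl fB).
by rewrite (bilDr fB) (bilZr fB).
Qed.

Lemma tsumE s : tsum s = \sum_(uv <- s) tens uv.1 uv.2.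
Proof.
apply: tensor_ext => W f fB; rewrite tens_lift_tsum // /tens_eval.
elim: s => [|uv s IH]; first by rewrite !big_nil lift_tzero.
by rewrite !big_cons lift_tadd // tens_liftE // IH.
Qed.

Lemma tensorP (t : tensor) : exists s, t = \sum_(uv <- s) tens uv.1 uv.2.
Proof. by exists (repr t); rewrite -tsumE /tsum reprK. Qed.

End Tensor.

Notation "U ⊗ V" := (tensor U V) (at level 35, right associativity) : type_scope.
Notation "u ⊗' v" := (tens u v) (at level 35, right associativity) : ring_scope.

Definition tens_map (k : fieldType) (U V U' V' : lmodType k)
    (f : U -> U') (g : V -> V') : U ⊗ V -> U' ⊗ V' :=
  tens_lift (fun u v => f u ⊗' g v).

Definition tens_assoc (k : fieldType) (U V W : lmodType k) :
    (U ⊗ V) ⊗ W -> U ⊗ (V ⊗ W) :=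
  tens_lift (fun t w => tens_lift (fun u v => u ⊗' (v ⊗' w)) t).

Section LinearForm.
Variables (k : fieldType) (V : lmodType k) (v : V).
Hypothesis v0 : v != 0.

Let sub (M : set V) := (forall c x y, M x -> M y -> M (c *: x + y)) /\ ~ M v.

Lemma exists_linear_form : exists f : V -> k^o, linear f /\ f v = 1.
Proof.
have [F FP Ftot|M [[Ml Mv] Mmax]] := @Zorn_bigcup V sub.
  split=> [c x y [X FX Xx] [Y FY Yy]|[X FX Xv]]; last exact: (FP _ FX).2 Xv.
  have [XY|YX] := Ftot _ _ FX FY.
    by exists Y => //; apply: (FP _ FY).1 => //; apply: XY.
  by exists X => //; apply: (FP _ FX).1 => //; apply: YX.
have M0 : M 0.
  apply: contrapT => nM0.
  have [[x Mx]|Me] := pselect (exists x, M x).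
    by apply: nM0; have := Ml (-1) _ _ Mx Mx; rewrite scaleN1r addNr.
  apply: (Mmax (fun x => x = 0)).
    split=> [x Mx|/(_ 0 erefl)//]; by case: Me; exists x.
  split=> [c x y -> ->|/= v00]; first by rewrite scaler0 addr0.
  by move/eqP: v0; apply.
have MZ c x : M x -> M (c *: x) by move=> Mx; rewrite -[_ *: _]addr0; apply: Ml.
have MD x y : M x -> M y -> M (x + y) by move=> Mx My; rewrite -[x]scale1r; apply: Ml.
have ex w : exists c : k, M (w - c *: v).
  apply: contrapT => nex.
  pose N : set V := fun x => exists a m, M m /\ x = m + a *: w.
  apply: (Mmax N).
    split=> [x Mx|NM]; first by exists 0, x; rewrite scale0r addr0.
    apply: nex; exists 0; rewrite scale0r subr0.
    by apply: NM; exists 1, 0; rewrite scale1r add0r.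
  split=> [c _ _ [a [m [Mm ->]]] [b [n [Mn ->]]]|[a [m [Mm E]]]].
    exists (c * a + b), (c *: m + n); split; first exact: Ml.
    by rewrite scalerDr scalerA scalerDl addrACA.
  have [a0|a0] := eqVneq a 0.
    by apply: Mv; rewrite E a0 scale0r addr0.
  apply: nex; exists a^-1.
  have -> : w - a^-1 *: v = - a^-1 *: m.
    by rewrite E scalerDr scalerA mulVf // scale1r opprD addrCA subrr addr0 scaleNr.
  exact: MZ.
have uniq w c d : M (w - c *: v) -> M (w - d *: v) -> c = d.
  move=> Mc Md; apply: contrapT => /eqP; rewrite -subr_eq0 => cd; apply: Mv.
  have : M ((c - d) *: v).
    have := Ml (-1) _ _ Mc Md; by rewrite scaleN1r opprB addrA subrK -scaleNr -scalerDl.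
  by move/(MZ (c - d)^-1); rewrite scalerA mulVf // scale1r.
have [f fP] := choice ex.
exists f; split=> [c x y|]; last by apply: (uniq v) => //; rewrite scale1r subrr.
apply: (uniq (c *: x + y)) => //.
rewrite scalerDl opprD -scalerA addrACA -scalerBr.
by apply: Ml.
Qed.

End LinearForm.

Section TensorAlg.
Variables (k : fieldType) (A B : algType k).

Definition tmul_rep (s t : seq (A * B)) : seq (A * B) :=
  [seq (x.1 * y.1, x.2 * y.2) | x <- s, y <- t].

Definition tone : A ⊗ B := 1 ⊗' 1.
Definition tmul (s t : A ⊗ B) : A ⊗ B := tsum (tmul_rep (repr s) (repr t)).

Lemma lmul_bil (W : lmodType k) (f : A -> B -> W) c d :
  is_bilinear f -> is_bilinear (fun a b => f (a * c) (b * d)).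
Proof.
move=> fB; split=> [b e a1 a2|a e b1 b2].
  by rewrite mulrDl -scalerAl (bilDl fB) (bilZl fB).
by rewrite mulrDl -scalerAl (bilDr fB) (bilZr fB).
Qed.

Lemma rmul_bil (W : lmodType k) (f : A -> B -> W) a b :
  is_bilinear f -> is_bilinear (fun c d => f (a * c) (b * d)).
Proof.
move=> fB; split=> [d e a1 a2|c e b1 b2].
  by rewrite mulrDr -scalerAr (bilDl fB) (bilZl fB).
by rewrite mulrDr -scalerAr (bilDr fB) (bilZr fB).
Qed.

Lemma lift_tmul (W : lmodType k) (f : A -> B -> W) s t : is_bilinear f ->
  tens_lift f (tmul s t) =
  tens_lift (fun a b => tens_lift (fun c d => f (a * c) (b * d)) t) s.
Proof.
move=> fB; rewrite tens_lift_tsum // /tens_eval /tmul_rep.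
rewrite big_allpairs_dep /tens_lift /tens_eval.
by apply: eq_bigr => x _.
Qed.

Lemma mul_bil (W : lmodType k) (f : A -> B -> W) t : is_bilinear f ->
  is_bilinear (fun a b => tens_lift (fun c d => f (a * c) (b * d)) t).
Proof.
move=> fB; split=> [b e a1 a2|a e b1 b2];
  rewrite /tens_lift /tens_eval scaler_sumr -big_split; apply: eq_bigr => x _ /=.
  by rewrite mulrDl -scalerAl (bilDl fB) (bilZl fB).
by rewrite mulrDl -scalerAl (bilDr fB) (bilZr fB).
Qed.

Lemma tmulE a b c d : tmul (a ⊗' b) (c ⊗' d) = (a * c) ⊗' (b * d).
Proof.
apply: tensor_ext => W f fB.
rewrite lift_tmul // tens_liftE; last exact: mul_bil.
by rewrite !tens_liftE //; exact: rmul_bil.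
Qed.

Lemma tmulDl : left_distributive tmul +%R.
Proof.
move=> s t r; apply: tensor_ext => W f fB.
by rewrite tens_liftD // !lift_tmul // tens_liftD //; exact: mul_bil.
Qed.

Lemma tmulDr : right_distributive tmul +%R.
Proof.
move=> s t r; apply: tensor_ext => W f fB.
rewrite tens_liftD // !lift_tmul //.
rewrite [LHS]/tens_lift [X in _ = X + _]/tens_lift [X in _ = _ + X]/tens_lift.
rewrite /tens_eval -big_split; apply: eq_bigr => x _ /=.
by rewrite tens_liftD //; exact: rmul_bil.
Qed.

Lemma tmulZl c s t : c *: tmul s t = tmul (c *: s) t.
Proof.
apply: tensor_ext => W f fB.
by rewrite tens_liftZ // !lift_tmul // tens_liftZ //; exact: mul_bil.
Qed.

Lemma tmulZr c s t : c *: tmul s t = tmul s (c *: t).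
Proof.
apply: tensor_ext => W f fB; rewrite tens_liftZ // !lift_tmul //.
rewrite [X in _ *: X]/tens_lift [RHS]/tens_lift /tens_eval scaler_sumr.
apply: eq_bigr => x _.
by rewrite tens_liftZ //; exact: rmul_bil.
Qed.

Lemma tmul0l t : tmul 0 t = 0.
Proof. by apply: (@addrI _ (tmul 0 t)); rewrite -tmulDl !addr0. Qed.
Lemma tmul0r t : tmul t 0 = 0.
Proof. by apply: (@addrI _ (tmul t 0)); rewrite -tmulDr !addr0. Qed.

Lemma tensor_ind (P : A ⊗ B -> Prop) :
  P 0 -> (forall s t, P s -> P t -> P (s + t)) -> (forall a b, P (a ⊗' b)) ->
  forall t, P t.
Proof.
move=> P0 PD Pt t; have [s ->] := tensorP t.
elim: s => [|x s IH]; first by rewrite big_nil.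
by rewrite big_cons; apply: PD.
Qed.

Lemma tmulA : associative tmul.
Proof.
move=> s t r; elim/tensor_ind: s => [|s s' Hs Hs'|a b].
- by rewrite !tmul0l.
- by rewrite !tmulDl Hs Hs'.
elim/tensor_ind: t => [|t t' Ht Ht'|c d].
- by rewrite tmul0l tmul0r tmul0l.
- by rewrite !(tmulDl, tmulDr) Ht Ht'.
elim/tensor_ind: r => [|r r' Hr Hr'|e f].
- by rewrite !tmul0r.
- by rewrite !tmulDr Hr Hr'.
by rewrite !tmulE !mulrA.
Qed.

Lemma tmul1 : left_id tone tmul.
Proof.
move=> t; elim/tensor_ind: t => [|t t' Ht Ht'|c d].
- by rewrite tmul0r.
- by rewrite tmulDr Ht Ht'.
by rewrite tmulE !mul1r.
Qed.

Lemma tmulr1 : right_id tone tmul.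
Proof.
move=> t; elim/tensor_ind: t => [|t t' Ht Ht'|c d].
- by rewrite tmul0l.
- by rewrite tmulDl Ht Ht'.
by rewrite tmulE !mulr1.
Qed.

Lemma tone_neq0 : tone != 0.
Proof.
have [f [fL f1]] := exists_linear_form (oner_neq0 A).
have [g [gL g1]] := exists_linear_form (oner_neq0 B).
have fgB : is_bilinear (fun a b => (f a * g b : k^o)).
  split=> [b c a1 a2|a c b1 b2]; rewrite (fL, gL).
    by rewrite mulrDl -scalerAl.
  by rewrite mulrDr -scalerAr.
apply/eqP => E; have := congr1 (tens_lift (fun a b => (f a * g b : k^o))) E.
rewrite tens_liftE // lift_tzero // f1 g1 mulr1 => /eqP.
by rewrite oner_eq0.
Qed.

HB.instance Definition _ := GRing.Zmodule_isNzRing.Build (A ⊗ B)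
  tmulA tmul1 tmulr1 tmulDl tmulDr tone_neq0.
HB.instance Definition _ := GRing.Lmodule_isLalgebra.Build k (A ⊗ B) tmulZl.
HB.instance Definition _ := GRing.Lalgebra_isAlgebra.Build k (A ⊗ B) tmulZr.

End TensorAlg.


Section QuotientAlgebra.
Variables (k : fieldType) (A : algType k).

(* A relation l = r is the pair (l, r). *)
Variable rels : seq (A * A).

(* The two-sided ideal generated by the l - r. *)
Definition in_ideal (x : A) : Prop :=
  exists2 s : seq (A * (A * A) * A), all (fun t => t.1.2 \in rels) s &
    x = \sum_(t <- s) t.1.1 * (t.1.2.1 - t.1.2.2) * t.2.

(* Algebras are nontrivial rings in MathComp, hence this side condition. *)
Definition consistent : Prop := ~ in_ideal 1.

Lemma in_ideal0 : in_ideal 0.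
Proof. by exists [::]; rewrite ?big_nil. Qed.

Lemma in_idealD x y : in_ideal x -> in_ideal y -> in_ideal (x + y).
Proof.
move=> [s sR ->] [t tR ->]; exists (s ++ t); first by rewrite all_cat sR.
by rewrite big_cat.
Qed.

Lemma in_idealMl a x : in_ideal x -> in_ideal (a * x).
Proof.
move=> [s sR ->]; exists [seq (a * t.1.1, t.1.2, t.2) | t <- s].
  by rewrite all_map.
by rewrite big_map mulr_sumr; apply: eq_bigr => t _; rewrite !mulrA.
Qed.

Lemma in_idealMr a x : in_ideal x -> in_ideal (x * a).
Proof.
move=> [s sR ->]; exists [seq (t.1.1, t.1.2, t.2 * a) | t <- s].
  by rewrite all_map.
by rewrite big_map mulr_suml; apply: eq_bigr => t _; rewrite !mulrA.
Qed.

Lemma in_idealZ c x : in_ideal x -> in_ideal (c *: x).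
Proof. by move=> Ix; rewrite -[x]mul1r scalerAl; apply: in_idealMl. Qed.

Lemma in_idealN x : in_ideal x -> in_ideal (- x).
Proof. by rewrite -scaleN1r; apply: in_idealZ. Qed.

Lemma in_idealB x y : in_ideal x -> in_ideal y -> in_ideal (x - y).
Proof. by move=> Ix Iy; apply: in_idealD => //; apply: in_idealN. Qed.

Lemma in_ideal_rel l r : (l, r) \in rels -> in_ideal (l - r).
Proof.
move=> lr; exists [:: (1, (l, r), 1)]; first by rewrite /= lr.
by rewrite big_seq1 mul1r mulr1.
Qed.

Lemma in_ideal_morph (B : algType k) (f : {lrmorphism A -> B}) :
  (forall r, r \in rels -> f r.1 = f r.2) -> forall x, in_ideal x -> f x = 0.
Proof.
move=> fR x [s /allP sR ->]; rewrite rmorph_sum big_seq big1 // => t ts.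
by rewrite !rmorphM rmorphB /= (fR _ (sR _ ts)) subrr mulr0 mul0r.
Qed.

Lemma consistentP (B : algType k) (f : {lrmorphism A -> B}) :
  (forall r, r \in rels -> f r.1 = f r.2) -> consistent.
Proof.
move=> fR /(in_ideal_morph fR); rewrite rmorph1 => /eqP.
by rewrite oner_eq0.
Qed.

Definition ideal_eq (x y : A) : bool := `[< in_ideal (x - y) >].

Lemma ideal_eq_equiv : equiv_class_of ideal_eq.
Proof.
split=> [x|x y|y x z].
- by apply/asboolP; rewrite subrr; exact: in_ideal0.
- by apply/idP/idP => /asboolP H; apply/asboolP; rewrite -opprB; exact: in_idealN.
- move=> /asboolP H1 /asboolP H2; apply/asboolP.
  by rewrite -(subrK y x) -addrA; apply: in_idealD.
Qed.

Canonical ideal_equiv := EquivRelPack ideal_eq_equiv.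

Definition quot_alg of consistent := {eq_quot ideal_eq}.

Hypothesis rels_cons : consistent.
Local Notation Q := (quot_alg rels_cons).

HB.instance Definition _ := Choice.on Q.
HB.instance Definition _ := EqQuotient.on Q.

Definition to_quot (a : A) : Q := \pi_Q a.

Lemma to_quotP a b : in_ideal (a - b) <-> to_quot a = to_quot b.
Proof.
split=> [H|/eqmodP /asboolP //].
by apply/eqmodP/asboolP.
Qed.

Lemma to_quot_surj (q : Q) : exists a, q = to_quot a.
Proof. by exists (repr q); rewrite /to_quot reprK. Qed.

Lemma to_quotK a : in_ideal (repr (to_quot a) - a).
Proof. by apply/to_quotP; rewrite /to_quot reprK. Qed.

Definition qzero : Q := to_quot 0.
Definition qone : Q := to_quot 1.
Definition qadd (x y : Q) : Q := to_quot (repr x + repr y).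
Definition qopp (x : Q) : Q := to_quot (- repr x).
Definition qmul (x y : Q) : Q := to_quot (repr x * repr y).
Definition qscale (c : k) (x : Q) : Q := to_quot (c *: repr x).

Lemma qaddE a b : qadd (to_quot a) (to_quot b) = to_quot (a + b).
Proof.
by apply/to_quotP; rewrite opprD addrACA; apply: in_idealD; apply: to_quotK.
Qed.
Lemma qoppE a : qopp (to_quot a) = to_quot (- a).
Proof. by apply/to_quotP; rewrite -opprD; apply: in_idealN; apply: to_quotK. Qed.
Lemma qmulE a b : qmul (to_quot a) (to_quot b) = to_quot (a * b).
Proof.
apply/to_quotP; set a' := repr _; set b' := repr _.
have -> : a' * b' - a * b = (a' - a) * b' + a * (b' - b).
  by rewrite mulrBl mulrBr addrA subrK.
by apply: in_idealD; [apply: in_idealMr|apply: in_idealMl]; apply: to_quotK.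
Qed.
Lemma qscaleE c a : qscale c (to_quot a) = to_quot (c *: a).
Proof. by apply/to_quotP; rewrite -scalerBr; apply: in_idealZ; apply: to_quotK. Qed.

Lemma qaddA : associative qadd.
Proof.
move=> x y z; have [[a ->] [b ->] [c ->]] :=
  And3 (to_quot_surj x) (to_quot_surj y) (to_quot_surj z).
by rewrite !qaddE addrA.
Qed.
Lemma qaddC : commutative qadd.
Proof. by move=> x y; rewrite /qadd addrC. Qed.
Lemma qadd0 : left_id qzero qadd.
Proof. by move=> x; have [a ->] := to_quot_surj x; rewrite qaddE add0r. Qed.
Lemma qaddN : left_inverse qzero qopp qadd.
Proof. by move=> x; have [a ->] := to_quot_surj x; rewrite qoppE qaddE addNr. Qed.

HB.instance Definition _ := GRing.isZmodule.Build Q qaddA qaddC qadd0 qaddN.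

Lemma qmulA : associative qmul.
Proof.
move=> x y z; have [[a ->] [b ->] [c ->]] :=
  And3 (to_quot_surj x) (to_quot_surj y) (to_quot_surj z).
by rewrite !qmulE mulrA.
Qed.
Lemma qmul1 : left_id qone qmul.
Proof. by move=> x; have [a ->] := to_quot_surj x; rewrite qmulE mul1r. Qed.
Lemma qmulr1 : right_id qone qmul.
Proof. by move=> x; have [a ->] := to_quot_surj x; rewrite qmulE mulr1. Qed.
Lemma qmulDl : left_distributive qmul +%R.
Proof.
move=> x y z; have [[a ->] [b ->] [c ->]] :=
  And3 (to_quot_surj x) (to_quot_surj y) (to_quot_surj z).
by rewrite -[to_quot a + to_quot b]/(qadd _ _) qaddE !qmulE -[RHS]/(qadd _ _) qaddE mulrDl.
Qed.
Lemma qmulDr : right_distributive qmul +%R.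
Proof.
move=> x y z; have [[a ->] [b ->] [c ->]] :=
  And3 (to_quot_surj x) (to_quot_surj y) (to_quot_surj z).
by rewrite -[to_quot b + to_quot c]/(qadd _ _) qaddE !qmulE -[RHS]/(qadd _ _) qaddE mulrDr.
Qed.
Lemma qone_neq0 : qone != 0.
Proof.
by apply/eqP => /to_quotP; rewrite subr0.
Qed.

HB.instance Definition _ := GRing.Zmodule_isNzRing.Build Q
  qmulA qmul1 qmulr1 qmulDl qmulDr qone_neq0.

Lemma qscaleA c d x : qscale c (qscale d x) = qscale (c * d) x.
Proof. by have [a ->] := to_quot_surj x; rewrite !qscaleE scalerA. Qed.
Lemma qscale1 : left_id 1 qscale.
Proof. by move=> x; have [a ->] := to_quot_surj x; rewrite qscaleE scale1r. Qed.
Lemma qscaleDr : right_distributive qscale +%R.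
Proof.
move=> c x y; have [a ->] := to_quot_surj x; have [b ->] := to_quot_surj y.
by rewrite -[to_quot a + to_quot b]/(qadd _ _) qaddE !qscaleE -[RHS]/(qadd _ _) qaddE scalerDr.
Qed.
Lemma qscaleDl x : {morph qscale^~ x : c d / c + d}.
Proof.
move=> c d; have [a ->] := to_quot_surj x.
by rewrite !qscaleE -[RHS]/(qadd _ _) qaddE scalerDl.
Qed.

HB.instance Definition _ :=
  GRing.Zmodule_isLmodule.Build k Q qscaleA qscale1 qscaleDr qscaleDl.

Lemma qscaleAl (c : k) (x y : Q) : c *: (x * y) = (c *: x) * y.
Proof.
have [a ->] := to_quot_surj x; have [b ->] := to_quot_surj y.
rewrite -[LHS]/(qscale c (qmul _ _)) -[RHS]/(qmul (qscale c _) _).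
by rewrite !(qmulE, qscaleE) scalerAl.
Qed.
Lemma qscaleAr (c : k) (x y : Q) : c *: (x * y) = x * (c *: y).
Proof.
have [a ->] := to_quot_surj x; have [b ->] := to_quot_surj y.
rewrite -[LHS]/(qscale c (qmul _ _)) -[RHS]/(qmul _ (qscale c _)).
by rewrite !(qmulE, qscaleE) scalerAr.
Qed.

HB.instance Definition _ := GRing.Lmodule_isLalgebra.Build k Q qscaleAl.
HB.instance Definition _ := GRing.Lalgebra_isAlgebra.Build k Q qscaleAr.

Lemma to_quot_additive : zmod_morphism to_quot.
Proof.
move=> a b; rewrite -[RHS]/(qadd _ (qopp _)).
by rewrite qoppE qaddE.
Qed.
Lemma to_quot_monoid : monoid_morphism to_quot.
Proof. by split=> // a b; rewrite -[RHS]/(qmul _ _) qmulE. Qed.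
Lemma to_quot_scalable : scalable to_quot.
Proof. by move=> c a; rewrite -[RHS]/(qscale _ _) qscaleE. Qed.

HB.instance Definition _ := GRing.isZmodMorphism.Build A Q to_quot to_quot_additive.
HB.instance Definition _ := GRing.isMonoidMorphism.Build A Q to_quot to_quot_monoid.
HB.instance Definition _ := GRing.isScalable.Build k A Q *:%R to_quot to_quot_scalable.

(* The algebra map induced by f (which should respect the relations). *)
Definition quot_lift (B : algType k) (f : A -> B) (q : Q) : B := f (repr q).

Lemma quot_liftE (B : algType k) (f : {lrmorphism A -> B}) a :
  (forall r, r \in rels -> f r.1 = f r.2) -> quot_lift f (to_quot a) = f a.
Proof.
move=> fR; apply/eqP; rewrite -subr_eq0 -rmorphB; apply/eqP.
by apply: (in_ideal_morph fR); apply: to_quotK.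
Qed.

End QuotientAlgebra.

(* The canonical projection between quotients of the same algebra, when the   *)
(* second one satisfies all the relations of the first one.                   *)
Section QuotientMap.
Variables (k : fieldType) (A : algType k) (rels1 rels2 : seq (A * A)).
Variables (c1 : consistent rels1) (c2 : consistent rels2).

Definition quot_map of {subset rels1 <= rels2} : quot_alg c1 -> quot_alg c2 :=
  quot_lift (to_quot c2).

Hypothesis sub12 : {subset rels1 <= rels2}.

Lemma quot_mapE a : quot_map sub12 (to_quot c1 a) = to_quot c2 a.
Proof.
rewrite /quot_map quot_liftE // => -[l r] /sub12 lr.
by apply/to_quotP; exact: in_ideal_rel.
Qed.

Lemma quot_map_additive : zmod_morphism (quot_map sub12).
Proof.
move=> x y; have [a ->] := to_quot_surj x; have [b ->] := to_quot_surj y.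
by rewrite -rmorphB !quot_mapE rmorphB.
Qed.
Lemma quot_map_monoid : monoid_morphism (quot_map sub12).
Proof.
split=> [|x y]; first by rewrite -(rmorph1 (to_quot c1)) quot_mapE rmorph1.
have [a ->] := to_quot_surj x; have [b ->] := to_quot_surj y.
by rewrite -rmorphM !quot_mapE rmorphM.
Qed.
Lemma quot_map_scalable : scalable (quot_map sub12).
Proof.
move=> c x; have [a ->] := to_quot_surj x.
by rewrite -linearZ !quot_mapE linearZ.
Qed.

HB.instance Definition _ :=
  GRing.isZmodMorphism.Build _ _ (quot_map sub12) quot_map_additive.
HB.instance Definition _ :=
  GRing.isMonoidMorphism.Build _ _ (quot_map sub12) quot_map_monoid.
HB.instance Definition _ :=
  GRing.isScalable.Build k _ _ *:%R (quot_map sub12) quot_map_scalable.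

End QuotientMap.

Section FreeAlgebra.
Variables (k : fieldType) (I : choiceType).

Definition free_alg := {malg k[{fmonom I}]}.

HB.instance Definition _ := GRing.Lalgebra.on free_alg.

Lemma malgC_central c (g : {malg k[{fmonom I}]}) :
  g * mkmalgU mone c = mkmalgU mone c * g.
Proof.
rewrite mul_malgC malgM_def fgmulgU malgZ_def.
by apply: eq_bigr => m _; rewrite mulm1 mulrC.
Qed.

Lemma malg_scaleAr c (x y : {malg k[{fmonom I}]}) : c *: (x * y) = x * (c *: y).
Proof. by rewrite -!mul_malgC [RHS]mulrA malgC_central mulrA. Qed.

Lemma free_alg_scaleAr (c : k) (x y : free_alg) : c *: (x * y) = x * (c *: y).
Proof. exact: malg_scaleAr. Qed.

HB.instance Definition _ := GRing.Lalgebra_isAlgebra.Build k free_alg free_alg_scaleAr.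

Definition free_gen (i : I) : free_alg := << fmu i >>.

Section Lift.
Variables (B : algType k) (b : I -> B).

Definition monom_eval (m : {fmonom I}) : B := \prod_(i <- m) b i.

Lemma monom_eval_mmorphism : mmorphism monom_eval.
Proof.
split=> [m n|]; rewrite /monom_eval; first by rewrite fmM big_cat.
by rewrite fm1 big_nil.
Qed.
HB.instance Definition _ :=
  isMultiplicative.Build {fmonom I} B monom_eval monom_eval_mmorphism.

(* The algebra map sending the generator i to b i. *)
Definition free_lift (x : free_alg) : B := monalg.mmap (in_alg B) monom_eval x.

Lemma free_lift_additive : zmod_morphism free_lift.
Proof. exact: monalg.mmapB. Qed.
Lemma free_lift_monoid : monoid_morphism free_lift.
Proof.
have C : forall (g : {malg k[{fmonom I}]}) m m',
    GRing.comm (in_alg B (monalg.mcoeff m g)) (monom_eval m').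
  by move=> g m m'; rewrite /GRing.comm /= mulr_algl mulr_algr.
by have [] := monalg.commr_mmap_is_multiplicative C.
Qed.
Lemma free_lift_scalable : scalable free_lift.
Proof. by move=> c x; rewrite /free_lift monalg.mmapZ /= mulr_algl. Qed.

HB.instance Definition _ := GRing.isZmodMorphism.Build _ _ free_lift free_lift_additive.
HB.instance Definition _ := GRing.isMonoidMorphism.Build _ _ free_lift free_lift_monoid.
HB.instance Definition _ :=
  GRing.isScalable.Build k _ _ *:%R free_lift free_lift_scalable.

Lemma free_liftE i : free_lift (free_gen i) = b i.
Proof. by rewrite /free_lift monalg.mmapU /= scale1r mul1r /monom_eval fmU big_seq1. Qed.

End Lift.
End FreeAlgebra.

Section Subalgebra.
Variables (k : fieldType) (A : algType k) (S : seq A).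

Definition gen_subalg : {pred A} :=
  [pred a | `[< forall T : {pred A},
      GRing.subalg_closed T -> {subset S <= T} -> a \in T >]].

Lemma gen_subalg_closed : GRing.subalg_closed gen_subalg.
Proof.
split=> [|c a b|a b]; rewrite ?inE.
- by move=> T [T1 _ _] _.
- move=> aT bT T TC ST.
  by have [_ + _] := TC; apply; [exact: aT|exact: bT].
- move=> aT bT T TC ST.
  by have [_ _ +] := TC; apply; [exact: aT|exact: bT].
Qed.

HB.instance Definition _ := GRing.isSubalgClosed.Build k A gen_subalg gen_subalg_closed.

Lemma mem_gen_subalg : {subset S <= gen_subalg}.
Proof. by move=> a aS; apply/asboolP => T _; apply. Qed.

Definition subalg := {a : A | a \in gen_subalg}.

HB.instance Definition _ := [isSub of subalg for @sval A _].
HB.instance Definition _ := [Choice of subalg by <:].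
HB.instance Definition _ := [SubChoice_isSubAlgebra of subalg by <:].

Definition incl (z : subalg) : A := val z.

Lemma incl_additive : zmod_morphism incl. Proof. exact: raddfB. Qed.
Lemma incl_monoid : monoid_morphism incl.
Proof. by split=> [|a b]; rewrite /incl ?rmorph1 ?rmorphM. Qed.
Lemma incl_scalable : scalable incl. Proof. by move=> c a; rewrite /incl linearZ. Qed.

HB.instance Definition _ := GRing.isZmodMorphism.Build _ _ incl incl_additive.
HB.instance Definition _ := GRing.isMonoidMorphism.Build _ _ incl incl_monoid.
HB.instance Definition _ := GRing.isScalable.Build k _ _ *:%R incl incl_scalable.

End Subalgebra.

Record hopf (k : fieldType) (A : algType k) := Hopf {
  comul : {lrmorphism A -> A ⊗ A};
  counit : {lrmorphism A -> k^o};
  antipode : {linear A -> A};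
  hopf_coassoc : forall a,
    tens_assoc (tens_map comul id (comul a)) = tens_map id comul (comul a);
  hopf_counitl : forall a, tens_lift (fun b c => counit b *: c) (comul a) = a;
  hopf_counitr : forall a, tens_lift (fun b c => counit c *: b) (comul a) = a;
  hopf_antipodel : forall a,
    tens_lift (fun b c => antipode b * c) (comul a) = (counit a)%:A;
  hopf_antipoder : forall a,
    tens_lift (fun b c => b * antipode c) (comul a) = (counit a)%:A
}.

Section HopfDefs.
Variables (k : fieldType).
Implicit Types A B C : algType k.

Definition hopf_morphism A B (hA : hopf A) (hB : hopf B)
    (f : {lrmorphism A -> B}) : Prop :=
  [/\ forall a, comul hB (f a) = tens_map f f (comul hA a),
      forall a, counit hB (f a) = counit hA a &
      forall a, antipode hB (f a) = f (antipode hA a)].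

Definition hopf_subalgebra A (hA : hopf A) (Z : {pred A}) : Prop :=
  [/\ GRing.subalg_closed Z,
      forall z, z \in Z -> exists2 s : seq (A * A),
        all (fun t => (t.1 \in Z) && (t.2 \in Z)) s &
        comul hA z = \sum_(t <- s) t.1 ⊗' t.2 &
      forall z, z \in Z -> antipode hA z \in Z].

Definition central A (Z : {pred A}) : Prop :=
  forall z, z \in Z -> forall a, z * a = a * z.

Definition short_exact A C B (hA : hopf A) (hC : hopf C) (hB : hopf B)
    (iota : {lrmorphism A -> C}) (pi : {lrmorphism C -> B}) : Prop :=
  [/\ hopf_morphism hA hC iota /\ hopf_morphism hC hB pi,
      injective iota,
      forall b, exists c, pi c = b,
      forall c, pi c = 0 <->
        exists2 s : seq (C * A), all (fun t => counit hA t.2 == 0) s &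
          c = \sum_(t <- s) t.1 * iota t.2 &
      forall c, (exists a, iota a = c) <->
        tens_map id pi (comul hC c) = c ⊗' 1].

Definition fg_free_over A (S : seq A) : Prop :=
  exists (n : nat) (e : 'I_n -> A), forall a,
    exists! c : {ffun 'I_n -> subalg S}, a = \sum_i incl (c i) * e i.

End HopfDefs.

Variant double_gen := gen_u | gen_v | gen_zeta | gen_g | gen_gV | gen_x | gen_y.
HB.instance Definition _ := gen_eqMixin double_gen.
HB.instance Definition _ := gen_choiceMixin double_gen.

Section Relations.
Variables (k : fieldType) (A : algType k) (c : double_gen -> A).

Local Notation u := (c gen_u).
Local Notation v := (c gen_v).
Local Notation zeta := (c gen_zeta).
Local Notation g := (c gen_g).
Local Notation gV := (c gen_gV).
Local Notation x := (c gen_x).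
Local Notation y := (c gen_y).

Definition double_rels : seq (A * A) :=
  [:: (g * gV, 1);
      (gV * g, 1);
      (g * x, x * g);
      (g * y, y * g + x * g);
      (y * x, x * y - 2^-1 *: x ^+ 2);
      (v * zeta, zeta * v + v);
      (u * zeta, zeta * u + u);
      (v * u, u * v - 2^-1 *: u ^+ 2);
      (zeta * y, y * zeta + y);
      (zeta * x, x * zeta + x);
      (v * g, g * v + g * u);
      (u * g, g * u);
      (v * x, x * v + (1 - g) + x * u);
      (u * x, x * u);
      (u * y, y * u + (1 - g));
      (v * y, y * v - g * zeta + y * u);
      (zeta * g, g * zeta)].

Definition restricted_rels (p : nat) : seq (A * A) :=
  double_rels ++
  [:: (g ^+ p, 1);
      (x ^+ p, 0);
      (y ^+ p, 0);
      (u ^+ p, 0);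
      (v ^+ p, 0);
      (zeta ^+ p, zeta)].

End Relations.

(* The prescribed values of the coproduct; they determine the Hopf structure  *)
(* of an algebra generated by the c i.                                        *)
Definition double_coproduct (k : fieldType) (A : algType k) (hA : hopf A)
    (c : double_gen -> A) : Prop :=
  let D := comul hA in
  [/\ D (c gen_g) = c gen_g ⊗' c gen_g,
      D (c gen_x) = c gen_x ⊗' 1 + c gen_g ⊗' c gen_x /\
      D (c gen_y) = c gen_y ⊗' 1 + c gen_g ⊗' c gen_y,
      D (c gen_zeta) = c gen_zeta ⊗' 1 + 1 ⊗' c gen_zeta,
      D (c gen_u) = c gen_u ⊗' 1 + 1 ⊗' c gen_u &
      D (c gen_v) = c gen_v ⊗' 1 + 1 ⊗' c gen_v + c gen_zeta ⊗' c gen_u].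

Section RelationsMap.
Variables (k : fieldType) (A B : algType k) (f : {lrmorphism A -> B}).
Variable c : double_gen -> A.

Lemma double_rels_map :
  [seq (f r.1, f r.2) | r <- double_rels c] = double_rels (f \o c).
Proof.
by rewrite /double_rels /= !expr2 ?(rmorph1, linearB, linearD, linearZ) /= ?rmorphM
  ?linearN ?linearZ /= ?rmorphM ?rmorph1.
Qed.

Lemma restricted_rels_map p :
  [seq (f r.1, f r.2) | r <- restricted_rels c p] = restricted_rels (f \o c) p.
Proof.
by rewrite /restricted_rels map_cat double_rels_map /= ?(rmorph0, rmorph1) ?rmorphXn.
Qed.

End RelationsMap.

Section ArtinSchreier.
Variables (k : fieldType) (p : nat) (pcharp : p \in [pchar k]).

Lemma prod_XDn_pchar : \prod_(1 <= i < p.+1) ('X + i%:R - 1) = 'X^p - 'X :> {poly k}.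
Proof.
have p1 : (1 < p)%N by exact: prime_gt1 (pcharf_prime pcharp).
pose rs : seq k := [seq 1 - i%:R | i <- index_iota 1 p.+1].
have sX : size ('X^p - 'X : {poly k}) = p.+1.
  by rewrite size_polyDl ?size_polyXn // size_polyN size_polyX.
have lX : lead_coef ('X^p - 'X : {poly k}) = 1.
  by rewrite lead_coefDl ?lead_coefXn // size_polyXn size_polyN size_polyX.
rewrite [RHS](@all_roots_prod_XsubC _ _ rs) ?lX ?scale1r ?big_map.
- by apply: eq_bigr => i _; rewrite polyCB polyC1 polyC_natr opprB addrA.
- by rewrite sX size_map size_iota subn1.
- apply/allP => _ /mapP[i _ ->]; rewrite rootE !hornerE.
  by rewrite -(pFrobenius_autE pcharp) rmorphB rmorph1 rmorph_nat subrr.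
rewrite uniq_rootsE map_inj_in_uniq ?iota_uniq // => i j.
rewrite !mem_index_iota => iI jI /addrI /oppr_inj.
wlog ij : i j iI jI / (i <= j)%N => [H E|].
  by case/orP: (leq_total i j) => ij; [apply: H|apply/esym/H].
move=> /esym/eqP; rewrite -subr_eq0 -natrB // -(dvdn_pcharf pcharp) => pd.
have [ji|/(dvdn_leq)] := posnP (j - i)%N.
  by apply/eqP; rewrite eqn_leq ij -subn_eq0 ji.
by move/(_ _ pd); lia.
Qed.

Lemma prod_Dn_pchar (A : algType k) (z : A) :
  \prod_(1 <= i < p.+1) (z + i%:R - 1) = z ^+ p - z.
Proof.
have /(congr1 (horner_alg z)) := prod_XDn_pchar.
rewrite rmorphB rmorphXn /= horner_algX rmorph_prod => <-.
by apply: eq_bigr => i _; rewrite rmorphB rmorphD rmorph1 rmorph_nat /= horner_algX.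
Qed.

End ArtinSchreier.

Section Double.
Variable k : fieldType.

Local Notation free_gen := (@free_gen k double_gen).

(* The values of the counit on the generators. *)
Definition double_aug (i : double_gen) : k^o :=
  if i is (gen_g | gen_gV) then 1 else 0.

Lemma double_aug_rels p r : (0 < p)%N ->
  r \in restricted_rels double_aug p -> r.1 = r.2.
Proof.
move=> p0 rR; apply/eqP; move: r rR; apply/allP.
rewrite /restricted_rels /double_rels all_cat /=.
by rewrite !(mulr0, mul0r, mulr1, addr0, subrr, scaler0, expr1n, expr0n) !eqxx gtn_eqF //= !eqxx.
Qed.

Lemma restricted_rels_cons p : (0 < p)%N ->
  consistent (restricted_rels free_gen p).
Proof.
move=> p0; apply: (@consistentP _ _ _ _ (free_lift double_aug)) => r rR.
set f := free_lift double_aug; apply: (@double_aug_rels p (f r.1, f r.2)) => //.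
have E : double_aug = f \o free_gen by apply/funext => i; rewrite /= /f free_liftE.
by rewrite [X in restricted_rels X _]E -restricted_rels_map; apply/mapP; exists r.
Qed.

Lemma double_rels_cons : consistent (double_rels free_gen).
Proof.
move=> [s sR E]; apply: (@restricted_rels_cons 1 isT); exists s => //.
by apply/allP => t /(allP sR) tR; rewrite mem_cat tR.
Qed.

(* The double of the Jordan plane. *)
Definition Dtilde : algType k := quot_alg double_rels_cons.
Definition Dtilde_gen (i : double_gen) : Dtilde := to_quot _ (free_gen i).

Variables (p : nat) (pcharp : p \in [pchar k]).

Lemma pchar_gt0 : (0 < p)%N.
Proof. exact: prime_gt0 (pcharf_prime pcharp). Qed.

(* The Drinfeld double of the bosonization of the restricted Jordan plane;    *)
(* since g ^+ p = 1, the generator gV is g ^+ p.-1.                           *)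
Definition DH : algType k := quot_alg (restricted_rels_cons pchar_gt0).
Definition DH_gen (i : double_gen) : DH := to_quot _ (free_gen i).

Lemma double_sub_restricted :
  {subset double_rels free_gen <= restricted_rels free_gen p}.
Proof. by move=> r rR; rewrite mem_cat rR. Qed.

Definition double_proj : {lrmorphism Dtilde -> DH} :=
  @quot_map _ _ _ _ double_rels_cons _ double_sub_restricted.

Lemma double_projE i : double_proj (Dtilde_gen i) = DH_gen i.
Proof. exact: quot_mapE. Qed.

Definition zeta_p : Dtilde :=
  \prod_(1 <= i < p.+1) (Dtilde_gen gen_zeta + i%:R - 1).

Lemma zeta_pE : zeta_p = Dtilde_gen gen_zeta ^+ p - Dtilde_gen gen_zeta.
Proof. exact: prod_Dn_pchar. Qed.

Definition Zgens : seq Dtilde :=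
  [:: Dtilde_gen gen_g ^+ p; Dtilde_gen gen_gV ^+ p; Dtilde_gen gen_x ^+ p;
      Dtilde_gen gen_y ^+ p; Dtilde_gen gen_u ^+ p; Dtilde_gen gen_v ^+ p;
      zeta_p].

End Double.

Section Laurent.
Variable k : fieldType.

(* k[T, T^-1], where T is the generator true and T^-1 the generator false. *)
Definition laurent_rels : seq (free_alg k bool * free_alg k bool) :=
  [:: (free_gen k true * free_gen k false, 1);
      (free_gen k false * free_gen k true, 1)].

Lemma laurent_rels_cons : consistent laurent_rels.
Proof.
apply: (@consistentP _ _ _ _ (free_lift (fun=> 1 : k^o))) => r.
rewrite !inE => /orP[] /eqP ->; rewrite [LHS]rmorphM [RHS]rmorph1 /=.
  by rewrite !free_liftE mulr1.
by rewrite !free_liftE mulr1.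
Qed.

Definition laurent : algType k := quot_alg laurent_rels_cons.

End Laurent.

(* Over an algebraically closed field, an affine algebraic group is described *)
(* by its group of points together with the coordinate functions of a closed  *)
(* embedding of the points in an affine space.                                *)
Record aff_group (k : fieldType) := AffGroup {
  ag_points :> groupType;
  ag_coords : seq (ag_points -> k)
}.

Section FunAlgebra.
Variables (k : fieldType) (G : groupType).

Definition fun_alg := G -> k^o.

HB.instance Definition _ := GRing.Lmodule.on fun_alg.
HB.instance Definition _ := GRing.PzRing.on fun_alg.

Lemma fun_alg_oner_neq0 : (1 : fun_alg) != 0.
Proof.
by apply/eqP => /(congr1 (@^~ 1%g)) /eqP; rewrite /= oner_eq0.
Qed.

HB.instance Definition _ := GRing.PzSemiRing_isNonZero.Build fun_alg fun_alg_oner_neq0.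

Lemma fun_alg_scaleAl (c : k) (f h : fun_alg) : c *: (f * h) = (c *: f) * h.
Proof. by apply/funext => x; exact: mulrA. Qed.
Lemma fun_alg_scaleAr (c : k) (f h : fun_alg) : c *: (f * h) = f * (c *: h).
Proof. by apply/funext => x; exact: mulrCA. Qed.

HB.instance Definition _ := GRing.Lmodule_isLalgebra.Build k fun_alg fun_alg_scaleAl.
HB.instance Definition _ := GRing.Lalgebra_isAlgebra.Build k fun_alg fun_alg_scaleAr.

End FunAlgebra.

(* The algebra of regular functions: polynomials in the coordinates. *)
Definition regfun (k : fieldType) (G : aff_group k) : algType k :=
  @subalg k (fun_alg k G) (ag_coords G).

Definition regfun_eval (k : fieldType) (G : aff_group k) (f : regfun G) (g : G) : k :=
  incl f g.

(* The Hopf structure of O(G): (Delta f)(g, h) = f (g h), where elements of   *)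
(* O(G) (x) O(G) are viewed as functions on G x G.                            *)
Definition regfun_coproduct (k : fieldType) (G : aff_group k) (hG : hopf (regfun G)) :=
  forall (f : regfun G) (g h : G),
    tens_lift (fun a b : regfun G => regfun_eval a g * regfun_eval b h : k^o)
      (comul hG f)
    = regfun_eval f (g * h)%g.

Section Groups.
Variable k : fieldType.

Definition Ga_pt : Type := k.
HB.instance Definition _ := Choice.on Ga_pt.
HB.instance Definition _ := isGroup.Build Ga_pt
  (@addrA k) (@add0r k) (@addr0 k) (@addNr k) (@addrN k).

Definition Ga : aff_group k := AffGroup [:: (id : Ga_pt -> k)].

Definition Gm_pt : Type := {c : k | c != 0}.
HB.instance Definition _ := SubChoice.on Gm_pt.

Definition gm_one : Gm_pt := Sub 1 (oner_neq0 k).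
Definition gm_mul (a b : Gm_pt) : Gm_pt := Sub (val a * val b) (mulf_neq0 (valP a) (valP b)).
Lemma gm_inv_subproof (a : Gm_pt) : (val a)^-1 != 0.
Proof. by rewrite invr_eq0; exact: (valP a). Qed.
Definition gm_inv (a : Gm_pt) : Gm_pt := Sub (val a)^-1 (gm_inv_subproof a).

Lemma gm_mulA : associative gm_mul.
Proof. by move=> a b c; apply: val_inj; rewrite /= mulrA. Qed.
Lemma gm_mul1 : left_id gm_one gm_mul.
Proof. by move=> a; apply: val_inj; rewrite /= mul1r. Qed.
Lemma gm_mulr1 : right_id gm_one gm_mul.
Proof. by move=> a; apply: val_inj; rewrite /= mulr1. Qed.
Lemma gm_mulV : left_inverse gm_one gm_inv gm_mul.
Proof. by move=> a; apply: val_inj; rewrite /= mulVf ?(valP a). Qed.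
Lemma gm_mulrV : right_inverse gm_one gm_inv gm_mul.
Proof. by move=> a; apply: val_inj; rewrite /= mulfV ?(valP a). Qed.
HB.instance Definition _ := isGroup.Build Gm_pt gm_mulA gm_mul1 gm_mulr1 gm_mulV gm_mulrV.

Definition Gm : aff_group k :=
  AffGroup [:: (fun a : Gm_pt => val a); (fun a : Gm_pt => (val a)^-1)].

End Groups.

(* (n, a) (n', a') = (n (a . n'), a a') *)
Record group_action (N K : groupType) := GroupAction {
  gact :> K -> N -> N;
  gact1 : forall n, gact 1%g n = n;
  gactM : forall a b n, gact (a * b)%g n = gact a (gact b n);
  gactg : forall a n m, gact a (n * m)%g = (gact a n * gact a m)%g
}.

Section SemidirectProduct.
Variables (N K : groupType) (act : group_action N K).
Local Open Scope group_scope.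

Definition sdprod_pt of group_action N K : Type := (N * K)%type.
Local Notation S := (sdprod_pt act).
HB.instance Definition _ := Choice.on S.

Definition sd_one : S := (1, 1).
Definition sd_mul (s t : S) : S := (s.1 * act s.2 t.1, s.2 * t.2).
Definition sd_inv (s : S) : S := (act s.2^-1 s.1^-1, s.2^-1).

Lemma gact_1 a : act a 1 = 1.
Proof. by apply: (mulgI (act a 1)); rewrite -gactg !mulg1. Qed.

Lemma sd_mulA : associative sd_mul.
Proof. by move=> [n a] [m b] [l c]; rewrite /sd_mul /= gactM gactg !mulgA. Qed.
Lemma sd_mul1 : left_id sd_one sd_mul.
Proof. by move=> [n a]; rewrite /sd_mul /= gact1 !mul1g. Qed.
Lemma sd_mulr1 : right_id sd_one sd_mul.
Proof. by move=> [n a]; rewrite /sd_mul /= gact_1 !mulg1. Qed.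
Lemma sd_mulV : left_inverse sd_one sd_inv sd_mul.
Proof.
by move=> [n a]; rewrite /sd_mul /sd_inv /= -gactg !mulVg gact_1.
Qed.
Lemma sd_mulrV : right_inverse sd_one sd_inv sd_mul.
Proof.
by move=> [n a]; rewrite /sd_mul /sd_inv /= -gactM !mulgV gact1 mulgV.
Qed.
HB.instance Definition _ := isGroup.Build S sd_mulA sd_mul1 sd_mulr1 sd_mulV sd_mulrV.

End SemidirectProduct.

Section Products.
Variables (k : fieldType).

Definition sdprod_aff (N K : aff_group k) (act : group_action N K) : aff_group k :=
  @AffGroup k (sdprod_pt act)
    ([seq (fun s : sdprod_pt act => f s.1) | f <- ag_coords N] ++
     [seq (fun s : sdprod_pt act => f s.2) | f <- ag_coords K]).

Definition trivial_action (N K : groupType) : group_action N K :=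
  @GroupAction N K (fun _ n => n) (fun=> erefl) (fun _ _ _ => erefl) (fun _ _ _ => erefl).

Definition dprod_aff (N K : aff_group k) : aff_group k :=
  sdprod_aff (trivial_action N K).

End Products.

Section Heisenberg.
Variable k : fieldType.

Definition unitriangular : {pred 'M[k]_3} :=
  [pred M : 'M[k]_3 | [forall i : 'I_3, forall j : 'I_3, (j <= i)%N ==> (M i j == (i == j)%:R)]].

Definition H3_pt := {M : 'M[k]_3 | M \in unitriangular}.
HB.instance Definition _ := SubChoice.on H3_pt.

Lemma unitriangularP (M : 'M[k]_3) :
  reflect (forall i j : 'I_3, (j <= i)%N -> M i j = (i == j)%:R) (M \in unitriangular).
Proof.
apply: (iffP 'forall_forallP) => H i j; first by move=> ij; have /implyP/(_ ij)/eqP := H i j.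
by apply/implyP => ij; rewrite H.
Qed.

Lemma unitriangular1 : 1%:M \in unitriangular.
Proof. by apply/unitriangularP => i j _; rewrite mxE. Qed.

Lemma unitriangularM M N :
  M \in unitriangular -> N \in unitriangular -> M *m N \in unitriangular.
Proof.
move=> /unitriangularP MU /unitriangularP NU; apply/unitriangularP => i j ij.
rewrite mxE (bigD1 i) //= MU // eqxx mul1r NU // big1 ?addr0 // => l li.
have [il|il] := ltnP i l; last by rewrite MU // (negbTE (_ : i != l)) ?mul0r // eq_sym.
by rewrite NU ?(leq_trans ij (ltnW il)) // -val_eqE gtn_eqF ?mulr0 //= (leq_ltn_trans ij).
Qed.

(* The inverse of M is 1 - (M - 1) + (M - 1) ^ 2. *)
Definition h3_invmx (M : 'M[k]_3) : 'M[k]_3 :=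
  1%:M - (M - 1%:M) + (M - 1%:M) *m (M - 1%:M).

Lemma h3_nilp M : M \in unitriangular ->
  (M - 1%:M) *m (M - 1%:M) *m (M - 1%:M) = 0.
Proof.
move=> /unitriangularP MU; set N := M - 1%:M.
have N0 (i j : 'I_3) : (j <= i)%N -> N i j = 0.
  by move=> ij; rewrite !mxE MU // subrr.
apply/matrixP => i j; rewrite !mxE big1 // => l _; rewrite mxE mulr_suml big1 // => m _.
have [im|/N0 ->] := ltnP i m; last by rewrite !mul0r.
have [ml|/N0 ->] := ltnP m l; last by rewrite mulr0 mul0r.
have [lj|/N0 ->] := ltnP l j; last by rewrite mulr0.
by have := leq_ltn_trans (leq_ltn_trans im ml) lj; case: j lj => [[|[|[|]]]].
Qed.

Lemma h3_invmxK M : M \in unitriangular -> h3_invmx M *m M = 1%:M.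
Proof.
move=> /h3_nilp.
have H (N : 'M[k]_3) : N *m N *m N = 0 -> (1%:M - N + N *m N) *m (N + 1%:M) = 1%:M.
  move=> N3; rewrite mulmxDr mulmx1 !mulmxDl N3 mul1mx mulNmx addr0.
  by rewrite addrACA addNr addr0 addrC subrK.
by move=> /H; rewrite subrK.
Qed.

Lemma h3_invmxP M : M \in unitriangular -> h3_invmx M \in unitriangular.
Proof.
move=> MU; have NU (i j : 'I_3) : (j <= i)%N -> (M - 1%:M) i j = 0.
  by move=> ij; rewrite !mxE (unitriangularP _ MU) // subrr.
apply/unitriangularP => i j ij; rewrite /h3_invmx 2!mxE [X in _ + X + _]mxE NU // oppr0 addr0.
rewrite [X in _ + X]mxE big1 ?addr0 ?mxE // => l _.
have [il|/NU ->] := ltnP i l; last by rewrite mul0r.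
by rewrite [X in _ * X]NU ?mulr0 // (leq_trans ij (ltnW il)).
Qed.

Definition h3_one : H3_pt := Sub 1%:M unitriangular1.
Definition h3_mul (M N : H3_pt) : H3_pt :=
  Sub (val M *m val N) (unitriangularM (valP M) (valP N)).
Definition h3_inv (M : H3_pt) : H3_pt := Sub (h3_invmx (val M)) (h3_invmxP (valP M)).

Lemma h3_mulA : associative h3_mul.
Proof. by move=> L M N; apply: val_inj; rewrite /= mulmxA. Qed.
Lemma h3_mul1 : left_id h3_one h3_mul.
Proof. by move=> M; apply: val_inj; rewrite /= mul1mx. Qed.
Lemma h3_mulr1 : right_id h3_one h3_mul.
Proof. by move=> M; apply: val_inj; rewrite /= mulmx1. Qed.
Lemma h3_mulV : left_inverse h3_one h3_inv h3_mul.
Proof. by move=> M; apply: val_inj; rewrite /= h3_invmxK ?(valP M). Qed.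
Lemma h3_mulrV : right_inverse h3_one h3_inv h3_mul.
Proof.
by move=> M; apply: val_inj; apply: mulmx1C; rewrite /= h3_invmxK ?(valP M).
Qed.
HB.instance Definition _ := isGroup.Build H3_pt h3_mulA h3_mul1 h3_mulr1 h3_mulV h3_mulrV.

Definition H3 : aff_group k :=
  AffGroup [seq (fun M : H3_pt => val M ij.1 ij.2) | ij <- enum {: 'I_3 * 'I_3}].

End Heisenberg.

Section GroupB.
Variable k : fieldType.

Local Notation GaGa := (dprod_aff (Ga k) (Ga k)).

Definition scaling (a : Gm k) (r : GaGa) : GaGa := (val a * r.1, val a * r.2).

Lemma scaling1 r : scaling 1%g r = r.
Proof. by case: r => r1 r2; rewrite /scaling /= !mul1r. Qed.
Lemma scalingM a b r : scaling (a * b)%g r = scaling a (scaling b r).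
Proof. by rewrite /scaling /= !mulrA. Qed.
Lemma scalingD a r s : scaling a (r * s)%g = (scaling a r * scaling a s)%g.
Proof. by rewrite /scaling; congr (_, _); exact: mulrDr. Qed.

Definition scaling_action : group_action GaGa (Gm k) :=
  GroupAction scaling1 scalingM scalingD.

Definition groupB : aff_group k := dprod_aff (sdprod_aff scaling_action) (H3 k).

End GroupB.

(* Main.v *)
From HB Require Import structures.
From mathcomp Require Import all_boot all_algebra.
From mathcomp Require Import ring zify.
From mathcomp Require Import boolp functions.
From mathcomp Require Import mpoly.
From mathcomp Require finmap monalg.
Require Import Defs.

(** Why the proposition holds.

    Centrality. In characteristic p, [a^p, b] is the p-th iterate of ad a on b
    (iter_ad_pchar). On the generators these iterates vanish, because they produce
    factorials up to p! or stop early, and ad zeta is its own p-th iterate.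

    Freeness. Adjoining the generators one at a time shows that the monomials with
    exponents less than p generate the double over Z (Dtilde_spans). For their
    independence the double is made to act on functions of exponents, as it acts on
    linear forms on itself (pbw_rep). This action contains enough joint eigenfunctions
    of Z (act_twisted): for every point with nonzero first coordinate there are ones on
    which the generators of Z act by the coordinates of that point. Evaluating a
    relation on them shows that its coefficients, as polynomials in the generators of Z,
    vanish at all these points, hence are zero, the field being infinite (zpoly_indep).
    The same result shows that the generators of Z satisfy no other relation than the
    invertibility of g^p (zlift_inj), so that Z is a Laurent polynomial algebra and a
    domain.

    Coproducts. Those of g^p, x^p, u^p and zeta^p - zeta follow from the additivity of
    the p-th power on commuting elements. Those of y^p and v^p are powers of sums in
    which one term translates the other within a Jordan plane; these powers are computed
    in jordan_add_pchar and jordan_translate_pchar. The latter produces the product of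
    the b + q/2, which is where the term (zeta^p - zeta) (x) u^p of the coproduct of v^p
    comes from. So Z is a Hopf subalgebra.

    Exactness. The relations which the restricted double adds say that the generators of
    Z are equal to their counits, so the kernel is the ideal generated by Z^+. For the
    coinvariants, the coordinate at the monomial 1 is a Z-linear retraction rho of the
    inclusion of Z, and a (x) b |-> a S(b_1) rho(b_2) descends to the quotient
    in its second factor; it maps Delta(c) to rho(c) and c (x) 1 to c
    (coinvariantP).

    Regular functions. Evaluation at the points identifies the same Laurent
    polynomial algebra with the functions on B (lp_regfun_inj, lp_regfun_surj), and the
    coproducts computed above are the multiplication of B in coordinates
    (phi_coproduct). *)

Set Implicit Arguments.
Unset Strict Implicit.
Unset Printing Implicit Defensive.

Import GRing.Theory.
Local Open Scope ring_scope.

(** * Algebras of linear endomorphisms *)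

Section Endo.
Variables (k : fieldType) (V : lmodType k).

Definition endo_pred : {pred V -> V} := [pred f | `[< linear f >]].

Lemma endo_submod_closed : GRing.submod_closed endo_pred.
Proof.
split=> [|c f g /asboolP fL /asboolP gL]; apply/asboolP => a v w /=.
  by rewrite scaler0 addr0.
rewrite !fctE fL gL !scalerDr !scalerA [c * a]mulrC -!addrA; congr (_ + _).
by rewrite addrCA.
Qed.

HB.instance Definition _ := GRing.isSubmodClosed.Build k (V -> V) endo_pred endo_submod_closed.

(** V is taken nonzero, for its endomorphisms to form a nontrivial ring. *)
Definition endo of {v : V | v != 0} := {f : V -> V | f \in endo_pred}.

Variable V0 : {v : V | v != 0}.
Local Notation E := (endo V0).

HB.instance Definition _ := [isSub of E for @sval (V -> V) _].
HB.instance Definition _ := [Choice of E by <:].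
HB.instance Definition _ := [SubChoice_isSubLmodule of E by <:].

Lemma endoP (f : E) : linear (val f).
Proof. exact/asboolP/(valP f). Qed.

Definition endo_of (f : V -> V) (fL : linear f) : E := Sub f (asboolT fL).

Lemma endo1_linear : linear (id : V -> V). Proof. by []. Qed.
Lemma endoM_linear (f g : E) : linear (val f \o val g).
Proof. by move=> c v w; rewrite /= !endoP. Qed.

Lemma endo_ext (f g : E) : (forall v, val f v = val g v) -> f = g.
Proof. by move=> fg; apply: val_inj; apply/funext. Qed.

Definition endo1 := endo_of endo1_linear.
Definition endoM f g := endo_of (endoM_linear f g).

Lemma endoMA : associative endoM. Proof. by move=> f g h; apply: val_inj. Qed.
Lemma endo1M : left_id endo1 endoM. Proof. by move=> f; apply: val_inj. Qed.
Lemma endoM1 : right_id endo1 endoM. Proof. by move=> f; apply: val_inj. Qed.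
Lemma endoMDl : left_distributive endoM +%R.
Proof. by move=> f g h; apply: val_inj. Qed.
Lemma endoMDr : right_distributive endoM +%R.
Proof.
move=> f g h; apply: val_inj; apply/funext => v /=.
by have := endoP f 1 (val g v) (val h v); rewrite !scale1r.
Qed.
Lemma endo1_neq0 : endo1 != 0.
Proof.
case: V0 => v; apply: contraNneq => /(congr1 val) /(congr1 (@^~ v)) /= vv.
exact/eqP.
Qed.

HB.instance Definition _ := GRing.Zmodule_isNzRing.Build E
  endoMA endo1M endoM1 endoMDl endoMDr endo1_neq0.

Lemma endo_scaleAl c (f g : E) : c *: (f * g) = (c *: f) * g.
Proof. by apply: val_inj. Qed.
Lemma endo_scaleAr c (f g : E) : c *: (f * g) = f * (c *: g).
Proof.
apply: endo_ext => v /=; rewrite !fctE.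
have f0 : val f 0 = 0.
  by apply: (addrI (val f 0)); have := endoP f 1 0 0; rewrite !scale1r !addr0 => <-.
by have := endoP f c (val g v) 0; rewrite f0 !addr0 => <-.
Qed.

HB.instance Definition _ := GRing.Lmodule_isLalgebra.Build k E endo_scaleAl.
HB.instance Definition _ := GRing.Lalgebra_isAlgebra.Build k E endo_scaleAr.

Lemma endo_addE (f g : E) v : val (f + g) v = val f v + val g v. Proof. by []. Qed.
Lemma endo_oppE (f : E) v : val (- f) v = - val f v. Proof. by []. Qed.

End Endo.

(** * A representation of the double on functions of exponents *)

(** The relations of a list as one conjunction, for them to be proved or used
    separately. *)
Definition all_rels (T : Type) (s : seq (T * T)) : Prop :=
  foldr (fun r P => r.1 = r.2 /\ P) True s.

Lemma all_relsP (T : eqType) (s : seq (T * T)) :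
  (forall r, r \in s -> r.1 = r.2) <-> all_rels s.
Proof.
elim: s => [|x s [IH1 IH2]] //=; split=> [H|[H1 H2] r].
  split; first by apply: H; rewrite mem_head.
  by apply: IH1 => r rs; apply: H; rewrite inE rs orbT.
by rewrite inE => /orP[/eqP -> //|]; apply: IH2.
Qed.

Section Presentation.
Variables (k : fieldType) (B : algType k) (b : double_gen -> B).

Definition Dtilde_lift of (forall r, r \in double_rels b -> r.1 = r.2) :
  Dtilde k -> B := quot_lift (free_lift b).

Hypothesis bR : forall r, r \in double_rels b -> r.1 = r.2.
Local Notation lift := (Dtilde_lift bR).

Lemma Dtilde_liftQ a : lift (to_quot _ a) = free_lift b a.
Proof.
apply: quot_liftE => r rR; apply: (bR (r := (_, _))).
have E : b = free_lift b \o @free_gen k _ by apply/funext => i; rewrite /= free_liftE.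
by rewrite [X in double_rels X]E -double_rels_map; apply/mapP; exists r.
Qed.

Lemma Dtilde_lift_additive : zmod_morphism lift.
Proof.
move=> x y; have [a ->] := to_quot_surj x; have [c ->] := to_quot_surj y.
by rewrite -rmorphB !Dtilde_liftQ rmorphB.
Qed.
Lemma Dtilde_lift_monoid : monoid_morphism lift.
Proof.
split=> [|x y]; first by rewrite -(rmorph1 (to_quot _)) Dtilde_liftQ rmorph1.
have [a ->] := to_quot_surj x; have [c ->] := to_quot_surj y.
by rewrite -rmorphM !Dtilde_liftQ rmorphM.
Qed.
Lemma Dtilde_lift_scalable : scalable lift.
Proof.
by move=> c x; have [a ->] := to_quot_surj x; rewrite -linearZ !Dtilde_liftQ linearZ.
Qed.

HB.instance Definition _ := GRing.isZmodMorphism.Build _ _ lift Dtilde_lift_additive.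
HB.instance Definition _ := GRing.isMonoidMorphism.Build _ _ lift Dtilde_lift_monoid.
HB.instance Definition _ := GRing.isScalable.Build k _ _ *:%R lift Dtilde_lift_scalable.

Lemma Dtilde_liftE i : lift (Dtilde_gen k i) = b i.
Proof. by rewrite /Dtilde_gen Dtilde_liftQ free_liftE. Qed.

End Presentation.

(** The double acts on linear forms on itself by (a f)(w) = f(w a). A linear form
    is recorded by its values on the ordered words v^j zeta^l u^i g^m y^r x^n,
    which are expected to form a basis; since zeta spans a polynomial algebra, the
    exponent l is replaced by a value s of zeta, and f j s i m r n stands for the
    value of f at v^j (zeta = s) u^i g^m y^r x^n. Each operator below rewrites the
    product of such a word by a generator in terms of ordered words. That the
    operators satisfy the defining relations is a finite computation, and it
    replaces the verification that the ordered words are linearly independent. *)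
Section Rep.
Variable k : fieldType.

Definition pbw_fun : lmodType k := nat -> k -> nat -> int -> nat -> nat -> k^o.
Implicit Types f : pbw_fun.

Definition op_x f : pbw_fun := fun j s i m r n => f j s i m r n.+1.
Definition op_y f : pbw_fun := fun j s i m r n =>
  f j s i m r.+1 n + n%:R / 2%:R * f j s i m r n.+1.
Definition op_t f : pbw_fun := fun j s i m r n => f j s i (m + 1) r n.
Definition op_tV f : pbw_fun := fun j s i m r n => f j s i (m - 1) r n.
(** The transpose of the automorphism y |-> y - x/2 of the Jordan plane, of which the
    square is y |-> g^-1 y g, whence op_g = op_h ^ 2 op_t. *)
Definition op_h f : pbw_fun := fun j s i m r n =>
  f j s i m r n - r%:R / 2%:R * f j s i m r.-1 n.+1.
(** Since op_h f only involves f at r and r - 1, it is inverted by recursion on r. *)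
Fixpoint hinv (F : nat -> nat -> k) (r n : nat) : k :=
  if r is r'.+1 then F r n + r%:R / 2%:R * hinv F r' n.+1 else F r n.
Definition op_hV f : pbw_fun := fun j s i m => hinv (f j s i m).
Definition op_g f := op_h (op_h (op_t f)).
Definition op_gV f := op_tV (op_hV (op_hV f)).
Definition op_u f : pbw_fun := fun j s i m r n =>
  f j s i.+1 m r n - r%:R * (f j s i m r.-1 n - op_h (op_t f) j s i m r.-1 n).
Definition op_zeta f : pbw_fun := fun j s i m r n =>
  (s - n%:R - r%:R + i%:R) * f j s i m r n.
Definition op_v f : pbw_fun := fun j s i m r n =>
  f j.+1 (s + 1) i m r n + (i%:R / 2%:R - m%:~R - r%:R) * f j s i.+1 m r n
  - n%:R * (f j s i m r n.-1 - op_g f j s i m r n.-1) - n%:R * op_u f j s i m r n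
  + r%:R * (s + i%:R - r%:R) * op_h (op_t f) j s i m r.-1 n
  + r%:R * (r%:R + 1) / 2%:R * f j s i m r.-1 n.

Ltac pw := let j := fresh "j" in let s := fresh "s" in let i := fresh "i" in
  let m := fresh "m" in let r := fresh "r" in let n := fresh "n" in
  apply/funext => j; apply/funext => s; apply/funext => i; apply/funext => m;
  apply/funext => r; apply/funext => n.

Lemma op_hK : cancel op_h op_hV.
Proof.
move=> f; pw; rewrite /op_hV; elim: r n => [|r IH] n /=.
  by rewrite /op_h mul0r mul0r subr0.
by rewrite IH /op_h /= subrK.
Qed.

Lemma op_hVK : cancel op_hV op_h.
Proof. by move=> f; pw; case: r => [|r]; rewrite /op_h /op_hV /= ?mul0r ?subr0 ?addrK. Qed.

Lemma op_tK : cancel op_t op_tV.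
Proof. by move=> f; pw; rewrite /op_tV /op_t subrK. Qed.

Lemma op_tVK : cancel op_tV op_t.
Proof. by move=> f; pw; rewrite /op_tV /op_t addrK. Qed.

Lemma hinv_linear c F G r n :
  hinv (fun r n => c * F r n + G r n) r n = c * hinv F r n + hinv G r n.
Proof. by elim: r n => [|r IH] n //=; rewrite IH; ring. Qed.

Definition pbw_op (i : double_gen) : pbw_fun -> pbw_fun :=
  match i with
  | gen_u => op_u | gen_v => op_v | gen_zeta => op_zeta | gen_g => op_g
  | gen_gV => op_gV | gen_x => op_x | gen_y => op_y
  end.

Lemma pbw_op_linear i : linear (pbw_op i).
Proof.
case: i => c f f'; rewrite /=; pw; rewrite !fctE.
- by rewrite /op_u /op_h /op_t !fctE /GRing.scale /=; ring.
- by rewrite /op_v /op_u /op_g /op_h /op_t !fctE /GRing.scale /=; ring.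
- by rewrite /op_zeta !fctE /GRing.scale /=; ring.
- by rewrite /op_g /op_h /op_t !fctE /GRing.scale /=; ring.
- rewrite /op_gV /op_tV /op_hV /GRing.scale /= -hinv_linear.
  by congr hinv; apply/funext => r'; apply/funext => n'; rewrite -hinv_linear.
- by [].
- by rewrite /op_y !fctE /GRing.scale /=; ring.
Qed.

Lemma pbw_fun_neq0 : ((fun _ _ _ _ _ _ => 1) : pbw_fun) != 0.
Proof.
apply/eqP => /(congr1 (fun f : pbw_fun => f 0%N 0 0%N 0 0%N 0%N)) /eqP.
exact: (negP (negbT (oner_eq0 k))).
Qed.

Definition pbw_endo : algType k := endo (exist (fun f : pbw_fun => f != 0) _ pbw_fun_neq0).

Definition pbw_gen (i : double_gen) : pbw_endo := endo_of _ (@pbw_op_linear i).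

Hypothesis two_neq0 : (2%:R : k) != 0.

Lemma pbw_gen_rels r : r \in double_rels pbw_gen -> r.1 = r.2.
Proof.
have gK : cancel op_g op_gV by move=> f; rewrite /op_gV /op_g !op_hK op_tK.
have gVK : cancel op_gV op_g by move=> f; rewrite /op_gV /op_g op_tVK !op_hVK.
move: r; apply/all_relsP; rewrite /=.
do !split; apply: endo_ext => f; rewrite ?expr2 /= ?fctE; rewrite ?gK ?gVK //.
all: pw; rewrite /op_v /op_y /op_u /op_g /op_zeta /op_h /op_t /op_x /= ?fctE /GRing.scale /=.
all: rewrite ?rmorphD /=.
(* Only the relations with the terms r.-1 or n.-1 need a case analysis on r and n. *)
all: try by rewrite -?natr1; field.
1,3,7,9: by case: r => [|[|r]]; rewrite /= -?natr1 ?mulr0n; field.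
all: by case: r => [|[|r]]; case: n => [|n]; rewrite /= -?natr1 ?mulr0n; field.
Qed.

Definition pbw_rep : Dtilde k -> pbw_endo := Dtilde_lift pbw_gen_rels.
HB.instance Definition _ := GRing.LRMorphism.on pbw_rep.

End Rep.

(** * Centrality of the p-th powers *)

(** Linear forms separate vectors: this turns a linear identity between
    noncommutative monomials, taken as indeterminates, into an identity in the
    base field, within reach of the commutative decision procedures. *)
Lemma linear_form_ext (k : fieldType) (V : lmodType k) (a b : V) :
  (forall f : V -> k, {morph f : x y / x + y} -> {morph f : x / - x} ->
     (forall c x, f (c *: x) = c * f x) -> f 0 = 0 ->
     (forall x n, f (x *+ n) = n%:R * f x) -> f a = f b) -> a = b.
Proof.
move=> H; apply/eqP; rewrite -subr_eq0; apply/negPn/negP => /exists_linear_form.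
case=> f [fL f1].
have f0 : f 0 = 0.
  by apply: (addrI (f 0)); have := fL 1 0 0; rewrite !scale1r !addr0 => <-.
have fZ c x : f (c *: x) = c *: f x by have := fL c x 0; rewrite f0 !addr0.
have fD x y : f (x + y) = f x + f y by have := fL 1 x y; rewrite !scale1r.
have fN x : f (- x) = - f x by rewrite -!scaleN1r fZ.
have fM x n : f (x *+ n) = n%:R * f x.
  by rewrite -scaler_nat fZ.
have fab := H f fD fN fZ f0 fM; move/eqP: f1.
by rewrite fD fN fab addrN eq_sym oner_eq0.
Qed.

Ltac lin := apply: linear_form_ext;
  let f := fresh "f" in let fD := fresh "fD" in let fN := fresh "fN" in
  let fZ := fresh "fZ" in let f0 := fresh "f0" in let fM := fresh "fM" in
  move=> f fD fN fZ f0 fM; rewrite ?(fD, fN, fZ, f0, fM); clear fD fN fZ f0 fM.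

Section Ad.
Variables (k : fieldType) (A : algType k).
Implicit Types a b c : A.

(** Locked, for the additivity of ad a not to match a nested bracket. *)
Fact ad_key : unit. Proof. by []. Qed.
Definition ad a b := locked_with ad_key (a * b - b * a).

Lemma adE a b : ad a b = a * b - b * a. Proof. exact: unlock. Qed.

Lemma ad_linear a : linear (ad a).
Proof.
by move=> c x y; rewrite !adE mulrDr mulrDl -scalerAr -scalerAl; lin; ring.
Qed.
HB.instance Definition _ a := GRing.isLinear.Build k A A *:%R (ad a) (ad_linear a).

Lemma adD a b c : ad a (b + c) = ad a b + ad a c. Proof. exact: linearD. Qed.
Lemma adB a b c : ad a (b - c) = ad a b - ad a c. Proof. exact: linearB. Qed.
Lemma adN a b : ad a (- b) = - ad a b. Proof. exact: linearN. Qed.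
Lemma adZ a (h : k) b : ad a (h *: b) = h *: ad a b. Proof. exact: linearZ. Qed.
Lemma ad0 a : ad a 0 = 0. Proof. exact: linear0. Qed.

Lemma adM a b c : ad a (b * c) = ad a b * c + b * ad a c.
Proof. by rewrite !adE mulrBl mulrBr !mulrA; lin; ring. Qed.

Lemma ad1 a : ad a 1 = 0. Proof. by rewrite adE mulr1 mul1r subrr. Qed.
Lemma ad_id a : ad a a = 0. Proof. by rewrite adE subrr. Qed.

Lemma ad_comm a b : a * b = b * a -> ad a b = 0.
Proof. by rewrite adE => ->; rewrite subrr. Qed.

Lemma iter_ad0 a n : iter n (ad a) 0 = 0.
Proof. by elim: n => //= n ->; rewrite ad0. Qed.

Lemma iter_adB a n b c : iter n (ad a) (b - c) = iter n (ad a) b - iter n (ad a) c.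
Proof. by elim: n => //= n ->; rewrite adB. Qed.

Lemma iter_adZ a n x b : iter n (ad a) (x *: b) = x *: iter n (ad a) b.
Proof. by elim: n => //= n ->; rewrite adZ. Qed.

Lemma iter_ad_ge a b m n : (m <= n)%N -> iter m (ad a) b = 0 -> iter n (ad a) b = 0.
Proof. by move=> /subnK <-; rewrite iterD => ->; exact: iter_ad0. Qed.

Variables (p : nat) (pcharp : p \in [pchar k]).

(** Left and right multiplications by a commute, and in characteristic p the
    p-th power of their difference is the difference of their p-th powers. *)
Lemma iter_ad_pchar a b : iter p (ad a) b = a ^+ p * b - b * a ^+ p.
Proof.
pose E : algType k := @endo k A (exist (fun v => v != 0) 1 (oner_neq0 A)).
have lL : linear (fun x => a * x) by move=> c x y; rewrite mulrDr -scalerAr.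
have rL : linear (fun x => x * a) by move=> c x y; rewrite mulrDl -scalerAl.
pose L : E := endo_of _ lL; pose R : E := endo_of _ rL.
have LR : GRing.comm L R by apply: endo_ext => x; rewrite /= mulrA.
have charE : p \in [pchar E] by rewrite pchar_lalg.
have itL n x : val (L ^+ n) x = a ^+ n * x.
  by elim: n x => [|n IH] x; rewrite ?expr0 ?mul1r // exprS /= IH exprS mulrA.
have itR n x : val (R ^+ n) x = x * a ^+ n.
  by elim: n x => [|n IH] x; rewrite ?expr0 ?mulr1 // exprS /= IH exprSr mulrA.
have itLR n x : val ((L - R) ^+ n) x = iter n (ad a) x.
  by elim: n x => [|n IH] x //; rewrite exprS iterS -IH adE.
rewrite -itLR; have := pFrobenius_autB_comm charE LR.
by rewrite !pFrobenius_autE => ->; rewrite endo_addE endo_oppE itL itR.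
Qed.

Lemma pchar_fact n : (p <= n)%N -> (n`!%:R : k) = 0.
Proof.
move=> pn; apply/eqP; rewrite -(dvdn_pcharf pcharp).
by apply: dvdn_fact; rewrite prime_gt0 ?(pcharf_prime pcharp).
Qed.

(** On the powers of X, ad a acts as the vector field h X^2 d/dX. *)
Lemma iter_ad_jordan a X (h : k) n :
  ad a X = h *: X ^+ 2 -> iter n (ad a) X = (h ^+ n * n`!%:R) *: X ^+ n.+1.
Proof.
move=> aX; have adX m : ad a (X ^+ m) = (h * m%:R) *: X ^+ m.+1.
  elim: m => [|m IH]; first by rewrite expr0 ad1 mulr0 scale0r.
  rewrite exprS adM IH aX -scalerAl -scalerAr -exprD -exprS add2n -natr1; lin; ring.
elim: n => [|n IH]; first by rewrite /= mulr1 scale1r expr1.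
by rewrite iterS IH adZ adX scalerA factS natrM; congr (_ *: _); rewrite exprS; ring.
Qed.

(** The p-th iterate of X^2 d/dX carries the factor p!. *)
Lemma ad_pchar_jordan a X h : ad a X = h *: X ^+ 2 -> a ^+ p * X = X * a ^+ p.
Proof.
move=> aX; apply/eqP; rewrite -subr_eq0 -iter_ad_pchar (iter_ad_jordan _ aX).
by rewrite pchar_fact // mulr0 scale0r.
Qed.

(** The form in which centrality is checked on most generators. *)
Lemma ad_pchar_nil a b m : (m <= p)%N -> iter m (ad a) b = 0 -> a ^+ p * b = b * a ^+ p.
Proof.
by move=> mp H; apply/eqP; rewrite -subr_eq0 -iter_ad_pchar (iter_ad_ge mp H).
Qed.

End Ad.

Section Central.
Variables (k : fieldType) (A : algType k) (c : double_gen -> A).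
Hypothesis cR : forall r, r \in double_rels c -> r.1 = r.2.
Variables (p : nat) (pcharp : p \in [pchar k]) (p_gt2 : (2 < p)%N).

Local Notation u := (c gen_u).
Local Notation v := (c gen_v).
Local Notation zeta := (c gen_zeta).
Local Notation g := (c gen_g).
Local Notation gV := (c gen_gV).
Local Notation x := (c gen_x).
Local Notation y := (c gen_y).

Lemma g_gV : g * gV = 1. Proof. by move/all_relsP: cR => /=; tauto. Qed.
Lemma gV_g : gV * g = 1. Proof. by move/all_relsP: cR => /=; tauto. Qed.
Lemma g_x : g * x = x * g. Proof. by move/all_relsP: cR => /=; tauto. Qed.
Lemma g_y : g * y = y * g + x * g. Proof. by move/all_relsP: cR => /=; tauto. Qed.
Lemma y_x : y * x = x * y - 2^-1 *: x ^+ 2. Proof. by move/all_relsP: cR => /=; tauto. Qed.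
Lemma v_zeta : v * zeta = zeta * v + v. Proof. by move/all_relsP: cR => /=; tauto. Qed.
Lemma u_zeta : u * zeta = zeta * u + u. Proof. by move/all_relsP: cR => /=; tauto. Qed.
Lemma v_u : v * u = u * v - 2^-1 *: u ^+ 2. Proof. by move/all_relsP: cR => /=; tauto. Qed.
Lemma zeta_y : zeta * y = y * zeta + y. Proof. by move/all_relsP: cR => /=; tauto. Qed.
Lemma zeta_x : zeta * x = x * zeta + x. Proof. by move/all_relsP: cR => /=; tauto. Qed.
Lemma v_g : v * g = g * v + g * u. Proof. by move/all_relsP: cR => /=; tauto. Qed.
Lemma u_g : u * g = g * u. Proof. by move/all_relsP: cR => /=; tauto. Qed.
Lemma v_x : v * x = x * v + (1 - g) + x * u. Proof. by move/all_relsP: cR => /=; tauto. Qed.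
Lemma u_x : u * x = x * u. Proof. by move/all_relsP: cR => /=; tauto. Qed.
Lemma u_y : u * y = y * u + (1 - g). Proof. by move/all_relsP: cR => /=; tauto. Qed.
Lemma v_y : v * y = y * v - g * zeta + y * u. Proof. by move/all_relsP: cR => /=; tauto. Qed.
Lemma zeta_g : zeta * g = g * zeta. Proof. by move/all_relsP: cR => /=; tauto. Qed.

Let p2 : (2 <= p)%N := ltnW p_gt2.
Lemma pchar_two_neq0 : (2%:R : k) != 0.
Proof. by rewrite -(dvdn_pcharf pcharp) gtnNdvd. Qed.
Let two0 := pchar_two_neq0.

Let swap (a b : A) (P : A) : a * b = b * a + P -> ad a b = P.
Proof. by rewrite adE => ->; rewrite addrC addKr. Qed.
Let swapN (a b : A) (P : A) : a * b = b * a + P -> ad b a = - P.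
Proof. by rewrite adE => ->; rewrite opprD addNKr. Qed.

Lemma ad_yx : ad y x = - 2^-1 *: x ^+ 2. Proof. by rewrite scaleNr; apply: swap y_x. Qed.
Lemma ad_xy : ad x y = 2^-1 *: x ^+ 2. Proof. by rewrite (swapN y_x) opprK. Qed.
Lemma ad_vu : ad v u = - 2^-1 *: u ^+ 2. Proof. by rewrite scaleNr; apply: swap v_u. Qed.
Lemma ad_uv : ad u v = 2^-1 *: u ^+ 2. Proof. by rewrite (swapN v_u) opprK. Qed.
Lemma ad_vzeta : ad v zeta = v. Proof. exact: swap v_zeta. Qed.
Lemma ad_uzeta : ad u zeta = u. Proof. exact: swap u_zeta. Qed.
Lemma ad_xzeta : ad x zeta = - x. Proof. exact: swapN zeta_x. Qed.
Lemma ad_yzeta : ad y zeta = - y. Proof. exact: swapN zeta_y. Qed.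
Lemma ad_vg : ad v g = g * u. Proof. exact: swap v_g. Qed.
Lemma ad_yg : ad y g = - (x * g). Proof. exact: swapN g_y. Qed.
Lemma ad_ug : ad u g = 0. Proof. exact/ad_comm/u_g. Qed.
Lemma ad_xg : ad x g = 0. Proof. exact/ad_comm/esym/g_x. Qed.
Lemma ad_xu : ad x u = 0. Proof. exact/ad_comm/esym/u_x. Qed.
Lemma ad_ux : ad u x = 0. Proof. exact/ad_comm/u_x. Qed.
Lemma ad_uy : ad u y = 1 - g. Proof. exact: swap u_y. Qed.
Lemma ad_yu : ad y u = g - 1. Proof. by rewrite (swapN u_y) opprB. Qed.
Lemma ad_vx : ad v x = 1 - g + x * u. Proof. by apply: swap; rewrite addrA v_x. Qed.
Lemma ad_xv : ad x v = g - 1 - x * u.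
Proof.
have E : v * x = x * v + (1 - g + x * u) by rewrite addrA v_x.
by rewrite (swapN E) opprD opprB.
Qed.
Lemma ad_vy : ad v y = y * u - g * zeta.
Proof. by apply: swap; rewrite v_y addrAC addrA. Qed.
Lemma ad_yv : ad y v = g * zeta - y * u.
Proof.
have E : v * y = y * v + (y * u - g * zeta) by rewrite v_y addrAC addrA.
by rewrite (swapN E) opprB.
Qed.

Lemma comm_gV a : a * g = g * a -> a * gV = gV * a.
Proof.
move=> ag; rewrite -[LHS]mul1r -gV_g -!mulrA; congr (_ * _).
by rewrite mulrA -ag -mulrA g_gV mulr1.
Qed.

Definition central_gens a := forall i, a * c i = c i * a.

Lemma central_gensP a :
  [/\ a * u = u * a, a * v = v * a, a * zeta = zeta * a &
   [/\ a * g = g * a, a * x = x * a & a * y = y * a]] -> central_gens a.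
Proof. by move=> [Hu Hv Hz [Hg Hx Hy]] []; rewrite // comm_gV. Qed.

Lemma central_xp : central_gens (x ^+ p).
Proof.
have N2 b : ad x (ad x b) = 0 -> x ^+ p * b = b * x ^+ p.
  exact: (@ad_pchar_nil _ _ _ pcharp _ _ 2).
have N b : ad x b = 0 -> x ^+ p * b = b * x ^+ p.
  by move=> xb; apply: N2; rewrite xb ad0.
apply: central_gensP; split; [exact: N ad_xu| | |split; [exact: N ad_xg| by rewrite -exprS -exprSr|]].
- by apply: N2; rewrite ad_xv !adB ad_xg ad1 adM ad_id ad_xu mul0r mulr0 addr0 !subr0.
- by apply: N2; rewrite ad_xzeta adN ad_id oppr0.
- by apply: N2; rewrite ad_xy adZ ad_comm ?scaler0 // -exprS -exprSr.
Qed.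

Lemma central_up : central_gens (u ^+ p).
Proof.
have N2 b : ad u (ad u b) = 0 -> u ^+ p * b = b * u ^+ p.
  exact: (@ad_pchar_nil _ _ _ pcharp _ _ 2).
have N b : ad u b = 0 -> u ^+ p * b = b * u ^+ p.
  by move=> xb; apply: N2; rewrite xb ad0.
apply: central_gensP; split; [by rewrite -exprS -exprSr| | |split; [exact: N ad_ug|exact: N ad_ux|]].
- by apply: N2; rewrite ad_uv adZ ad_comm ?scaler0 // -exprS -exprSr.
- by apply: N2; rewrite ad_uzeta ad_id.
- by apply: N2; rewrite ad_uy adB ad1 ad_ug subr0.
Qed.

(** The generators are eigenvectors of ad zeta for eigenvalues in the prime field,
    which are fixed by the Frobenius map: ad zeta is thus equal to its p-th iterate
    on each of them. *)
Lemma central_zetap : central_gens (zeta ^+ p - zeta).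
Proof.
have Z (e : k) b : e ^+ p = e -> ad zeta b = e *: b ->
    (zeta ^+ p - zeta) * b = b * (zeta ^+ p - zeta).
  move=> ep zb; apply/eqP; rewrite -subr_eq0.
  have -> : (zeta ^+ p - zeta) * b - b * (zeta ^+ p - zeta) = iter p (ad zeta) b - ad zeta b.
    by rewrite iter_ad_pchar // adE mulrBl mulrBr; lin; ring.
  rewrite subr_eq0 zb.
  have -> n : iter n (ad zeta) b = e ^+ n *: b.
    by elim: n => [|n IH]; rewrite ?scale1r // iterS IH adZ zb scalerA exprSr.
  by rewrite ep.
have p0 : (0 : k) ^+ p = 0 by rewrite expr0n gtn_eqF // ltnW.
have pN1 : (-1 : k) ^+ p = -1.
  have := pFrobenius_autN pcharp 1; rewrite !pFrobenius_autE expr1n //.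
have p1 : (1 : k) ^+ p = 1 by rewrite expr1n.
apply: central_gensP; split; [| | |split].
- by apply: (Z _ _ pN1); rewrite scaleN1r (swapN u_zeta).
- by apply: (Z _ _ pN1); rewrite scaleN1r (swapN v_zeta).
- by rewrite mulrBl mulrBr -exprS -exprSr.
- by apply: (Z _ _ p0); rewrite scale0r ad_comm ?zeta_g.
- by apply: (Z _ _ p1); rewrite scale1r (swap zeta_x).
- by apply: (Z _ _ p1); rewrite scale1r (swap zeta_y).
Qed.

(** ad y acts on x^n g as the vector field - x^2 d/dx / 2 on x^n, plus - x g; the
    two contributions combine to the factorial of n + 1, so that the iterate of order
    p - 1 is already zero. *)
Lemma iter_ad_yg n : iter n (ad y) g = ((- 2^-1) ^+ n * (n.+1)`!%:R) *: (x ^+ n * g).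
Proof.
have yxn m : ad y (x ^+ m) = (- 2^-1 * m%:R) *: x ^+ m.+1.
  elim: m => [|m IH]; first by rewrite expr0 ad1 mulr0 scale0r.
  rewrite exprS adM IH ad_yx -scalerAl -scalerAr -exprD -exprS add2n -natr1; lin; ring.
elim: n => [|n IH]; first by rewrite /= mulr1 scale1r expr0 mul1r.
rewrite iterS IH adZ adM yxn ad_yg mulrN mulrA -exprSr -scalerAl.
rewrite [n.+2`!]factS natrM -[n.+2%:R]natr1 -[n.+1%:R]natr1.
rewrite [(- _) ^+ n.+1]exprS; lin; field; exact: two0.
Qed.

(** The iterates of ad y on u and v are expressed by those on g, which vanish from the
    order p - 1 on. *)
Lemma central_yp : central_gens (y ^+ p).
Proof.
have N2 b : ad y (ad y b) = 0 -> y ^+ p * b = b * y ^+ p.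
  exact: (@ad_pchar_nil _ _ _ pcharp _ _ 2).
have G0 : iter p.-1 (ad y) g = 0.
  by rewrite iter_ad_yg prednK ?(ltnW p2) // (pchar_fact pcharp) // mulr0 scale0r.
have pE : p = p.-2.+2 by lia.
apply: central_gensP; split; [| | |split].
- apply: (@ad_pchar_nil _ _ _ pcharp _ _ p) => //.
  by rewrite pE iterSr ad_yu iter_adB {1}(_ : p.-2.+1 = p.-1) ?G0 1?pE // sub0r iterSr ad1 iter_ad0 oppr0.
- apply: (@ad_pchar_nil _ _ _ pcharp _ _ p) => //.
  have Gz n : iter n.+1 (ad y) (g * zeta) =
      iter n.+1 (ad y) g * zeta - n.+1%:R *: (iter n (ad y) g * y).
    elim: n => [|n IH]; first by rewrite /= adM ad_yzeta mulrN scale1r.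
    rewrite iterS IH adB adZ !adM ad_yzeta ad_id mulr0 addr0 mulrN -!iterS.
    by rewrite -[n.+2%:R]natr1; lin; ring.
  have Yu n : iter n (ad y) (y * u) = y * iter n (ad y) u.
    by elim: n => //= n ->; rewrite adM ad_id mul0r add0r.
  rewrite {1}pE iterSr ad_yv iter_adB Gz Yu [iter _ _ u]iterSr ad_yu iter_adB.
  have -> : iter p.-2 (ad y) 1 = 0.
    by have -> : p.-2 = p.-2.-1.+1 by [lia]; rewrite iterSr ad1 iter_ad0.
  rewrite (_ : p.-2.+1 = p.-1) ?G0; last by lia.
  have -> : p.-1%:R = -1 :> k.
    by apply/eqP; rewrite -subr_eq0 opprK natr1 prednK ?(ltnW p2) // pcharf0.
  rewrite mul0r sub0r scaleN1r opprK subr0 -opprB -adE -iterS.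
  by rewrite (_ : p.-2.+1 = p.-1) ?G0 ?oppr0 //; lia.
- by apply: N2; rewrite ad_yzeta adN ad_id oppr0.
- exact: (@ad_pchar_nil _ _ _ pcharp _ _ p.-1 (leq_pred _) G0).
- exact: (ad_pchar_jordan pcharp ad_yx).
- by rewrite -exprS -exprSr.
Qed.

Let nc := (mul0r, mulr0, mulrDl, mulrDr, mulrBl, mulrBr, mulNr, mulrN, mul1r, mulr1,
  (fun c (a b : A) => esym (scalerAl c a b)), (fun c (a b : A) => esym (scalerAr c a b)),
  @mulrA A).

Let ad_vu2 : ad v u = - 2^-1 *: (u * u). Proof. by rewrite ad_vu expr2. Qed.
Let adv := (adN v, adD v, adB v, adM v, adZ v, ad0 v, ad1 v, ad_vg, ad_vx, ad_vy, ad_vu2,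
  ad_vzeta, ad_id v).

Lemma iter3_ad_vg : iter 3 (ad v) g = 0.
Proof. by rewrite /= !adv !nc; lin; field; exact: two0. Qed.

(** The third iterates of ad v on x and y have a factor 3 and lie in the kernel of
    the second iterate of ad v, so that p iterates kill x and y: for p = 3 because of
    the factor, and for p >= 5 because five iterates suffice. *)
Lemma iter3_ad_vx : iter 3 (ad v) x = - (3%:R / 2%:R) *: (g * u * u).
Proof. by rewrite /= !adv !nc; lin; field; exact: two0. Qed.

Let zu : zeta * u = u * zeta - u. Proof. by rewrite u_zeta addrK. Qed.
Let zu' a : a * zeta * u = a * u * zeta - a * u.
Proof. by rewrite -mulrA zu mulrBr mulrA. Qed.
Let vu' a : a * v * u = a * u * v - 2^-1 *: (a * u * u).
Proof. by rewrite -mulrA v_u mulrBr expr2 -scalerAr !mulrA. Qed.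

Lemma iter3_ad_vy : iter 3 (ad v) y =
  - (3%:R / 2%:R) *: (g * u * u * zeta + 2%:R *: (g * u * v) - g * u * u).
Proof. by rewrite /= !adv !(nc, zu', vu'); lin; field; exact: two0. Qed.

Lemma central_vp : central_gens (v ^+ p).
Proof.
have G2 : ad v (g * u * u) = 0.
  by rewrite !adv !nc; lin; field; exact: two0.
have three b w : iter 3 (ad v) b = - (3%:R / 2%:R) *: w -> iter 2 (ad v) w = 0 ->
    v ^+ p * b = b * v ^+ p.
  move=> bw w0; have [p3|p5] : p = 3 \/ (5 <= p)%N.
  - have : p != 4 by apply: contraTneq (pcharf_prime pcharp) => ->.
    by case: (ltngtP p 4) => [? _|? _|//]; [left|right]; lia.
  - apply: (@ad_pchar_nil _ _ _ pcharp _ _ 3); first by rewrite p3.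
    have /eqP H : (3%:R : k) == 0 by rewrite -(dvdn_pcharf pcharp) p3.
    by rewrite bw H mul0r oppr0 scale0r.
  - apply: (@ad_pchar_nil _ _ _ pcharp _ _ 5) => //.
    by rewrite (iterD 2 3) bw iter_adZ w0 scaler0.
apply: central_gensP; split; [| | |split].
- exact: (ad_pchar_jordan pcharp ad_vu).
- by rewrite -exprS -exprSr.
- by apply: (@ad_pchar_nil _ _ _ pcharp _ _ 2) => //=; rewrite ad_vzeta ad_id.
- exact: (@ad_pchar_nil _ _ _ pcharp _ _ 3 p_gt2 iter3_ad_vg).
- by apply: (three _ _ iter3_ad_vx); rewrite /= G2 ad0.
- apply: (three _ _ iter3_ad_vy).
  by rewrite /= !adv !nc; lin; field; exact: two0.
Qed.

Lemma central_gp : central_gens (g ^+ p).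
Proof.
have pA : p%:R = 0 :> A by rewrite pcharf0 // pchar_lalg.
have gx n : g ^+ n * x = x * g ^+ n.
  by elim: n => [|n IH]; rewrite ?expr0 ?mulr1 ?mul1r // exprS -mulrA IH mulrA g_x mulrA.
have gy n : g ^+ n * y = y * g ^+ n + n%:R * (x * g ^+ n).
  elim: n => [|n IH]; first by rewrite expr0 mul0r addr0 mulr1 mul1r.
  rewrite exprSr -mulrA g_y mulrDr 2!mulrA IH gx -natr1 !mulrDl mul1r !mulrA addrA.
  by [].
have gv n : v * g ^+ n = g ^+ n * v + n%:R * (g ^+ n * u).
  elim: n => [|n IH]; first by rewrite expr0 mul0r addr0 mulr1 mul1r.
  rewrite exprSr mulrA IH -natr1 !mulrDl mul1r -!mulrA v_g u_g !mulrDr !mulrA.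
  by rewrite -!addrA; congr (_ + _); rewrite addrC.
apply: central_gensP; split; [| | |split].
- elim: (p) => [|n IH]; rewrite ?expr0 ?mulr1 ?mul1r // exprS -mulrA IH !mulrA u_g //.
- by rewrite gv pA mul0r addr0.
- elim: (p) => [|n IH]; rewrite ?expr0 ?mulr1 ?mul1r // exprS -mulrA IH !mulrA zeta_g //.
- by rewrite -exprS -exprSr.
- exact: gx.
- by rewrite gy pA mul0r addr0.
Qed.

Lemma gp_gVp : g ^+ p * gV ^+ p = 1.
Proof. by rewrite -exprMn_comm ?g_gV ?expr1n // /GRing.comm g_gV gV_g. Qed.
Lemma gVp_gp : gV ^+ p * g ^+ p = 1.
Proof. by rewrite -exprMn_comm ?gV_g ?expr1n // /GRing.comm g_gV gV_g. Qed.

Lemma central_gVp : central_gens (gV ^+ p).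
Proof.
move=> i; rewrite -[RHS]mul1r -gVp_gp -!mulrA; congr (_ * _).
by rewrite mulrA central_gp -mulrA gp_gVp mulr1.
Qed.

End Central.

(** * Powers of sums in Jordan planes *)

Section JordanPowers.
Variables (k : fieldType) (B : algType k).
Implicit Types a b w X : B.

(** The binomial expansion of w^n follows by Pascal's rule from an array T with
    T(i, j) w = T(i+1, j) + T(i, j+1), without commutativity. *)
Section Pascal.
Variables (w : B) (T : nat -> nat -> B).
Hypothesis T0 : T 0 0 = 1.

Lemma pascal_step n :
  \sum_(j < n.+1) (T (n - j).+1 j + T (n - j) j.+1) *+ 'C(n, j) =
  \sum_(j < n.+2) T (n.+1 - j) j *+ 'C(n.+1, j).
Proof.
rewrite [RHS]big_ord_recl [X in _ = _ + X](eq_bigr (fun i : 'I_n.+1 =>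
  T (n - i) i.+1 *+ 'C(n, i.+1) + T (n - i) i.+1 *+ 'C(n, i))); last first.
  by move=> i _; rewrite /= /bump leq0n add1n subSS binS mulrnDr.
rewrite big_split /= addrA bin0 subn0.
under eq_bigr do rewrite mulrnDl.
rewrite big_split /=; congr (_ + _).
rewrite big_ord_recl /= subn0 bin0; congr (_ + _).
rewrite [RHS]big_ord_recr /= bin_small // addr0; apply: eq_bigr => i _.
by rewrite /bump leq0n add1n subnSK.
Qed.

Lemma pascal_expr n :
  (forall i j, T i j * w = T i.+1 j + T i j.+1) ->
  w ^+ n = \sum_(j < n.+1) T (n - j) j *+ 'C(n, j).
Proof.
move=> TS; elim: n => [|n IH].
  by rewrite big_ord1 expr0 T0.
rewrite exprSr IH mulr_suml -pascal_step; apply: eq_bigr => j _.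
by rewrite mulrnAl TS.
Qed.

(** The same expansion when the step fails by terms that cancel telescopically
    in the sum. *)
Lemma pascal_expl (h : k) (E : nat -> nat -> B) n :
  (forall i j, w * T i j = T i.+1 j + T i j.+1 +
     h *: (E i.-1 j.+1 *+ i - E i j *+ j)) ->
  w ^+ n = \sum_(j < n.+1) T (n - j) j *+ 'C(n, j).
Proof.
move=> TS; elim: n => [|n IH].
  by rewrite big_ord1 expr0 T0.
rewrite exprS IH mulr_sumr -pascal_step.
under eq_bigr do rewrite mulrnAr TS mulrnDl scalerMnr mulrnBl -!mulrnA.
rewrite big_split /= -scaler_sumr sumrB /=.
(* The error terms cancel by j C(n, j) = (n - j + 1) C(n, j - 1). *)
rewrite [X in _ - X]big_ord_recl [X in X - _]big_ord_recr /= subnn !mul0n !mulr0n.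
rewrite addr0 add0r -sumrB [X in _ *: X]big1 ?scaler0 ?addr0 // => i _.
by rewrite /bump leq0n add1n -mul_bin_left subnS subrr.
Qed.

End Pascal.

Variables (p : nat) (pcharp : p \in [pchar k]) (p_gt2 : (2 < p)%N).
Let p_gt0 : (0 < p)%N. Proof. exact: ltnW (ltnW p_gt2). Qed.

(** The other binomial coefficients are divisible by p. *)
Lemma sum_bin_pchar (T : nat -> nat -> B) :
  \sum_(j < p.+1) T (p - j)%N j *+ 'C(p, j) = T p 0 + T 0 p.
Proof.
have pB : p \in [pchar B] by rewrite pchar_lalg.
rewrite (bigD1 ord0) //= (bigD1 ord_max) /=; last by rewrite -val_eqE /= -lt0n.
rewrite big1 ?addr0 => [|j /andP[j0 jp]].
  by rewrite subn0 subnn bin0 binn.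
rewrite -mulr_natr (bin_lt_pcharf_0 pB) ?mulr0 //.
move: j0 jp; rewrite -!val_eqE /= => j0 jp.
by rewrite lt0n j0 ltn_neqAle jp -ltnS ltn_ord.
Qed.

Let two0 : (2%:R : k) != 0 := pchar_two_neq0 pcharp p_gt2.

Section Jordan.
Variables (a X : B).
Hypothesis aX : a * X = X * a - 2^-1 *: X ^+ 2.

Let Xa : X * a = a * X + 2^-1 *: X ^+ 2. Proof. by rewrite aX subrK. Qed.

Lemma jordan_Xn n : X ^+ n * a = a * X ^+ n + (n%:R / 2%:R) *: X ^+ n.+1.
Proof.
elim: n => [|n IH]; first by rewrite expr0 mul0r scale0r addr0 mul1r mulr1.
rewrite exprSr -mulrA Xa mulrDr mulrA IH mulrDl -mulrA -exprSr -scalerAl -scalerAr -exprSr.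
by rewrite -exprD addn2 -natr1; lin; field; exact: two0.
Qed.

Lemma jordan_shift b : b * X = X * b ->
  (a + b * X) * X = X * (a + b * X) - 2^-1 *: X ^+ 2.
Proof. by move=> bX; rewrite mulrDl mulrDr aX [X * (b * X)]mulrA -bX; lin; ring. Qed.

(** The terms of higher order in X cancel, as (a + X/2) X = X a. *)
Lemma jordan_half m :
  (a + 2^-1 *: X) ^+ m.+1 = a ^+ m.+1 + (m.+1%:R / 2%:R) *: (X * a ^+ m).
Proof.
elim: m => [|m IH]; first by rewrite !expr1 expr0 mulr1 mul1r.
rewrite exprS IH mulrDl !mulrDr -!scalerAl -!scalerAr !mulrA aX mulrBl.
rewrite -!scalerAl -exprS -[X * a * _]mulrA -exprS -expr2 -[m.+2%:R]natr1.
by lin; field; exact: two0.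
Qed.

(** The coefficient of X^j a^(n - j) in (a + bX)^n is C(n, j) times
    b (b + 1/2) ... (b + (j - 1)/2). For n = p only j = 0 and j = p remain, and the
    last coefficient is the Artin-Schreier product for 2b, up to a power of 2. *)
Lemma jordan_translate_pchar (b : B) : b * a = a * b -> b * X = X * b ->
  (a + b * X) ^+ p = a ^+ p + (b ^+ p - b) * X ^+ p.
Proof.
move=> ba bX.
pose P j := \prod_(0 <= q < j) (b + (q%:R / 2%:R)%:A).
have PS j : P j.+1 = P j * (b + (j%:R / 2%:R)%:A) by rewrite /P big_nat_recr.
have Pa j : P j * a = a * P j.
  elim: j => [|j IH]; first by rewrite /P big_geq // mul1r mulr1.
  by rewrite PS -mulrA mulrDl ba mulr_algl -mulr_algr -mulrDr mulrA IH -mulrA.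
have PX j : P j * b = b * P j.
  elim: j => [|j IH]; first by rewrite /P big_geq // mul1r mulr1.
  by rewrite PS -mulrA mulrDl mulr_algl -mulr_algr -mulrDr mulrA IH -mulrA.
have bXn n : X ^+ n * b = b * X ^+ n by elim: n => [|n IH]; rewrite ?mul1r ?mulr1 // exprSr -mulrA -bX mulrA IH -mulrA.
have ban n : a ^+ n * b = b * a ^+ n by elim: n => [|n IH]; rewrite ?mul1r ?mulr1 // exprSr -mulrA -ba mulrA IH -mulrA.
have Pan j n : P j * a ^+ n = a ^+ n * P j.
  by elim: n => [|n IH]; rewrite ?mul1r ?mulr1 // exprSr mulrA IH -mulrA Pa mulrA.
rewrite (@pascal_expr _ (fun i j => P j * a ^+ i * X ^+ j)); first last.
- move=> i j; rewrite PS mulrDr.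
  have -> : P j * a ^+ i * X ^+ j * a =
      P j * a ^+ i.+1 * X ^+ j + (j%:R / 2%:R) *: (P j * a ^+ i * X ^+ j.+1).
    by rewrite -mulrA jordan_Xn mulrDr -scalerAr [a ^+ i.+1]exprSr !mulrA.
  have -> : P j * a ^+ i * X ^+ j * (b * X) = P j * b * a ^+ i * X ^+ j.+1.
    have -> : P j * a ^+ i * X ^+ j * (b * X) = P j * a ^+ i * (X ^+ j * b * X).
      by rewrite !mulrA.
    by rewrite bXn -[b * _ * X]mulrA -exprSr mulrA -[P j * a ^+ i * b]mulrA ban mulrA.
  by rewrite !mulrDr !mulrDl mulr_algr -!scalerAl; lin; ring.
- by rewrite /P big_geq // !mulr1.
rewrite (sum_bin_pchar (fun i j => P j * a ^+ i * X ^+ j)) !expr0 !mulr1.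
rewrite [P 0%N]/P big_geq // mul1r; congr (_ + _ * _).
have two_p : (2%:R : k) ^+ p = 2%:R.
  by rewrite -(pFrobenius_autE pcharp) rmorph_nat.
have : (2%:R : k) ^+ p *: P p = 2%:R *: (b ^+ p - b).
  move: (prod_Dn_pchar pcharp (2%:R *: b)).
  rewrite big_add1 /= exprZn [in _ *: b ^+ p]two_p -scalerBr => E; rewrite -{}E.
  rewrite /P; elim: {1 2 3}p => [|n IH]; first by rewrite !big_geq ?scale1r.
  rewrite !big_nat_recr //= -IH exprSr -scalerA scalerAr -scalerAl.
  congr (_ *: (_ * _)); rewrite -[n.+1%:R]natr1 addrA addrK scalerDr; congr (_ + _).
  by rewrite scalerA mulrC divfK // scaler_nat.
by rewrite {1}two_p => /(scalerI two0).
Qed.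

End Jordan.

(** As b a = (a + X) b, the powers of a + b expand as
    (a + b)^n = sum_j C(n, j) (a + (j/2) X)^(n - j) b^j. *)
Lemma jordan_add_pchar a X b :
  a * X = X * a - 2^-1 *: X ^+ 2 -> b * a = a * b + X * b -> b * X = X * b ->
  (a + b) ^+ p = a ^+ p + b ^+ p.
Proof.
move=> aX ba bX.
pose S j := a + (j%:R / 2%:R) *: X.
have SX j : S j * X = X * S j - 2^-1 *: X ^+ 2.
  by rewrite /S -mulr_algl jordan_shift // mulr_algl mulr_algr.
have S1 j : S j.+1 = S j + 2^-1 *: X.
  by rewrite /S -natr1; lin; field; exact: two0.
have bS j n : b * S j ^+ n = S j.+2 ^+ n * b.
  elim: n => [|n IH]; first by rewrite !expr0 mulr1 mul1r.
  rewrite !exprS mulrA.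
  have -> : b * S j = S j.+2 * b.
    rewrite !S1 /S mulrDr -scalerAr bX ba !mulrDl -!scalerAl.
    by lin; field; exact: two0.
  by rewrite -mulrA IH mulrA.
rewrite (@pascal_expl _ (fun i j => S j ^+ i * b ^+ j) _ 2^-1 (fun i j => X * (S j ^+ i * b ^+ j))); first last.
- move=> i j; rewrite mulrDl.
  have -> : b * (S j ^+ i * b ^+ j) =
      S j.+1 ^+ i * b ^+ j.+1 + 2^-1 *: (X * (S j.+1 ^+ i.-1 * b ^+ j.+1) *+ i).
    rewrite mulrA bS [S j.+2]S1 -(mulrA _ b) -exprS.
    case: i => [|i]; first by rewrite !expr0 mulr0n scaler0 addr0.
    rewrite jordan_half // mulrDl -scalerAl mulrA /=.
    by lin; field; exact: two0.
  have -> : a * (S j ^+ i * b ^+ j) = S j ^+ i.+1 * b ^+ j - 2^-1 *: (X * (S j ^+ i * b ^+ j) *+ j).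
    rewrite -[a](addrK ((j%:R / 2%:R) *: X)) -/(S j) mulrBl [S j * _]mulrA -exprS -scalerAl.
    by lin; field; exact: two0.
  by lin; ring.
- by rewrite !expr0 mulr1.
by rewrite (sum_bin_pchar (fun i j => S j ^+ i * b ^+ j)) !expr0 mulr1 mul1r /S mul0r scale0r addr0.
Qed.

End JordanPowers.

(** * Monomials generate the double over its central subalgebra *)

Section GenInduction.
Variables (k : fieldType) (A : algType k).

Lemma gen_subalg_ind (S : seq A) (P : A -> Prop) :
  P 1 -> (forall c a b, P a -> P b -> P (c *: a + b)) ->
  (forall a b, P a -> P b -> P (a * b)) -> (forall s, s \in S -> P s) ->
  forall a, a \in gen_subalg S -> P a.
Proof.
move=> P1 PL PM PS a /asboolP /(_ [pred a | `[< P a >]]) aP; apply/asboolP.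
apply: aP => [|s sS]; last exact/asboolP/PS.
split=> [|c x y /asboolP Px /asboolP Py|x y /asboolP Px /asboolP Py]; apply/asboolP => //.
  exact: PL.
exact: PM.
Qed.

Lemma gen_subalg_sub (S T : seq A) : {subset S <= gen_subalg T} ->
  {subset gen_subalg S <= gen_subalg T}.
Proof.
move=> ST; apply: gen_subalg_ind => //; first exact: rpred1.
  by move=> c a b Ha Hb; apply: rpredD => //; apply: rpredZ.
by move=> a b; apply: rpredM.
Qed.

End GenInduction.

(* The imports are confined to a module: their notation for monoid algebras overrides *)
(* that for polynomials in several variables.                                       *)
Module FreeAlgebraInduction.
Import finmap monalg.

Lemma free_alg_ind (k : fieldType) (I : choiceType) (P : free_alg k I -> Prop) :
  P 1 -> (forall c a b, P a -> P b -> P (c *: a + b)) ->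
  (forall a b, P a -> P b -> P (a * b)) -> (forall i, P (free_gen k i)) ->
  forall a, P a.
Proof.
move=> P1 PL PM PG a; rewrite [a]monalgE.
have P0 : P 0 by have := PL (-1) 1 1 P1 P1; rewrite scaleN1r addNr.
elim: (X in \sum_(_ <- X) _) => [|m s IH]; first by rewrite big_nil.
rewrite big_cons; set c := monalg.mcoeff _ _.
have -> : << c *g m >> = c *: << m >> :> {malg k[{fmonom I}]}.
  by apply/malgP => w; rewrite monalg.mcoeffZ !monalg.mcoeffU mulrnAr mulr1.
apply: (PL c << m >>) => //; case: m {c} => w; elim: w => [|i w Pw].
  have -> : << FMonom [::] >> = 1 :> free_alg k I by rewrite -fmoneE.
  by [].
have -> : << FMonom (i :: w) >> = free_gen k i * << FMonom w >> :> free_alg k I.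
  rewrite -[RHS]/(<< fmu i >> * << FMonom w >> : {malg k[{fmonom I}]}).
  by rewrite malgM_def fgmulUU mulr1; congr << _ >>; apply/eqP; rewrite fmP fmM fmU.
exact: PM.
Qed.

End FreeAlgebraInduction.
Export FreeAlgebraInduction.

Lemma Dtilde_ind (k : fieldType) (P : Dtilde k -> Prop) :
  P 1 -> (forall c a b, P a -> P b -> P (c *: a + b)) ->
  (forall a b, P a -> P b -> P (a * b)) -> (forall i, P (Dtilde_gen k i)) ->
  forall a, P a.
Proof.
move=> P1 PL PM PG q; have [a ->] := to_quot_surj q.
elim/free_alg_ind: a => [|c a b Ha Hb|a b Ha Hb|i].
- by rewrite rmorph1.
- by rewrite linearP; apply: PL.
- by rewrite rmorphM; apply: PM.
- exact: PG.
Qed.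

Section Adjoin.
Variables (k : fieldType) (A : algType k) (S0 : seq A) (p : nat).
Hypothesis p_gt1 : (1 < p)%N.
Hypothesis S0_central : central (gen_subalg S0).

(** The family f generates the subalgebra of S as a module over that of S0. *)
Definition spans (I : finType) (f : I -> A) (S : seq A) :=
  [/\ {subset S0 <= gen_subalg S}, forall i, f i \in gen_subalg S &
   forall a, a \in gen_subalg S -> exists z : I -> A,
     (forall i, z i \in gen_subalg S0) /\ a = \sum_i z i * f i].

Lemma spans0 : spans (fun _ : unit => 1) S0.
Proof.
split=> [a aS|_|a aS]; first exact: mem_gen_subalg.
  exact: rpred1.
exists (fun=> a); split=> //.
by rewrite big_const card_unit /= mulr1 addr0.
Qed.

(** Adjoining t to a subalgebra B such that Bt is contained in tB + B, where t
    is a root of a monic trinomial over the central subalgebra: the powers t^l,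
    l < p, generate the larger subalgebra as a right B-module. *)
Lemma spans_adjoin (I : finType) (f : I -> A) (S : seq A) (t z0 z1 : A) :
  spans f S ->
  (forall s, s \in S -> exists a b,
    [/\ a \in gen_subalg S, b \in gen_subalg S & s * t = t * a + b]) ->
  z0 \in gen_subalg S0 -> z1 \in gen_subalg S0 -> t ^+ p = z0 + z1 * t ->
  spans (fun li : 'I_p * I => t ^+ li.1 * f li.2) (t :: S).
Proof.
move=> [S0S fS Sf] tS z0Z z1Z tp.
have SS : {subset gen_subalg S <= gen_subalg (t :: S)}.
  by apply: gen_subalg_sub => s sS; apply: mem_gen_subalg; rewrite inE sS orbT.
have S0S' : {subset gen_subalg S0 <= gen_subalg S} by apply: gen_subalg_sub.
have tS' : t \in gen_subalg (t :: S) by apply: mem_gen_subalg; rewrite mem_head.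
split=> [s /S0S /SS //|[l i]|].
  by apply: rpredM; [exact: rpredX|exact: SS].
have comt b : b \in gen_subalg S -> exists a c,
    [/\ a \in gen_subalg S, c \in gen_subalg S & b * t = t * a + c].
  move=> bS; suff [] : b \in gen_subalg S /\ exists a c,
    [/\ a \in gen_subalg S, c \in gen_subalg S & b * t = t * a + c] by [].
  elim/gen_subalg_ind: b / bS => [|c a b [aS [a1 [a2 [A1 A2 E]]]] [bS [b1 [b2 [B1 B2 F]]]]|
    a b [aS [a1 [a2 [A1 A2 E]]]] [bS [b1 [b2 [B1 B2 F]]]]|s sS].
  - by split; [exact: rpred1|exists 1, 0; rewrite rpred1 rpred0 mul1r mulr1 addr0].
  - split; first by apply: rpredD => //; apply: rpredZ.
    exists (c *: a1 + b1), (c *: a2 + b2).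
    split; try by apply: rpredD => //; apply: rpredZ.
    by rewrite mulrDl -scalerAl E F mulrDr -scalerAr; lin; ring.
  - split; first exact: rpredM.
    exists (a1 * b1), (a2 * b1 + a * b2); split; first exact: rpredM.
      by apply: rpredD; apply: rpredM.
    by rewrite -mulrA F mulrDr mulrA E mulrDl !addrA !mulrA.
  - by split; [exact: mem_gen_subalg|exact: tS].
pose M a := exists2 c : 'I_p -> A, (forall l, c l \in gen_subalg S) &
  a = \sum_(l < p) t ^+ l * c l.
have M0 : M 0.
  by exists (fun=> 0) => [l|]; rewrite ?rpred0 // big1 // => l _; rewrite mulr0.
have MD a b : M a -> M b -> M (a + b).
  move=> [c cS ->] [d dS ->]; exists (fun l => c l + d l) => [l|].
    by apply: rpredD.
  by rewrite -big_split; apply: eq_bigr => l _; rewrite mulrDr.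
have MS a b : M a -> b \in gen_subalg S -> M (a * b).
  move=> [c cS ->] bS; exists (fun l => c l * b) => [l|]; first exact: rpredM.
  by rewrite mulr_suml; apply: eq_bigr => l _; rewrite mulrA.
have Msum (J : finType) (F : J -> A) : (forall j, M (F j)) -> M (\sum_j F j).
  by move=> MF; apply: big_ind.
have Mt n : M (t ^+ n).
  elim/ltn_ind: n => n IH; have [np|pn] := ltnP n p.
    exists (fun l => (l == Ordinal np)%:R) => [l|].
      by case: eqP => _; rewrite ?rpred1 ?rpred0.
    rewrite (bigD1 (Ordinal np)) //= eqxx mulr1 big1 ?addr0 // => l /negbTE ->.
    by rewrite mulr0.
  rewrite -(subnK pn) exprD tp mulrDr (S0_central z1Z) mulrA.
  rewrite -exprSr; apply: MD; apply: MS; rewrite ?S0S' //; apply: IH; lia.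
have Mmul a b : M a -> M b -> M (a * b).
  have tM a' : M a' -> M (t * a').
    move=> [c cS ->]; rewrite mulr_sumr; apply: Msum => l.
    by rewrite mulrA -exprS; apply: MS.
  have SM n b' c : b' \in gen_subalg S -> c \in gen_subalg S -> M (b' * t ^+ n * c).
    elim: n b' => [|n IH] b' b'S cS.
      by rewrite expr0 mulr1 -[b']mul1r -(expr0 t) -mulrA; apply: MS => //; apply: rpredM.
    have [a1 [a2 [A1 A2 E]]] := comt _ b'S.
    rewrite exprS mulrA E mulrDl mulrDl -!mulrA; apply: MD; last by rewrite mulrA; apply: IH.
    by apply: tM; rewrite mulrA; apply: IH.
  move=> [c cS ->] [d dS ->]; rewrite mulr_suml; apply: (Msum) => l.
  rewrite mulr_sumr; apply: (Msum) => m.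
  have -> : t ^+ l * c l * (t ^+ m * d m) = t ^+ l * (c l * t ^+ m * d m) by rewrite !mulrA.
  elim: (val l) => [|n IH]; first by rewrite mul1r; apply: SM.
  by rewrite exprS -mulrA; apply: tM.
move=> a aS'; have {aS'} [c cS ->] : M a.
  elim/gen_subalg_ind: a / aS' => [|x a b Ma Mb|a b|s].
  - by rewrite -(expr0 t); apply: Mt.
  - by apply: MD => //; rewrite -mulr_algr; apply: MS => //; apply: rpredZ; exact: rpred1.
  - exact: Mmul.
  - rewrite inE => /orP[/eqP ->|sS]; first by rewrite -[t]expr1; apply: Mt.
    by rewrite -[s]mul1r -(expr0 t); apply: MS; [exact: Mt|exact: mem_gen_subalg].
have [z zP] := choice (fun l => Sf _ (cS l)).
exists (fun li => z li.1 li.2); split=> [[l i]|]; first exact: (zP l).1.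
rewrite -(pair_bigA _ (fun l i => z l i * (t ^+ l * f i))) /=.
apply: eq_bigr => l _; rewrite (zP l).2 mulr_sumr; apply: eq_bigr => i _.
by rewrite !mulrA (S0_central ((zP l).1 i)).
Qed.

End Adjoin.

Section DoubleSpan.
Variables (k : fieldType) (A : algType k) (c : double_gen -> A).
Hypothesis cR : forall r, r \in double_rels c -> r.1 = r.2.
Variables (p : nat) (pcharp : p \in [pchar k]) (p_gt2 : (2 < p)%N).

Local Notation u := (c gen_u).
Local Notation v := (c gen_v).
Local Notation zeta := (c gen_zeta).
Local Notation g := (c gen_g).
Local Notation gV := (c gen_gV).
Local Notation x := (c gen_x).
Local Notation y := (c gen_y).

Definition central_seq : seq A :=
  [:: g ^+ p; gV ^+ p; x ^+ p; y ^+ p; u ^+ p; v ^+ p; zeta ^+ p - zeta].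

Definition pbw_index : finType := ('I_p * ('I_p * ('I_p * ('I_p * ('I_p * ('I_p * unit))))))%type.

Definition pbw_elt (a : pbw_index) : A :=
  v ^+ a.1 * (zeta ^+ a.2.1 * (u ^+ a.2.2.1 * (g ^+ a.2.2.2.1 *
    (y ^+ a.2.2.2.2.1 * (x ^+ a.2.2.2.2.2.1 * 1))))).

Hypothesis cent : central (gen_subalg central_seq).

(** The generators x, y, g, u, zeta, v are adjoined in this order: moving each of
    them to the left of the previous ones produces terms of degree at most one in it,
    and its p-th power is central, or for zeta the sum of zeta and a central element.
    The inverse of g is then g^(p - 1) times a central element. *)
Lemma pbw_spans : exists2 S, spans central_seq pbw_elt S & forall i, c i \in gen_subalg S.
Proof.
have p_gt1 : (1 < p)%N by exact: ltnW.
have step (I : finType) (f : I -> A) S t z1 :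
    t ^+ p - z1 * t \in central_seq -> z1 \in gen_subalg central_seq ->
    spans central_seq f S ->
    (forall s, s \in S -> s \in central_seq \/ exists a b,
      [/\ a \in gen_subalg S, b \in gen_subalg S & s * t = t * a + b]) ->
    spans central_seq (fun li : 'I_p * I => t ^+ li.1 * f li.2) (t :: S).
  move=> tp z1Z Sf H; apply: (spans_adjoin p_gt1 cent (z0 := t ^+ p - z1 * t) (z1 := z1)) => //.
  - move=> s sS; case: (H s sS) => // sZ; exists s, 0; rewrite rpred0 mem_gen_subalg //.
    by split=> //; rewrite addr0 cent //; apply: mem_gen_subalg.
  - exact: mem_gen_subalg.
  - by rewrite subrK.
have step0 (I : finType) (f : I -> A) S t : t ^+ p \in central_seq ->
    spans central_seq f S ->
    (forall s, s \in S -> s \in central_seq \/ exists a b,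
      [/\ a \in gen_subalg S, b \in gen_subalg S & s * t = t * a + b]) ->
    spans central_seq (fun li : 'I_p * I => t ^+ li.1 * f li.2) (t :: S).
  move=> tp; apply: (step _ _ _ _ 0) => //; last exact: rpred0.
  by rewrite mul0r subr0.
pose mem (S : seq A) := mem_gen_subalg (S := S).
pose S1 := x :: central_seq; pose S2 := y :: S1; pose S3 := g :: S2; pose S4 := u :: S3.
pose S5 := zeta :: S4; pose S6 := v :: S5.
pose f1 (li : 'I_p * unit) := x ^+ li.1 * 1.
pose f2 (li : 'I_p * _) := y ^+ li.1 * f1 li.2.
pose f3 (li : 'I_p * _) := g ^+ li.1 * f2 li.2.
pose f4 (li : 'I_p * _) := u ^+ li.1 * f3 li.2.
pose f5 (li : 'I_p * _) := zeta ^+ li.1 * f4 li.2.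
have H1 : spans central_seq f1 S1.
  by apply: (step0 _ _ _ x _ (spans0 _)); rewrite ?inE ?eqxx ?orbT // => s; left.
have comm (S : seq A) (s t : A) : s \in S -> s * t = t * s ->
   exists a b, [/\ a \in gen_subalg S, b \in gen_subalg S & s * t = t * a + b].
  by move=> sS st; exists s, 0; rewrite rpred0 addr0 (mem S).
have H2 : spans central_seq f2 S2.
  apply: (step0 _ f1 S1 y _ H1); rewrite ?inE ?eqxx ?orbT // => s; rewrite inE => /orP[/eqP ->|]; last by left.
  right; exists x, (2^-1 *: x ^+ 2); split; rewrite ?rpredZ ?rpredX ?(mem S1) ?mem_head //.
  by rewrite (y_x cR) subrK.
have H3 : spans central_seq f3 S3.
  apply: (step0 _ f2 S2 g _ H2); rewrite ?inE ?eqxx ?orbT // => s; rewrite !inE => /or3P[/eqP ->|/eqP ->|]; last by left.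
    right; exists (y - x), 0; split; rewrite ?rpred0 ?rpredB ?(mem S2) ?inE ?eqxx ?orbT //.
    by rewrite mulrBr (g_y cR) (g_x cR) addrK addr0.
  by right; apply: comm; rewrite ?(g_x cR) // !inE eqxx ?orbT.
have H4 : spans central_seq f4 S4.
  apply: (step0 _ f3 S3 u _ H3); rewrite ?inE ?eqxx ?orbT // => s; rewrite !inE => /or4P[/eqP ->|/eqP ->|/eqP ->|]; last by left.
  - by right; apply: comm; rewrite ?(u_g cR) // !inE eqxx ?orbT.
  - right; exists y, (g - 1); split; rewrite ?rpredB ?rpred1 ?(mem S3) ?inE ?eqxx ?orbT //.
    by rewrite (u_y cR); lin; ring.
  - by right; apply: comm; rewrite ?(u_x cR) // !inE eqxx ?orbT.
have H5 : spans central_seq f5 S5.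
  apply: (step _ f4 S4 zeta 1 _ _ H4); rewrite ?mul1r ?rpred1 ?inE ?eqxx ?orbT // => s.
  rewrite !inE => /or4P[/eqP ->|/eqP ->|/eqP ->|/orP[/eqP ->|]]; last by left.
  - right; exists u, u; split; rewrite ?(mem S4) ?inE ?eqxx ?orbT //.
    by rewrite (u_zeta cR).
  - by right; apply: comm; rewrite ?(zeta_g cR) // !inE eqxx ?orbT.
  - right; exists y, (- y); split; rewrite ?rpredN ?(mem S4) ?inE ?eqxx ?orbT //.
    by rewrite (zeta_y cR) addrK.
  - right; exists x, (- x); split; rewrite ?rpredN ?(mem S4) ?inE ?eqxx ?orbT //.
    by rewrite (zeta_x cR) addrK.
have H6 : spans central_seq pbw_elt S6.
  apply: (step0 _ f5 S5 v _ H5); rewrite ?inE ?eqxx ?orbT // => s.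
  have [mz mu mg] : [/\ zeta \in gen_subalg S5, u \in gen_subalg S5 & g \in gen_subalg S5].
    by split; rewrite (mem S5) // !inE eqxx ?orbT.
  have [my mx] : y \in gen_subalg S5 /\ x \in gen_subalg S5.
    by split; rewrite (mem S5) // !inE eqxx ?orbT.
  rewrite !inE => /or4P[/eqP ->|/eqP ->|/eqP ->|/or3P[/eqP ->|/eqP ->|]]; last by left.
  - right; exists (zeta - 1), 0; split; rewrite ?rpredB ?rpred1 ?rpred0 //.
    by rewrite mulrBr mulr1 (v_zeta cR) addrK addr0.
  - right; exists u, (2^-1 *: u ^+ 2); split; rewrite ?rpredZ ?rpredX //.
    by rewrite (v_u cR) subrK.
  - right; exists g, (- (g * u)); split; rewrite ?rpredN ?rpredM //.
    by rewrite (v_g cR) addrK.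
  - right; exists y, (g * zeta - y * u); split; rewrite ?rpredB ?rpredM //.
    by rewrite (v_y cR); lin; ring.
  - right; exists x, (g - 1 - x * u); split; rewrite ?rpredB ?rpredM ?rpred1 //.
    by rewrite (v_x cR); lin; ring.
exists S6 => //.
have mg : g \in gen_subalg S6 by rewrite (mem S6) // !inE eqxx ?orbT.
case; try by rewrite (mem S6) // !inE eqxx ?orbT.
have -> : gV = g ^+ p.-1 * gV ^+ p.
  have gg n : g ^+ n * gV ^+ n = 1.
    by elim: n => [|n IH]; rewrite ?mulr1 // exprSr exprS -mulrA (mulrA g) (g_gV cR) mul1r IH.
  by rewrite -[in gV ^+ p](prednK (ltnW p_gt1)) exprSr mulrA gg mul1r.
by apply: rpredM; [exact: rpredX|rewrite (mem S6) // !inE eqxx ?orbT].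
Qed.

End DoubleSpan.

Section DtildeSpan.
Variables (k : fieldType) (p : nat) (pcharp : p \in [pchar k]) (p_gt2 : (2 < p)%N).

Local Notation D := (Dtilde k).
Local Notation c := (Dtilde_gen k).

Lemma Dtilde_rels r : r \in double_rels c -> r.1 = r.2.
Proof.
have E : c = to_quot _ \o @free_gen k _ by [].
rewrite E -double_rels_map => /mapP[[a b] ab ->] /=.
by apply/to_quotP; exact: in_ideal_rel.
Qed.

Lemma Zgens_central_seq : Zgens k p = central_seq c p.
Proof. by rewrite /Zgens zeta_pE. Qed.

Lemma central_gensW (z : D) : central_gens c z -> forall a, z * a = a * z.
Proof.
move=> zc; elim/Dtilde_ind => [|x a b Ha Hb|a b Ha Hb|i]; last exact: zc.
- by rewrite mul1r mulr1.
- by rewrite mulrDl mulrDr -scalerAl -scalerAr Ha Hb.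
- exact: commrM Ha Hb.
Qed.

Lemma Z_central : central (gen_subalg (Zgens k p)).
Proof.
move=> z zZ; apply: central_gensW; elim/gen_subalg_ind: z / zZ => [|x a b Ha Hb|a b Ha Hb|s].
- by move=> i; rewrite mul1r mulr1.
- by move=> i; rewrite mulrDl mulrDr -scalerAl -scalerAr Ha Hb.
- by move=> i; apply/commr_sym/commrM; apply/commr_sym; [exact: Ha|exact: Hb].
rewrite Zgens_central_seq !inE.
have H1 := central_gp Dtilde_rels pcharp.
have H2 := central_gVp Dtilde_rels pcharp.
have H3 := central_xp Dtilde_rels pcharp p_gt2.
have H4 := central_yp Dtilde_rels pcharp p_gt2.
have H5 := central_up Dtilde_rels pcharp p_gt2.
have H6 := central_vp Dtilde_rels pcharp p_gt2.
have H7 := central_zetap Dtilde_rels pcharp p_gt2.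
by do ![case/orP]; move/eqP->.
Qed.

Definition pbw (i : pbw_index p) : D := pbw_elt c i.

Lemma Dtilde_spans (a : D) : exists z : pbw_index p -> D,
  (forall i, z i \in gen_subalg (Zgens k p)) /\ a = \sum_i z i * pbw i.
Proof.
have Zc := Z_central; rewrite Zgens_central_seq in Zc *.
have [S [_ _ H] cS] := pbw_spans Dtilde_rels p_gt2 Zc.
have [G1 GL GM] := gen_subalg_closed S.
apply: H; elim/Dtilde_ind: a => [|x a b Ha Hb|a b Ha Hb|i]; last exact: cS.
- exact: G1.
- exact: GL.
- exact: GM.
Qed.

End DtildeSpan.

(** * Laurent polynomials *)

Lemma mpoly_alg_ind (k : fieldType) n (P : {mpoly k[n]} -> Prop) :
  P 1 -> (forall c a b, P a -> P b -> P (c *: a + b)) ->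
  (forall a b, P a -> P b -> P (a * b)) -> (forall i, P 'X_i) -> forall a, P a.
Proof.
move=> P1 PL PM PX a.
have P0 : P 0 by have := PL (-1) 1 1 P1 P1; rewrite scaleN1r addNr.
rewrite [a]mpolyE; elim: (X in \sum_(_ <- X) _) => [|m s IH]; first by rewrite big_nil.
rewrite big_cons; apply: PL => //; rewrite mpolyXE_id.
by apply: (big_ind P) => // i _; elim: (m i) => [|e He]; rewrite ?expr0 // exprS; apply: PM.
Qed.

Lemma laurent_ind (k : fieldType) (P : laurent k -> Prop) :
  P 1 -> (forall c a b, P a -> P b -> P (c *: a + b)) ->
  (forall a b, P a -> P b -> P (a * b)) ->
  (forall i, P (to_quot _ (free_gen k i))) -> forall a, P a.
Proof.
move=> P1 PL PM PG q; have [a ->] := to_quot_surj q.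
elim/free_alg_ind: a => [|c a b Ha Hb|a b Ha Hb|i].
- by rewrite rmorph1.
- by rewrite linearP; apply: PL.
- by rewrite rmorphM; apply: PM.
- exact: PG.
Qed.

(** The universal properties below are stated for a commutative target algebra B;
    the proof of commutativity is an argument of each lift, for the morphism
    structures to be inferred from the term. *)
Section Lifts.
Variables (k : fieldType) (B : algType k).
Hypothesis commB : forall a b : B, a * b = b * a.

Section MpolyLift.
Variables (n : nat) (h : 'I_n -> B).

Definition mpoly_lift of (forall a b : B, a * b = b * a) : {mpoly k[n]} -> B :=
  mmap (in_alg B) h.
Local Notation lift := (mpoly_lift commB).

Lemma mpoly_lift_additive : zmod_morphism lift.
Proof. exact: mmap_is_additive. Qed.
Lemma mpoly_lift_monoid : monoid_morphism lift.
Proof.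
have [M O] := @commr_mmap_is_multiplicative n k B h (in_alg B)
  (fun i x => commB x (h i)) (fun p m m' => commB _ _).
by split.
Qed.
Lemma mpoly_lift_scalable : scalable lift.
Proof. by move=> c a; rewrite /mpoly_lift mmapZ /= mulr_algl. Qed.
HB.instance Definition _ := GRing.isZmodMorphism.Build _ _ lift mpoly_lift_additive.
HB.instance Definition _ := GRing.isMonoidMorphism.Build _ _ lift mpoly_lift_monoid.
HB.instance Definition _ := GRing.isScalable.Build k _ _ *:%R lift mpoly_lift_scalable.

Lemma mpoly_liftX i : lift 'X_i = h i.
Proof. by rewrite /mpoly_lift mmapX mmap1U. Qed.
End MpolyLift.

Section LaurentLift.
Variables (t tV : B).
Hypothesis ttV : t * tV = 1.

Definition laurent_lift of t * tV = 1 & (forall a b : B, a * b = b * a) : laurent k -> B :=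
  quot_lift (free_lift (fun b : bool => if b then t else tV)).
Local Notation lift := (laurent_lift ttV commB).

Lemma laurent_liftQ a : lift (to_quot _ a) = free_lift (fun b : bool => if b then t else tV) a.
Proof.
apply: quot_liftE => r; rewrite !inE => /orP[] /eqP -> /=.
  by rewrite rmorphM rmorph1 /= !free_liftE.
by rewrite rmorphM rmorph1 /= !free_liftE commB.
Qed.

Lemma laurent_lift_additive : zmod_morphism lift.
Proof.
move=> x y; have [a ->] := to_quot_surj x; have [c ->] := to_quot_surj y.
by rewrite -rmorphB !laurent_liftQ rmorphB.
Qed.
Lemma laurent_lift_monoid : monoid_morphism lift.
Proof.
split=> [|x y]; first by rewrite -(rmorph1 (to_quot _)) laurent_liftQ rmorph1.
have [a ->] := to_quot_surj x; have [c ->] := to_quot_surj y.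
by rewrite -rmorphM !laurent_liftQ rmorphM.
Qed.
Lemma laurent_lift_scalable : scalable lift.
Proof.
by move=> c x; have [a ->] := to_quot_surj x; rewrite -linearZ !laurent_liftQ linearZ.
Qed.
HB.instance Definition _ := GRing.isZmodMorphism.Build _ _ lift laurent_lift_additive.
HB.instance Definition _ := GRing.isMonoidMorphism.Build _ _ lift laurent_lift_monoid.
HB.instance Definition _ := GRing.isScalable.Build k _ _ *:%R lift laurent_lift_scalable.
End LaurentLift.

Section TensorLift.
Variables (A1 A2 : algType k) (f1 : {lrmorphism A1 -> B}) (f2 : {lrmorphism A2 -> B}).

Definition tensor_lift of (forall a b : B, a * b = b * a) : A1 ⊗ A2 -> B :=
  tens_lift (fun a b => f1 a * f2 b).
Local Notation lift := (tensor_lift commB).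

Lemma tensor_lift_bil : is_bilinear (fun a b => f1 a * f2 b).
Proof.
split=> [b c x y|a c x y]; rewrite linearP ?mulrDl ?mulrDr.
  by rewrite -scalerAl.
by rewrite -scalerAr.
Qed.

Lemma tensor_liftE a b : lift (a ⊗' b) = f1 a * f2 b.
Proof. exact: tens_liftE tensor_lift_bil. Qed.

Lemma tensor_lift_additive : zmod_morphism lift.
Proof.
move=> s t; rewrite /tensor_lift -[- t]scaleN1r addrC tens_lift_linear; last exact: tensor_lift_bil.
by rewrite scaleN1r addrC.
Qed.
Lemma tensor_lift_scalable : scalable lift.
Proof. by move=> c s; exact: tens_liftZ tensor_lift_bil. Qed.
HB.instance Definition _ := GRing.isZmodMorphism.Build _ _ lift tensor_lift_additive.
HB.instance Definition _ := GRing.isScalable.Build k _ _ *:%R lift tensor_lift_scalable.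
Lemma tensor_lift_monoid : monoid_morphism lift.
Proof.
split=> [|s t]; first by rewrite tensor_liftE !rmorph1 mulr1.
elim/tensor_ind: s => [|s s' Hs Hs'|a b].
- by rewrite mul0r linear0 mul0r.
- by rewrite mulrDl !raddfD /= Hs Hs' mulrDl.
elim/tensor_ind: t => [|t t' Ht Ht'|c d].
- by rewrite mulr0 linear0 mulr0.
- by rewrite mulrDr !raddfD /= Ht Ht' mulrDr.
rewrite [(a ⊗' b) * _]tmulE !tensor_liftE !rmorphM -!mulrA; congr (_ * _).
by rewrite !mulrA [f1 c * _]commB.
Qed.
HB.instance Definition _ := GRing.isMonoidMorphism.Build _ _ lift tensor_lift_monoid.
End TensorLift.

End Lifts.

Lemma tens1DZ (k : fieldType) (A1 A2 : algType k) (P : A1 ⊗ A2 -> Prop) :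
  (forall a b, P a -> P b -> P (a * b)) -> (forall a b, P a -> P b -> P (a + b)) -> P 0 ->
  (forall a, P (a ⊗' 1)) -> (forall b, P (1 ⊗' b)) -> forall t, P t.
Proof.
move=> PM PD P0 Pl Pr t; elim/tensor_ind: t => // a b.
rewrite -[a]mulr1 -[b]mul1r -[_ ⊗' _]tmulE; exact: PM.
Qed.

Section LaurentNormal.
Variables (k : fieldType) (B : algType k) (t tV : B).
Variables (R : algType k) (F : {lrmorphism R -> B}) (T : R).
Hypotheses (commB : forall a b : B, a * b = b * a) (tVt : tV * t = 1) (FT : F T = t).

(** The property of becoming an element F q after multiplication by a power of t. *)
Definition laurent_normal (a : B) := exists N q, a = tV ^+ N * F q.

Lemma laurent_normal_closed :
  [/\ laurent_normal 1,
      forall c a b, laurent_normal a -> laurent_normal b -> laurent_normal (c *: a + b),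
      forall a b, laurent_normal a -> laurent_normal b -> laurent_normal (a * b),
      laurent_normal tV & forall q, laurent_normal (F q)].
Proof.
have TVp n : tV ^+ n * F (T ^+ n) = 1.
  by rewrite rmorphXn /= FT -exprMn_comm ?tVt ?expr1n //; exact: commB.
have raise n m q : tV ^+ n * F q = tV ^+ (n + m) * F (T ^+ m * q).
  by rewrite exprD rmorphM /= -mulrA [X in _ = _ * X]mulrA TVp mul1r.
split=> [|c _ _ [n [q ->]] [m [r ->]]|_ _ [n [q ->]] [m [r ->]]||q].
- by exists 0%N, 1; rewrite rmorph1 mulr1.
- exists (n + m)%N, (c *: (T ^+ m * q) + T ^+ n * r).
  by rewrite (raise n m) (raise m n) [(m + n)%N]addnC linearP mulrDr -scalerAr.
- exists (n + m)%N, (q * r); rewrite rmorphM exprD -!mulrA; congr (_ * _).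
  by rewrite mulrA [F q * _]commB -mulrA.
- by exists 1%N, 1; rewrite rmorph1 mulr1.
- by exists 0%N, q; rewrite mul1r.
Qed.

(** Up to a power of the unit t, an element of the kernel is of the form F q. *)
Lemma laurent_normal_inj (C : algType k) (f : {lrmorphism B -> C}) :
  (forall a, laurent_normal a) -> (forall q, f (F q) = 0 -> q = 0) -> injective f.
Proof.
move=> N H; apply: raddf_inj => a; have [n [q ->]] := N a => E.
have tn : t ^+ n * tV ^+ n = 1.
  by rewrite -exprMn_comm ?[t * _]commB ?tVt ?expr1n //; exact: commB.
have -> : q = 0; last by rewrite linear0 mulr0.
by apply: H; rewrite -[F q]mul1r -tn -mulrA rmorphM E mulr0.
Qed.

End LaurentNormal.

Section LaurentPoly.
Variable k : fieldType.

Definition laurent_poly : algType k := laurent k ⊗ {mpoly k[5]}.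

Definition lp_T : laurent_poly := to_quot (@laurent_rels_cons k) (free_gen k true) ⊗' 1.
Definition lp_TV : laurent_poly := to_quot (@laurent_rels_cons k) (free_gen k false) ⊗' 1.
Definition lp_X (i : 'I_5) : laurent_poly := 1 ⊗' 'X_i.

Lemma lp_TTV : lp_T * lp_TV = 1.
Proof.
rewrite [LHS]tmulE mulr1 -rmorphM; congr (_ ⊗' _); rewrite -(rmorph1 (to_quot _)).
by apply/to_quotP/in_ideal_rel; rewrite mem_head.
Qed.

Lemma lp_TVT : lp_TV * lp_T = 1.
Proof.
rewrite [LHS]tmulE mulr1 -rmorphM; congr (_ ⊗' _); rewrite -(rmorph1 (to_quot _)).
by apply/to_quotP/in_ideal_rel; rewrite inE mem_head orbT.
Qed.

Lemma lp_ind (P : laurent_poly -> Prop) :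
  P 1 -> (forall c a b, P a -> P b -> P (c *: a + b)) ->
  (forall a b, P a -> P b -> P (a * b)) -> P lp_T -> P lp_TV -> (forall i, P (lp_X i)) ->
  forall a, P a.
Proof.
move=> P1 PL PM PT PTV PX.
have bil := @tens_bilinear k (laurent k) {mpoly k[5]}.
have P0 : P 0 by have := PL (-1) 1 1 P1 P1; rewrite scaleN1r addNr.
apply: tens1DZ => //.
- by move=> a b Pa Pb; rewrite -[a]scale1r; apply: PL.
- elim/laurent_ind => // [c a b Ha Hb|a b Ha Hb|[]] //.
    by rewrite (bilDl bil) (bilZl bil); apply: PL.
  by rewrite -[1]mulr1 -[_ ⊗' _]tmulE; apply: PM.
- elim/mpoly_alg_ind => // [c a b Ha Hb|a b Ha Hb] //.
    by rewrite (bilDr bil) (bilZr bil); apply: PL.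
  by rewrite -[1]mulr1 -[_ ⊗' _]tmulE; apply: PM.
Qed.

Lemma commW (A : algType k) (a : A) (P := fun b => a * b = b * a) :
  P 1 /\ (forall c x y, P x -> P y -> P (c *: x + y)) /\ (forall x y, P x -> P y -> P (x * y)).
Proof.
split; first by rewrite /P mulr1 mul1r.
split; first by rewrite /P => c x y Hx Hy; rewrite mulrDr mulrDl -scalerAl -scalerAr Hx Hy.
by move=> x y; exact: commrM.
Qed.

Lemma comm_inv (A : algType k) (t tV : A) : t * tV = 1 -> tV * t = 1 ->
  (forall c, t * c = c * t) -> forall c, tV * c = c * tV.
Proof.
move=> ttV tVt T c; rewrite -[LHS]mulr1 -ttV mulrA -[tV * c * t]mulrA -T.
by rewrite !mulrA tVt mul1r.
Qed.

(** It is enough that the generators commute with everything; each of the properties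
    is first shown for a generator and then propagated by induction. *)
Lemma lp_comm (a b : laurent_poly) : a * b = b * a.
Proof.
have X i c : lp_X i * c = c * lp_X i.
  elim/tensor_ind: c => [|s t Hs Ht|l q]; first by rewrite mulr0 mul0r.
    by rewrite mulrDr mulrDl Hs Ht.
  by rewrite [LHS]tmulE [RHS]tmulE mul1r mulr1 [_ * q]mulrC.
have T c : lp_T * c = c * lp_T.
  have [H1 [HL HM]] := commW lp_T.
  refine (@lp_ind _ H1 HL HM erefl _ (fun i => esym (X i _)) c).
  by rewrite lp_TTV lp_TVT.
have TV c : lp_TV * c = c * lp_TV.
  exact: comm_inv lp_TTV lp_TVT T c.
have [H1 [HL HM]] := commW b.
exact/esym/(@lp_ind _ H1 HL HM (esym (T b)) (esym (TV b)) (fun i => esym (X i b)) a).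
Qed.

(** T is the variable of index 0. *)
Definition lp_vars (i : 'I_6) : laurent_poly := if unlift ord0 i is Some j then lp_X j else lp_T.
Definition lp_poly : {mpoly k[6]} -> laurent_poly := mpoly_lift lp_vars lp_comm.
HB.instance Definition _ := GRing.LRMorphism.on lp_poly.

Lemma lp_polyX0 : lp_poly 'X_ord0 = lp_T.
Proof. by rewrite [LHS]mpoly_liftX /lp_vars unlift_none. Qed.
Lemma lp_polyXS j : lp_poly 'X_(lift ord0 j) = lp_X j.
Proof. by rewrite [LHS]mpoly_liftX /lp_vars liftK. Qed.

Lemma lp_normal (a : laurent_poly) : laurent_normal lp_TV lp_poly a.
Proof.
have [H1 HL HM HV HF] := laurent_normal_closed lp_comm lp_TVT lp_polyX0.
apply: (lp_ind H1 HL HM _ HV) => [|i]; first by rewrite -lp_polyX0; exact: HF.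
by rewrite -lp_polyXS; exact: HF.
Qed.

Section Lift.
Variables (B : algType k) (commB : forall a b : B, a * b = b * a).
Variables (t tV : B) (ttV : t * tV = 1) (h : 'I_5 -> B).

Definition lp_lift : laurent_poly -> B :=
  tensor_lift (laurent_lift ttV commB) (mpoly_lift h commB) commB.
HB.instance Definition _ := GRing.LRMorphism.on lp_lift.

Lemma lp_liftT : lp_lift lp_T = t.
Proof.
rewrite [LHS]tensor_liftE rmorph1 mulr1.
exact: etrans (laurent_liftQ _ _ _) (free_liftE _ _).
Qed.
Lemma lp_liftTV : lp_lift lp_TV = tV.
Proof.
rewrite [LHS]tensor_liftE rmorph1 mulr1.
exact: etrans (laurent_liftQ _ _ _) (free_liftE _ _).
Qed.
Lemma lp_liftX i : lp_lift (lp_X i) = h i.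
Proof. by rewrite [LHS]tensor_liftE rmorph1 mul1r; exact: mpoly_liftX. Qed.

Lemma lp_lift_inj : (forall q, lp_lift (lp_poly q) = 0 -> q = 0) -> injective lp_lift.
Proof.
move=> H; exact: (laurent_normal_inj lp_comm lp_TVT (f := lp_lift) lp_normal H).
Qed.

End Lift.
End LaurentPoly.

(** * Polynomials that vanish at all points *)

Lemma digits_inj N n (a b : 'I_n -> nat) :
  (forall i, (a i < N)%N) -> (forall i, (b i < N)%N) ->
  (\sum_i a i * N ^ i = \sum_i b i * N ^ i)%N -> a =1 b.
Proof.
elim: n a b => [|n IH] a b aN bN; first by move=> _ [].
rewrite !big_ord_recl !muln1.
have E (c : 'I_n.+1 -> nat) : (\sum_(i < n) c (lift ord0 i) * N ^ bump 0 i =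
    (\sum_(i < n) c (lift ord0 i) * N ^ i) * N)%N.
  by rewrite big_distrl; apply: eq_bigr => i _; rewrite /bump leq0n add1n expnSr mulnA.
rewrite !E => H.
have H0 : a ord0 = b ord0.
  by have := congr1 (modn^~ N) H; rewrite ![(_ + _ * N)%N]addnC !modnMDl !modn_small.
have N0 : (0 < N)%N by apply: leq_ltn_trans (aN ord0).
have /IH HS : (\sum_(i < n) a (lift ord0 i) * N ^ i = \sum_(i < n) b (lift ord0 i) * N ^ i)%N.
  by have := H; rewrite H0 => /addnI/eqP; rewrite eqn_pmul2r // => /eqP.
by move=> i; case: (unliftP ord0 i) => [j|] -> //; apply: HS.
Qed.

Section Vanish.
Variable k : closedFieldType.

(** Otherwise q + 1, which takes the value 1 only, would have a root. *)
Lemma poly_vanish (q : {poly k}) : (forall t, q.[t] = 0) -> q = 0.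
Proof.
move=> H; have [q1|q1] := leqP (size q) 1.
  by rewrite (size1_polyC q1) -horner_coef0 H.
have /closed_rootP [t] : size (q + 1) != 1.
  by rewrite size_polyDl ?size_poly1 // neq_ltn q1 orbT.
by rewrite rootE hornerD H hornerC add0r oner_eq0.
Qed.

(** Kronecker substitution X_i := t ^ (N ^ i), where N exceeds all exponents,
    keeps the monomials apart and reduces to one variable. *)
Lemma mpoly_vanish n (q : {mpoly k[n]}) : (forall v, q.@[v] = 0) -> q = 0.
Proof.
move=> H; pose N := (msize q).+1.
pose kap (m : 'X_{1..n}) := (\sum_i m i * N ^ i)%N.
pose w := \sum_(m <- msupp q) q@_m *: 'X^(kap m).
have w0 : w = 0.
  apply: poly_vanish => t; rewrite -[RHS](H (fun i => t ^+ (N ^ i))) mevalE horner_sum.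
  apply: eq_bigr => m _; rewrite hornerZ hornerXn; congr (_ * _).
  by rewrite -prodrXr; apply: eq_bigr => i _; rewrite -exprM mulnC.
apply/mpolyP => m; rewrite mcoeff0; have [mq|mq] := boolP (m \in msupp q); last first.
  by apply/eqP; rewrite mcoeff_eq0.
have := congr1 (coefp (kap m)) w0; rewrite /= coef0 coef_sum (bigD1_seq m) ?msupp_uniq //=.
rewrite coefZ coefXn eqxx mulr1 big1_seq ?addr0 // => m' /andP[mm' m'q].
rewrite coefZ coefXn; case: eqP => [E|]; last by rewrite mulr0.
have small (a : 'X_{1..n}) i : a \in msupp q -> (a i < N)%N.
  move=> aq; rewrite /N ltnS; apply: leq_trans (ltnW (msize_mdeg_lt aq)).
  by rewrite mdegE (bigD1 i) //= leq_addr.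
case/eqP: mm'; apply/mnmP; apply: (@digits_inj N) => //.
- by move=> i; apply: small.
- by move=> i; apply: small.
Qed.

End Vanish.

(** * Eigenfunctions of the central subalgebra *)

Section Monomials.
Variables (k : fieldType) (A : algType k) (c : double_gen -> A).

Local Notation u := (c gen_u).
Local Notation v := (c gen_v).
Local Notation zeta := (c gen_zeta).
Local Notation g := (c gen_g).
Local Notation x := (c gen_x).
Local Notation y := (c gen_y).

Definition pbw_mon (j l i m r n : nat) : A :=
  v ^+ j * (zeta ^+ l * (u ^+ i * (g ^+ m * (y ^+ r * x ^+ n)))).

Variable p : nat.
Local Notation C z := (forall a, z * a = a * z).

Lemma pbw_mon_x j l i m r n : pbw_mon j l i m r n * x ^+ p = pbw_mon j l i m r (n + p).
Proof. by rewrite /pbw_mon -!mulrA -exprD. Qed.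
Lemma pbw_mon_y j l i m r n : C (y ^+ p) ->
  pbw_mon j l i m r n * y ^+ p = pbw_mon j l i m (r + p) n.
Proof. by move=> z; rewrite /pbw_mon -!mulrA -z [y ^+ r * _]mulrA -exprD. Qed.
Lemma pbw_mon_g j l i m r n : C (g ^+ p) ->
  pbw_mon j l i m r n * g ^+ p = pbw_mon j l i (m + p) r n.
Proof. by move=> z; rewrite /pbw_mon -4!mulrA -z [g ^+ m * _]mulrA -exprD. Qed.
Lemma pbw_mon_u j l i m r n : C (u ^+ p) ->
  pbw_mon j l i m r n * u ^+ p = pbw_mon j l (i + p) m r n.
Proof. by move=> z; rewrite /pbw_mon -3!mulrA -z [u ^+ i * _]mulrA -exprD. Qed.
Lemma pbw_mon_v j l i m r n : C (v ^+ p) ->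
  pbw_mon j l i m r n * v ^+ p = pbw_mon (j + p) l i m r n.
Proof. by move=> z; rewrite /pbw_mon -1!mulrA -z [v ^+ j * _]mulrA -exprD. Qed.
(* The exponent 0 of zeta suffices, zeta acting through its value s. *)
Lemma pbw_mon_zeta j i m r n : C (zeta ^+ p - zeta) ->
  pbw_mon j 0 i m r n * (zeta ^+ p - zeta) = pbw_mon j p i m r n - pbw_mon j 1 i m r n.
Proof.
move=> z; rewrite /pbw_mon expr0 mul1r expr1 -mulrA -z mulrBl mulrBr //.
Qed.

End Monomials.

Section Twisted.
Variables (k : fieldType) (p : nat) (pcharp : p \in [pchar k]) (p_gt2 : (2 < p)%N).
Let two0 : (2%:R : k) != 0 := pchar_two_neq0 pcharp p_gt2.
Let p_gt0 : (0 < p)%N. Proof. exact: ltnW (ltnW p_gt2). Qed.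

Local Notation D := (Dtilde k).
Local Notation c := (Dtilde_gen k).

Definition act (a : D) (f : pbw_fun k) : pbw_fun k := val (pbw_rep two0 a) f.

Lemma act_gen i f : act (c i) f = pbw_op i f.
Proof. by rewrite /act /pbw_rep Dtilde_liftE. Qed.
Lemma actM a b f : act (a * b) f = act a (act b f).
Proof. by rewrite /act rmorphM. Qed.
Lemma actD a b f : act (a + b) f = act a f + act b f.
Proof. by rewrite /act rmorphD. Qed.
Lemma actB a b f : act (a - b) f = act a f - act b f.
Proof. by rewrite /act rmorphB. Qed.
Lemma actZ x a f : act (x *: a) f = x *: act a f.
Proof. by rewrite /act linearZ. Qed.
Lemma act1 f : act 1 f = f.
Proof. by rewrite /act rmorph1. Qed.
Lemma actZr a x f : act a (x *: f) = x *: act a f.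
Proof.
by rewrite -{1}[f]act1 -actZ -actM -scalerAr mulr1 actZ.
Qed.

Local Notation mon := (pbw_mon c).

(** By the action of D on linear forms, the value of f at a monomial is the value of
    monomial . f at the word 1. The start of the exponents of g at an M which is zero
    in k gives access to the negative exponents, on which the operators depend through
    their class modulo p only. *)
Lemma act_mon j l i m r n (M : int) s f : (M%:~R : k) = 0 ->
  act (mon j l i m r n) f 0%N s 0%N M 0%N 0%N =
  (s + j%:R) ^+ l * f j (s + j%:R) i (M + m%:Z) r n.
Proof.
move=> M0; rewrite !actM.
have Hx n' j' s' i' m' r' n0 F : act (c gen_x ^+ n') F j' s' i' m' r' n0 = F j' s' i' m' r' (n' + n0)%N.
  elim: n' F => [|n' IH] F; first by rewrite expr0 act1.
  by rewrite exprSr actM IH act_gen.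
have Hy n' j' s' i' m' r' F : act (c gen_y ^+ n') F j' s' i' m' r' 0%N = F j' s' i' m' (n' + r')%N 0%N.
  elim: n' F => [|n' IH] F; first by rewrite expr0 act1.
  by rewrite exprSr actM IH act_gen /= /op_y !mul0r addr0.
have Hg n' j' s' i' m' F : act (c gen_g ^+ n') F j' s' i' m' 0%N 0%N = F j' s' i' (m' + n'%:Z) 0%N 0%N.
  elim: n' F => [|n' IH] F; first by rewrite expr0 act1 addr0.
  rewrite exprSr actM IH act_gen /= /op_g /op_h /op_t !mul0r !subr0.
  by rewrite -addrA -PoszD addn1.
have Hu n' j' s' i' m' F : act (c gen_u ^+ n') F j' s' i' m' 0%N 0%N = F j' s' (n' + i')%N m' 0%N 0%N.
  elim: n' F => [|n' IH] F; first by rewrite expr0 act1.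
  by rewrite exprSr actM IH act_gen /= /op_u mul0r subr0.
have Hz n' j' s' m' F : act (c gen_zeta ^+ n') F j' s' 0%N m' 0%N 0%N = s' ^+ n' * F j' s' 0%N m' 0%N 0%N.
  elim: n' F => [|n' IH] F; first by rewrite expr0 act1 mul1r.
  by rewrite exprSr actM IH act_gen /= /op_zeta !subr0 addr0 exprSr mulrA.
have Hv n' j' s' F : act (c gen_v ^+ n') F j' s' 0%N M 0%N 0%N = F (n' + j')%N (s' + n'%:R) 0%N M 0%N 0%N.
  elim: n' F => [|n' IH] F; first by rewrite expr0 act1 addr0.
  rewrite exprSr actM IH act_gen /= /op_v M0 !mul0r !subr0 !mul0r !addr0 -natr1.
  by rewrite ?mul0r ?addr0 addrA.
by rewrite Hv Hz Hu Hg Hy Hx !addn0.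
Qed.

(** A central z may be applied to f before or after a monomial, so that its effect is
    known at all words once it is known on the monomials. *)
Lemma act_central (z : D) (b : k) (f : pbw_fun k) :
  (forall a, z * a = a * z) ->
  (forall j s i (M : int) m r n, (M%:~R : k) = 0 ->
     act (mon j 0 i m r n * z) f 0%N s 0%N M 0%N 0%N =
     b * f j (s + j%:R) i (M + m%:Z) r n) ->
  act z f = b *: f.
Proof.
move=> zc H; apply/funext => j; apply/funext => s; apply/funext => i.
apply/funext => m; apply/funext => r; apply/funext => n.
(* An exponent of g, possibly negative, is a multiple of p plus a natural number. *)
pose M := ((m %/ p)%Z * p)%R; pose m' := `|(m %% p)%Z|%N.
have mE : m = M + m'%:Z.
  by rewrite /M /m' gez0_abs ?modz_ge0 -?divz_eq // eqz_nat -lt0n.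
have M0 : (M%:~R : k) = 0 by rewrite /M intrM -[p%:~R]/(p%:R) pcharf0 // mulr0.
have := H j (s - j%:R) i M m' r n M0.
by rewrite actM act_mon // expr0 mul1r subrK -mE => ->.
Qed.

Variables (lam X Y U V w s1 : k).
Hypotheses (lam0 : lam != 0) (s1w : s1 ^+ p - s1 = w).
Variables (j0 i0 m0 r0 n0 : nat).

(** The function a + pq |-> b^q, supported on the residue class of a. *)
Definition tw (b : k) (a n : nat) : k := (n %% p == a)%N%:R * b ^+ (n %/ p)%N.
Definition twz (b : k) (a : nat) (n : int) : k := ((n %% p)%Z == a)%:R * b ^ (n %/ p)%Z.

Lemma twD b a n : tw b a (n + p)%N = b * tw b a n.
Proof. by rewrite /tw modnDr divnDr ?dvdnn // divnn p_gt0 addn1 exprS; ring. Qed.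

Lemma twzD b a (n : int) : b != 0 -> twz b a (n + p%:Z) = b * twz b a n.
Proof.
move=> b0; rewrite /twz modzDr divzDr ?dvdzz // divzz eqz_nat gtn_eqF //.
by rewrite exprzDr ?unitfE // expr1z; ring.
Qed.

(** An eigenfunction of the central subalgebra: translating an exponent by p
    multiplies it by the prescribed eigenvalue, and zeta^p - zeta acts by s1^p - s1 on
    the functions supported at s = s1. Among the monomials of exponents less than p it
    only sees those with the exponents j0, i0, m0, r0, n0. *)
Definition twisted : pbw_fun k := fun j s i m r n =>
  (s == s1)%:R * tw V j0 j * tw U i0 i * twz lam m0 m * tw Y r0 r * tw X n0 n.

Lemma act_twisted :
  [/\ act (c gen_g ^+ p) twisted = lam *: twisted,
      act (c gen_x ^+ p) twisted = X *: twisted /\ act (c gen_y ^+ p) twisted = Y *: twisted,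
      act (c gen_u ^+ p) twisted = U *: twisted /\ act (c gen_v ^+ p) twisted = V *: twisted &
      act (c gen_zeta ^+ p - c gen_zeta) twisted = w *: twisted].
Proof.
have R := @Dtilde_rels k.
have Cg := central_gensW (central_gp R pcharp).
have Cx := central_gensW (central_xp R pcharp p_gt2).
have Cy := central_gensW (central_yp R pcharp p_gt2).
have Cu := central_gensW (central_up R pcharp p_gt2).
have Cv := central_gensW (central_vp R pcharp p_gt2).
have Cz := central_gensW (central_zetap R pcharp p_gt2).
split; [|split|split|]; apply: act_central => // j s i M m r n M0.
- by rewrite pbw_mon_g // act_mon // /twisted PoszD addrA twzD //; ring.
- by rewrite pbw_mon_x // act_mon // /twisted twD; ring.
- by rewrite pbw_mon_y // act_mon // /twisted twD; ring.
- by rewrite pbw_mon_u // act_mon // /twisted twD; ring.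
- by rewrite pbw_mon_v // act_mon // /twisted (natrD k j p) (pcharf0 pcharp) addr0 twD; ring.
- rewrite pbw_mon_zeta // actB.
  have E l := act_mon j l i m r n s twisted M0.
  apply: etrans (congr2 (fun a b => a - b) (E p) (E 1%N)) _.
  rewrite -mulrBl expr1 /twisted.
  by case: eqP => [->|_]; rewrite -?s1w ?(mul0r, mulr0).
Qed.

Lemma act_twisted_pbw (idx : pbw_index p) :
  (j0 < p)%N ->
  act (pbw k idx) twisted 0%N (s1 - j0%:R) 0%N 0 0%N 0%N =
  ([&& idx.1 == j0 :> nat, idx.2.2.1 == i0 :> nat, idx.2.2.2.1 == m0 :> nat,
       idx.2.2.2.2.1 == r0 :> nat & idx.2.2.2.2.2.1 == n0 :> nat])%:R * s1 ^+ idx.2.1.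
Proof.
move=> j0p; case: idx => j [l [i [m [r [n []]]]]] /=.
have -> : pbw k (j, (l, (i, (m, (r, (n, tt)))))) = mon j l i m r n.
  by rewrite /pbw /pbw_elt /= mulr1.
rewrite act_mon // add0r /twisted /tw /twz modz_nat divz_nat eqz_nat.
rewrite !modn_small // !divn_small // expr0z !expr0 !mulr1.
case: (eqVneq (j : nat) j0) => [->|_]; last by rewrite !(mul0r, mulr0).
rewrite subrK eqxx /= !mul1r mulrC; congr (_ * _).
by do 4?[case: eqP => _; rewrite ?mul0r ?mulr0 ?mul1r //].
Qed.

End Twisted.

(** * The central subalgebra is a Laurent polynomial algebra *)

Section ZLift.
Variables (k : fieldType) (p : nat) (pcharp : p \in [pchar k]) (p_gt2 : (2 < p)%N).

Local Notation Z := (subalg (Zgens k p)).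

Lemma Z_comm (a b : Z) : a * b = b * a.
Proof.
apply: val_inj; rewrite !rmorphM /=.
exact: (Z_central pcharp p_gt2 (valP a)).
Qed.

Lemma Zgens_mem (i : 'I_7) : (Zgens k p)`_i \in gen_subalg (Zgens k p).
Proof. by apply: mem_gen_subalg; apply: mem_nth. Qed.

Definition Zgen (i : 'I_7) : Z := Sub (Zgens k p)`_i (Zgens_mem i).

Lemma Zgen_gV : Zgen ord0 * Zgen (lift ord0 ord0) = 1.
Proof. by apply: val_inj; rewrite rmorphM rmorph1 /=; exact: gp_gVp (@Dtilde_rels k) p. Qed.

Definition zlift : laurent_poly k -> Z :=
  lp_lift Z_comm Zgen_gV (fun i : 'I_5 => Zgen (lift ord0 (lift ord0 i))).
HB.instance Definition _ := GRing.LRMorphism.on zlift.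

Lemma subalg_surj (A R : algType k) (S : seq A) (f : {lrmorphism R -> subalg S}) :
  (forall s, s \in S -> exists a, incl (f a) = s) -> forall z, exists a, f a = z.
Proof.
move=> fS z; suff [a fa] : exists a, incl (f a) = val z by exists a; apply: val_inj.
move: (val z) (valP z : val z \in gen_subalg S); apply: gen_subalg_ind => [|c x y [a <-] [b <-]|x y [a <-] [b <-]|s /fS] //.
- by exists 1; rewrite rmorph1 rmorph1.
- by exists (c *: a + b); rewrite !linearP.
- by exists (a * b); rewrite !rmorphM.
Qed.

Lemma zliftT : zlift (lp_T k) = Zgen ord0. Proof. exact: lp_liftT. Qed.
Lemma zliftTV : zlift (lp_TV k) = Zgen (lift ord0 ord0). Proof. exact: lp_liftTV. Qed.
Lemma zliftX i : zlift (lp_X k i) = Zgen (lift ord0 (lift ord0 i)).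
Proof. exact: lp_liftX. Qed.

Lemma zlift_surj z : exists a, zlift a = z.
Proof.
apply: subalg_surj => s /(nthP 0) [i i7 <-].
have -> : (Zgens k p)`_i = val (Zgen (Ordinal i7)) by [].
case: (unliftP ord0 (Ordinal i7)) => [j|] ->; last by exists (lp_T k); exact: (congr1 (@incl _ _ _) zliftT).
case: (unliftP ord0 j) => [l|] ->; first by exists (lp_X k l); exact: (congr1 (@incl _ _ _) (zliftX l)).
by exists (lp_TV k); exact: (congr1 (@incl _ _ _) zliftTV).
Qed.

Definition zpoly (q : {mpoly k[6]}) : Dtilde k := incl (zlift (lp_poly q)).

Lemma zpoly_closed : [/\ zpoly 1 = 1, forall c a b, zpoly (c *: a + b) = c *: zpoly a + zpoly b,
  forall a b, zpoly (a * b) = zpoly a * zpoly b,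
  zpoly 'X_ord0 = (Zgens k p)`_0 & forall i : 'I_5, zpoly 'X_(lift ord0 i) = (Zgens k p)`_i.+2].
Proof.
split=> [|c a b|a b||i].
- by rewrite /zpoly !rmorph1.
- by rewrite /zpoly !linearP.
- by rewrite /zpoly !rmorphM.
- by rewrite /zpoly lp_polyX0 zliftT.
- by rewrite /zpoly lp_polyXS zliftX.
Qed.

Section Point.
Variables (lam X Y U V w s1 : k).
Hypotheses (lam0 : lam != 0) (s1w : s1 ^+ p - s1 = w).
Variables (j0 i0 m0 r0 n0 : nat).

(** The eigenvalues of the central generators on the eigenfunction. *)
Definition point (i : 'I_6) : k := nth 0 [:: lam; X; Y; U; V; w] i.
Local Notation tw := (twisted p lam X Y U V s1 j0 i0 m0 r0 n0).
Local Notation act := (act pcharp p_gt2).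

Lemma act_poly (zf : {mpoly k[6]} -> Dtilde k) (f : pbw_fun k) : zf 1 = 1 ->
  (forall c a b, zf (c *: a + b) = c *: zf a + zf b) ->
  (forall a b, zf (a * b) = zf a * zf b) ->
  (forall i, act (zf 'X_i) f = point i *: f) -> forall q, act (zf q) f = q.@[point] *: f.
Proof.
move=> z1 zL zM zX; elim/mpoly_alg_ind => [|x a b Ha Hb|a b Ha Hb|i].
- by rewrite z1 act1 meval1 scale1r.
- by rewrite zL actD actZ Ha Hb mevalD mevalZ scalerDl scalerA.
- by rewrite zM actM Hb actZr Ha scalerA mevalM mulrC.
- by rewrite mevalXU.
Qed.

Lemma act_zpoly q : act (zpoly q) tw = q.@[point] *: tw.
Proof.
have [z1 zL zM zX0 zXS] := zpoly_closed.
have [Hg [Hx Hy] [Hu Hv] Hz] := act_twisted pcharp p_gt2 X Y U V lam0 s1w j0 i0 m0 r0 n0.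
apply: act_poly => // i; case: (unliftP ord0 i) => [j|] ->; last by rewrite zX0.
rewrite zXS; case: j => [[|[|[|[|[|//]]]]] j5] //=.
by rewrite zeta_pE.
Qed.

(** Applying a relation between the monomials to an eigenfunction, and taking the value
    at the word 1, specialises its coefficients at the eigenvalues and isolates the
    monomials that differ only by their exponent of zeta. *)
Lemma act_sum_zpoly (F : pbw_index p -> {mpoly k[6]}) :
  (j0 < p)%N -> \sum_i zpoly (F i) * pbw k i = 0 ->
  \sum_(i : pbw_index p) (F i).@[point] *
     ([&& i.1 == j0 :> nat, i.2.2.1 == i0 :> nat, i.2.2.2.1 == m0 :> nat,
       i.2.2.2.2.1 == r0 :> nat & i.2.2.2.2.2.1 == n0 :> nat]%:R * s1 ^+ i.2.1) = 0.
Proof.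
move=> j0p /(congr1 (fun a => act a tw 0%N (s1 - j0%:R) 0%N 0 0%N 0%N)).
have act0 : act 0 tw = 0.
  by have := actZ pcharp p_gt2 0 0 tw; rewrite !scale0r.
rewrite act0 => H; rewrite -[RHS]H.
transitivity ((\sum_i act (zpoly (F i) * pbw k i) tw) 0%N (s1 - j0%:R) 0%N 0 0%N 0%N).
  pose ev (f : pbw_fun k) := f 0%N (s1 - j0%:R) 0%N 0 0%N 0%N.
  rewrite -/(ev _) (big_morph ev (id1 := 0) (op1 := +%R)) //.
  apply: eq_bigr => i _; rewrite /ev -(act_twisted_pbw pcharp p_gt2 lam X Y U V s1 i0 m0 r0 n0 i j0p).
  have -> : zpoly (F i) * pbw k i = pbw k i * zpoly (F i).
    exact: (Z_central pcharp p_gt2 (valP _)).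
  apply: etrans _ (esym (congr1 ev (actM pcharp p_gt2 (pbw k i) (zpoly (F i)) tw))).
  have Hb b := congr1 ev (actZr pcharp p_gt2 (pbw k i) b tw).
  by rewrite act_zpoly; apply: esym; exact: Hb.
apply: (congr1 (fun f : pbw_fun k => f 0%N (s1 - j0%:R) 0%N 0 0%N 0%N)).
exact/esym/(big_morph (fun a => act a tw) (fun a b => actD pcharp p_gt2 a b tw) act0).
Qed.

End Point.
End ZLift.

Section Independence.
Variables (k : closedFieldType) (p : nat) (pcharp : p \in [pchar k]) (p_gt2 : (2 < p)%N).

Local Notation Z := (subalg (Zgens k p)).
Local Notation zpoly := (zpoly pcharp p_gt2).

Lemma artin_schreier_root (w : k) : exists s, s ^+ p - s = w.
Proof.
have p1 : (1 < p)%N by exact: ltnW.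
have /closed_rootP [s] : size ('X^p - 'X - w%:P : {poly k}) != 1.
  rewrite -addrA size_polyDl size_polyXn; first by rewrite eqSS -lt0n ltnW.
  rewrite ltnS -opprD size_polyN (leq_trans (size_polyD _ _)) // size_polyX.
  by rewrite geq_max p1 (leq_trans (size_polyC_leq1 _)) // ltnW.
rewrite rootE !hornerE subr_eq0 => /eqP <-; by exists s.
Qed.

(** The solutions of s^p - s = w are a coset of the prime field, hence p in number. *)
Lemma poly_artin_schreier_eq0 (w : k) (q : {poly k}) : (size q <= p)%N ->
  (forall s, s ^+ p - s = w -> q.[s] = 0) -> q = 0.
Proof.
move=> qp H; have [s sw] := artin_schreier_root w.
apply/eqP; apply: contraTT (leqnn p) => q0; rewrite -ltnNge.
pose rs : seq k := [seq s + (i : 'I_p)%:R | i : 'I_p].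
have rsE : size rs = p by rewrite size_map size_enum_ord.
rewrite -{1}rsE; apply: leq_trans qp; apply: max_poly_roots => //.
  apply/allP => _ /mapP[i _ ->]; rewrite rootE; apply/eqP/H.
  rewrite -!(pFrobenius_autE pcharp) rmorphD rmorph_nat /= pFrobenius_autE -sw; ring.
rewrite map_inj_uniq ?enum_uniq // => i j /addrI.
wlog ij : i j / (i <= j)%N => [W E|].
  by case/orP: (leq_total i j) => ij; [apply: W|apply/esym/W].
move=> /esym/eqP; rewrite -subr_eq0 -natrB // -(dvdn_pcharf pcharp) => pd.
have [ji|/(dvdn_leq)] := posnP (j - i)%N.
  by apply/val_inj/eqP; rewrite eqn_leq ij -subn_eq0 ji.
by move/(_ _ pd); have := ltn_ord j; lia.
Qed.

(** A relation specialised at a point with nonzero first coordinate gives, for fixed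
    exponents of the other generators, a polynomial in the value s1 of zeta which has
    degree less than p and vanishes at the p solutions of s1^p - s1 = w. So its
    coefficients are zero at all such points, hence identically. *)
Lemma zpoly_indep (F : pbw_index p -> {mpoly k[6]}) :
  \sum_i zpoly (F i) * pbw k i = 0 -> forall i, F i = 0.
Proof.
move=> F0 [j0 [l0 [i0 [m0 [r0 [n0 []]]]]]]; set i := (j0, _).
pose idx (l : 'I_p) : pbw_index p := (j0, (l, (i0, (m0, (r0, (n0, tt)))))).
have H (v : 'I_6 -> k) : v ord0 != 0 -> (F i).@[v] = 0.
  move=> v0; pose c l := (F (idx l)).@[v].
  have vE : v =1 point (v ord0) (v (inord 1)) (v (inord 2)) (v (inord 3)) (v (inord 4)) (v (inord 5)).
    move=> a; have -> : a = inord a by rewrite inord_val.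
    case: a => [[|[|[|[|[|[|//]]]]]] a6] /=; rewrite /point ?inordK //.
    by congr v; apply: val_inj; rewrite /= inordK.
  have q0 : \poly_(l < p) (if insub l is Some l' then c l' else 0) = 0.
    apply: (@poly_artin_schreier_eq0 (v (inord 5))); first exact: size_poly.
    move=> s1 s1w; rewrite horner_poly.
    have := act_sum_zpoly (pcharp := pcharp) (p_gt2 := p_gt2) (v (inord 1)) (v (inord 2))
      (v (inord 3)) (v (inord 4)) v0 s1w i0 m0 r0 n0 (ltn_ord j0) F0.
    rewrite (bigID [pred a : pbw_index p | [&& a.1 == j0 :> nat, a.2.2.1 == i0 :> nat,
      a.2.2.2.1 == m0 :> nat, a.2.2.2.2.1 == r0 :> nat & a.2.2.2.2.2.1 == n0 :> nat]]) /=.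
    rewrite [X in _ + X]big1 ?addr0 => [|a /negbTE ->]; last by rewrite mul0r mulr0.
    rewrite (reindex_onto idx (fun a => a.2.1)) /=; last first.
      move=> [j [l [a [m [r [n []]]]]]] /= /and5P[].
      by do 5![move/eqP/val_inj->].
    move=> H0; rewrite -[RHS]H0; apply: eq_big => [l|l _]; first by rewrite !eqxx.
    by rewrite !eqxx /= mul1r valK /c (meval_eq _ vE).
  have := congr1 (coefp l0) q0; rewrite /= coef0 coef_poly ltn_ord valK.
  by [].
have : 'X_ord0 * F i = 0.
  apply: mpoly_vanish => v; rewrite mevalM mevalXU.
  by have [->|/H ->] := eqVneq (v ord0) 0; rewrite ?mul0r ?mulr0.
move/eqP; rewrite mulf_eq0 => /orP[|/eqP //].
by move/eqP/(congr1 (meval (fun=> 1))); rewrite mevalXU meval0 => /eqP; rewrite oner_eq0.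
Qed.

Lemma pbw_elt0 : exists i0, pbw k (p := p) i0 = 1.
Proof.
have p0 : (0 < p)%N by exact: ltnW (ltnW p_gt2).
pose o := Ordinal p0; exists (o, (o, (o, (o, (o, (o, tt)))))).
by rewrite /pbw /pbw_elt /= !mulr1.
Qed.

(** The case of the independence of the monomials where only the monomial 1 occurs. *)
Lemma zlift_inj : injective (zlift pcharp p_gt2).
Proof.
apply: lp_lift_inj => q E; have [i0 e0] := pbw_elt0.
rewrite -(zpoly_indep (F := fun i => if i == i0 then q else 0) _ i0) ?eqxx //.
rewrite big1 // => i _; case: eqP => _.
  by rewrite /zpoly; rewrite [zlift _ _ _]E rmorph0 mul0r.
by rewrite /zpoly !rmorph0 mul0r.
Qed.

End Independence.

(** * Tensor products of linear maps *)

Section TensorMaps.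
Variable k : fieldType.
Implicit Types U V W : lmodType k.

Lemma tens_ind U V (P : U ⊗ V -> Prop) :
  P 0 -> (forall s t, P s -> P t -> P (s + t)) -> (forall u v, P (u ⊗' v)) ->
  forall t, P t.
Proof.
move=> P0 PD Pt t; have [s ->] := tensorP t.
elim: s => [|x s IH]; first by rewrite big_nil.
by rewrite big_cons; apply: PD.
Qed.

Lemma tens_lift0 U V W (f : U -> V -> W) : is_bilinear f -> tens_lift f 0 = 0.
Proof. by move=> fB; exact: lift_tzero. Qed.

Lemma tensDl U V (u u' : U) (v : V) : (u + u') ⊗' v = u ⊗' v + u' ⊗' v.
Proof. exact: (bilDl (@tens_bilinear k U V)). Qed.
Lemma tensDr U V (u : U) (v v' : V) : u ⊗' (v + v') = u ⊗' v + u ⊗' v'.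
Proof. exact: (bilDr (@tens_bilinear k U V)). Qed.
Lemma tensZl U V c (u : U) (v : V) : (c *: u) ⊗' v = c *: (u ⊗' v).
Proof. exact: (bilZl (@tens_bilinear k U V)). Qed.
Lemma tensZr U V c (u : U) (v : V) : u ⊗' (c *: v) = c *: (u ⊗' v).
Proof. exact: (bilZr (@tens_bilinear k U V)). Qed.
Lemma tens0l U V (v : V) : (0 : U) ⊗' v = 0.
Proof. exact: (bil0l (@tens_bilinear k U V)). Qed.

Section Map.
Variables (U V U' V' : lmodType k) (f : {linear U -> U'}) (g : {linear V -> V'}).

Lemma bil_comp W (F : U' -> V' -> W) :
  is_bilinear F -> is_bilinear (fun u v => F (f u) (g v)).
Proof.
move=> B; split=> [v c x y|u c x y]; rewrite linearP.
  by rewrite (bilDl B) (bilZl B).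
by rewrite (bilDr B) (bilZr B).
Qed.

Lemma tens_map_bil : is_bilinear (fun u v => f u ⊗' g v).
Proof. exact: bil_comp (tens_bilinear _ _). Qed.

Lemma tens_mapE u v : tens_map f g (u ⊗' v) = f u ⊗' g v.
Proof. exact: tens_liftE tens_map_bil. Qed.

Lemma tens_map_linear : linear (tens_map f g).
Proof. exact: tens_lift_linear tens_map_bil. Qed.
HB.instance Definition _ :=
  GRing.isLinear.Build k (U ⊗ V) (U' ⊗ V') *:%R (tens_map f g) tens_map_linear.

Lemma tens_map0 : tens_map f g 0 = 0. Proof. exact: linear0. Qed.
Lemma tens_mapD s t : tens_map f g (s + t) = tens_map f g s + tens_map f g t.
Proof. exact: linearD. Qed.

Lemma tens_lift_map W (F : U' -> V' -> W) t : is_bilinear F ->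
  tens_lift F (tens_map f g t) = tens_lift (fun u v => F (f u) (g v)) t.
Proof.
move=> B; have B' := bil_comp B; elim/tens_ind: t => [|s t Hs Ht|u v].
- by rewrite tens_map0 !tens_lift0.
- by rewrite tens_mapD !tens_liftD // Hs Ht.
- by rewrite tens_mapE !tens_liftE.
Qed.

Lemma linear_lift W W' (h : {linear W -> W'}) (F : U -> V -> W) t :
  h (tens_lift F t) = tens_lift (fun u v => h (F u v)) t.
Proof. by rewrite /tens_lift /tens_eval linear_sum. Qed.

Lemma lift_lift U2 V2 W (F : U2 -> V2 -> W) (G : U -> V -> U2 ⊗ V2) t : is_bilinear F ->
  tens_lift F (tens_lift G t) = tens_lift (fun u v => tens_lift F (G u v)) t.
Proof.
move=> B; exact: (big_morph _ (fun s t => tens_liftD s t B) (tens_lift0 B)).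
Qed.

Lemma lift_mull (R : algType k) (F : U -> V -> R) t r :
  tens_lift F t * r = tens_lift (fun u v => F u v * r) t.
Proof. exact: mulr_suml. Qed.

Lemma lift_mulr (R : algType k) (F : U -> V -> R) t r :
  r * tens_lift F t = tens_lift (fun u v => r * F u v) t.
Proof. exact: mulr_sumr. Qed.

Lemma eq_lift W (F G : U -> V -> W) t :
  (forall u v, F u v = G u v) -> tens_lift F t = tens_lift G t.
Proof. by move=> FG; apply: eq_bigr => uv _; apply: FG. Qed.

End Map.

Lemma tens_map_comp U V U' V' U'' V'' (f : {linear U -> U'}) (g : {linear V -> V'})
    (f' : {linear U' -> U''}) (g' : {linear V' -> V''}) t :
  tens_map f' g' (tens_map f g t) = tens_map (f' \o f) (g' \o g) t.
Proof. exact: tens_lift_map (tens_map_bil f' g'). Qed.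

Lemma eq_tens_map U V U' V' (f f' : U -> U') (g g' : V -> V') t :
  f =1 f' -> g =1 g' -> tens_map f g t = tens_map f' g' t.
Proof. by move=> ff gg; apply: eq_lift => u v; rewrite ff gg. Qed.

Lemma tens_map_id U V (t : U ⊗ V) : tens_map id id t = t.
Proof.
elim/tens_ind: t => [|s t Hs Ht|u v].
- exact: (tens_map0 idfun idfun).
- by rewrite (tens_mapD idfun idfun) Hs Ht.
- exact: (tens_mapE idfun idfun).
Qed.

Lemma tens_map_mul (A B A' B' : algType k) (f : {lrmorphism A -> A'}) (g : {lrmorphism B -> B'}) s t :
  tens_map f g (s * t) = tens_map f g s * tens_map f g t.
Proof.
elim/tens_ind: s => [|s s' Hs Hs'|a b]; first by rewrite mul0r !tens_map0 mul0r.
  by rewrite mulrDl !tens_mapD mulrDl Hs Hs'.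
elim/tens_ind: t => [|t t' Ht Ht'|c d]; first by rewrite mulr0 !tens_map0 mulr0.
  by rewrite mulrDr !tens_mapD mulrDr Ht Ht'.
by rewrite [_ * _]tmulE !tens_mapE [RHS]tmulE !rmorphM.
Qed.

Lemma tens_tens_bil U V W (w : W) : is_bilinear (fun (u : U) (v : V) => u ⊗' (v ⊗' w)).
Proof. by split=> [v c x y|u c x y] /=; rewrite ?(tensDl, tensZl, tensDr, tensZr). Qed.

Lemma tens_assoc_bil U V W : is_bilinear (fun (t : U ⊗ V) (w : W) =>
  tens_lift (fun u v => u ⊗' (v ⊗' w)) t).
Proof.
have bw := @tens_tens_bil U V W.
split=> [w c x y|t c x y] /=; first by rewrite tens_liftD // tens_liftZ.
elim/tens_ind: t => [|s t Hs Ht|u v]; first by rewrite !tens_lift0 // scaler0 addr0.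
  by rewrite !tens_liftD // Hs Ht scalerDr addrACA.
by rewrite !tens_liftE // !(tensDr, tensZr).
Qed.

Lemma tens_assocE U V W (t : U ⊗ V) (w : W) :
  tens_assoc (t ⊗' w) = tens_lift (fun u v => u ⊗' (v ⊗' w)) t.
Proof. exact: tens_liftE (@tens_assoc_bil U V W). Qed.

End TensorMaps.

(** * Convolution and antipodes *)

Section Convolution.
Variables (k : fieldType) (A : algType k) (hA : hopf A).
Local Notation Delta := (comul hA).
Local Notation eps := (counit hA).

Section Conv.
Variable R : algType k.
Implicit Types f g h : {linear A -> R}.

Definition conv f g a := tens_lift (fun b c => f b * g c) (Delta a).

Lemma mul_bil f g : is_bilinear (fun b c => f b * g c).
Proof.
by split=> [b c x y|a c x y]; rewrite linearP ?mulrDl ?mulrDr -?scalerAl -?scalerAr.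
Qed.

Lemma conv_linear f g : linear (conv f g).
Proof.
by move=> c a b; rewrite /conv linearP tens_lift_linear //; exact: mul_bil.
Qed.
HB.instance Definition _ f g := GRing.isLinear.Build k A R *:%R (conv f g) (conv_linear f g).

Lemma convA f g h a : conv f (conv g h) a = conv (conv f g) h a.
Proof.
pose T3 (t : A ⊗ (A ⊗ A)) := tens_lift (fun b u => f b * tens_lift (fun c d => g c * h d) u) t.
have B2 : is_bilinear (fun c d => g c * h d) := mul_bil g h.
have B3 : is_bilinear (fun b u => f b * tens_lift (fun c d => g c * h d) u).
  split=> [b c x y|b c x y]; first by rewrite linearP mulrDl -scalerAl.
  by rewrite tens_lift_linear // mulrDr -scalerAr.
have T3L : linear T3 by exact: tens_lift_linear.
transitivity (T3 (tens_map id Delta (Delta a))).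
  by rewrite /T3 (tens_lift_map idfun Delta _ B3).
rewrite -hopf_coassoc /T3 /conv.
have BL := bil_comp (Delta) idfun (@tens_assoc_bil k A A A).
have BR : is_bilinear (fun b c => conv f g b * h c) := mul_bil _ _.
elim/tens_ind: (Delta a) => [|s t Hs Ht|b c].
- by rewrite (tens_map0 Delta idfun) /tens_assoc !tens_lift0 //; exact: tens_assoc_bil.
- rewrite (tens_mapD Delta idfun) /tens_assoc.
  rewrite (tens_liftD _ _ (@tens_assoc_bil k A A A)) [LHS]tens_liftD // [RHS]tens_liftD //.
  by congr (_ + _).
rewrite (tens_mapE Delta idfun) tens_assocE [RHS]tens_liftE // /conv.
rewrite lift_lift // lift_mull; apply: eq_lift => d e.
by rewrite !tens_liftE // mulrA.
Qed.

(** Left and right convolution inverses of g agree, up to the factor r which makes the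
    statement apply to the maps a |-> S(ab). *)
Lemma conv_inv_eq f g h (r : R) a :
  (forall b, conv f g b = (eps b : k) *: r) ->
  (forall b, conv g h b = (eps b : k)%:A) ->
  f a = r * h a :> R.
Proof.
move=> fg gh.
transitivity (conv f (conv g h) a).
  transitivity (f (tens_lift (fun b c => (eps c : k) *: b) (Delta a))).
    by congr (f _); rewrite -[LHS](hopf_counitr hA).
  rewrite linear_lift; apply: eq_lift => b c.
  by rewrite /= gh linearZ mulr_algr.
rewrite convA.
transitivity (r * h (tens_lift (fun b c => (eps b : k) *: c) (Delta a))); last first.
  by congr (_ * h _); rewrite -[RHS](hopf_counitl hA).
rewrite linear_lift [RHS]lift_mulr.
by apply: eq_lift => b c; rewrite /= fg linearZ -scalerAl -scalerAr.
Qed.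

End Conv.

Local Notation S := (antipode hA).

Lemma comulM a b : Delta (a * b) = Delta a * Delta b. Proof. exact: rmorphM. Qed.

Lemma conv_antipodel a : conv S idfun a = (eps a)%:A.
Proof. exact: hopf_antipodel. Qed.
Lemma conv_antipoder a : conv idfun S a = (eps a)%:A.
Proof. exact: hopf_antipoder. Qed.

Lemma antipode1 : S 1 = 1.
Proof.
have := conv_antipodel 1; rewrite /conv !rmorph1 tens_liftE; last exact: (mul_bil S idfun).
by rewrite mulr1 scale1r.
Qed.

(** The antipode reverses products: for fixed b, the map a |-> S(ab) and the map
    a |-> S(b)S(a) have the same convolution product with the identity. *)
Lemma antipodeM a b : S (a * b) = S b * S a.
Proof.
pose phi a b := tens_lift (fun a1 a2 => S (a1 * b) * a2) (Delta a).
have phiL a' : linear (phi a').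
  move=> c x y; rewrite /phi /tens_lift /tens_eval scaler_sumr -big_split; apply: eq_bigr => t _ /=.
  by rewrite mulrDr -scalerAr linearP mulrDl scalerAl.
have phiE a' b' : phi a' b' = (eps a' : k) *: S b'.
  pose F : {linear A -> A} := HB.pack (phi a') (GRing.isLinear.Build k A A *:%R (phi a') (phiL a')).
  have /= -> := @conv_inv_eq A F idfun S (eps a' : k)%:A b' _ conv_antipoder.
    by rewrite mulr_algl.
  move=> d; transitivity (conv S idfun (a' * d)); last first.
    by rewrite conv_antipodel rmorphM /= scalerA mulrC.
  rewrite /conv comulM [RHS]lift_tmul; last exact: (mul_bil S idfun).
  rewrite /tens_lift /tens_eval /= exchange_big /=; apply: eq_bigr => t _.
  by rewrite mulr_suml; apply: eq_bigr => w _; rewrite mulrA.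
have thL : linear (fun a => S (a * b)).
  by move=> c x y; rewrite mulrDl -scalerAl linearP.
pose G : {linear A -> A} := HB.pack (fun a => S (a * b)) (GRing.isLinear.Build k A A *:%R _ thL).
exact: (@conv_inv_eq A G idfun S (S b) a (phiE^~ b) conv_antipoder).
Qed.

End Convolution.

(** Both S f and f S are convolution inverses of f. *)
Lemma hopf_antipode_morph (k : fieldType) (A B : algType k) (hA : hopf A) (hB : hopf B)
    (f : {lrmorphism A -> B}) :
  (forall a, comul hB (f a) = tens_map f f (comul hA a)) ->
  (forall a, counit hB (f a) = counit hA a) ->
  forall a, antipode hB (f a) = f (antipode hA a).
Proof.
move=> fD fe a.
have B0 := mul_bil (antipode hB) (@idfun B).
have /= -> := @conv_inv_eq k A hA B (antipode hB \o f) f (f \o antipode hA) 1 a.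
- by rewrite mul1r.
- move=> b; rewrite -fe -(hopf_antipodel hB) fD tens_lift_map //.
- move=> b; rewrite /conv -[RHS]mulr_algr mul1r -(rmorph1 f) -linearZ -(hopf_antipoder hA).
  by rewrite linear_lift; apply: eq_lift => c d /=; rewrite rmorphM.
Qed.

(** * Restriction and transport of Hopf algebra structures *)

(** A subalgebra i : Z -> D stable under the structure maps of D inherits them. The
    linear retraction rho makes the tensor powers of i injective, so that the axioms
    are checked in D. *)
Section HopfRestriction.
Variables (k : fieldType) (D Z : algType k) (hD : hopf D).
Variables (i : {lrmorphism Z -> D}) (rho : {linear D -> Z}).
Hypothesis iK : cancel i rho.
Hypothesis iDelta : forall z, exists w, comul hD (i z) = tens_map i i w.
Hypothesis iS : forall z, exists z', antipode hD (i z) = i z'.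

Definition res_comul z : Z ⊗ Z := tens_map rho rho (comul hD (i z)).

Lemma tens_iK w : tens_map rho rho (tens_map i i w) = w.
Proof. by rewrite tens_map_comp -[RHS]tens_map_id; apply: eq_tens_map => z /=; rewrite iK. Qed.

Lemma res_comulE z : tens_map i i (res_comul z) = comul hD (i z).
Proof. by have [w E] := iDelta z; rewrite /res_comul E tens_iK. Qed.

Let inj2 : injective (tens_map i i) := can_inj tens_iK.

Lemma res_comul_linear : linear res_comul.
Proof. by move=> c a b; rewrite /res_comul !linearP. Qed.
HB.instance Definition _ := GRing.isLinear.Build k Z (Z ⊗ Z) *:%R res_comul res_comul_linear.
Lemma res_comul_monoid : monoid_morphism res_comul.
Proof.
split=> [|a b]; apply: inj2.
  by rewrite res_comulE !rmorph1 [RHS]tens_mapE !rmorph1.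
by rewrite tens_map_mul !res_comulE !rmorphM.
Qed.
HB.instance Definition _ := GRing.isMonoidMorphism.Build _ _ res_comul res_comul_monoid.

Definition res_counit : Z -> k^o := counit hD \o i.
HB.instance Definition _ := GRing.LRMorphism.on res_counit.

Definition res_antipode : Z -> Z := rho \o antipode hD \o i.
HB.instance Definition _ := GRing.Linear.on res_antipode.

Lemma res_antipodeE z : i (res_antipode z) = antipode hD (i z).
Proof. by have [z' E] := iS z; rewrite /res_antipode /= E iK. Qed.

Lemma res_coassoc a :
  tens_assoc (tens_map res_comul id (res_comul a)) = tens_map id res_comul (res_comul a).
Proof.
have inj3 : injective (tens_map i (tens_map i i)).
  apply: (@can_inj _ _ _ (tens_map rho (tens_map rho rho))) => t.
  rewrite tens_map_comp -[RHS]tens_map_id; apply: eq_tens_map => z /=; first exact: iK.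
  exact: tens_iK.
apply: inj3.
have R t : tens_map i (tens_map i i) (tens_map id res_comul t) =
    tens_map id (comul hD) (tens_map i i t).
  rewrite (tens_map_comp idfun res_comul) (tens_map_comp i i idfun (comul hD)).
  by apply: eq_tens_map => z //=; exact: res_comulE.
have L t : tens_map i (tens_map i i) (tens_assoc (tens_map res_comul id t)) =
    tens_assoc (tens_map (comul hD) id (tens_map i i t)).
  elim/tens_ind: t => [|s t Hs Ht|b c].
  - rewrite (tens_map0 res_comul idfun) (tens_map0 i i) (tens_map0 (comul hD) idfun).
    by rewrite /tens_assoc !tens_lift0 ?tens_map0 //; exact: tens_assoc_bil.
  - rewrite (tens_mapD res_comul idfun) (tens_mapD i i) (tens_mapD (comul hD) idfun).
    rewrite /tens_assoc (tens_liftD _ _ (@tens_assoc_bil k Z Z Z)).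
    by rewrite (tens_liftD _ _ (@tens_assoc_bil k D D D)) tens_mapD; congr (_ + _).
  rewrite (tens_mapE res_comul idfun) (tens_mapE i i) (tens_mapE (comul hD) idfun).
  rewrite !tens_assocE -[X in _ = tens_lift _ X]res_comulE linear_lift [RHS]tens_lift_map; last exact: tens_tens_bil.
  apply: eq_lift => u v; apply: etrans (tens_mapE i (tens_map i i) u (v ⊗' c)) _.
  by congr (_ ⊗' _); exact: tens_mapE.
by rewrite L R res_comulE hopf_coassoc.
Qed.

Lemma scale_bil (A : algType k) (e : {linear A -> k^o}) :
  is_bilinear (fun b c : A => (e b : k) *: c) /\ is_bilinear (fun b c : A => (e c : k) *: b).
Proof.
split; split=> [b c x y|a c x y] /=.
- by rewrite linearP /= scalerDl scalerA.
- by rewrite scalerDr !scalerA mulrC.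
- by rewrite scalerDr !scalerA mulrC.
- by rewrite linearP /= scalerDl scalerA.
Qed.

Lemma res_counitl a : tens_lift (fun b c => res_counit b *: c) (res_comul a) = a.
Proof.
apply: (can_inj iK); rewrite -[RHS](hopf_counitl hD) -res_comulE.
rewrite [RHS](tens_lift_map i i _ (scale_bil (counit hD)).1) linear_lift.
by apply: eq_lift => b c; rewrite linearZ.
Qed.

Lemma res_counitr a : tens_lift (fun b c => res_counit c *: b) (res_comul a) = a.
Proof.
apply: (can_inj iK); rewrite -[RHS](hopf_counitr hD) -res_comulE.
rewrite [RHS](tens_lift_map i i _ (scale_bil (counit hD)).2) linear_lift.
by apply: eq_lift => b c; rewrite linearZ.
Qed.

Lemma res_antipodel a :
  tens_lift (fun b c => res_antipode b * c) (res_comul a) = (res_counit a)%:A.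
Proof.
apply: (can_inj iK); rewrite linearZ /= rmorph1 -[RHS](hopf_antipodel hD) -res_comulE.
rewrite [RHS](tens_lift_map i i _ (mul_bil (antipode hD) idfun)) linear_lift.
by apply: eq_lift => b c; rewrite rmorphM /= res_antipodeE.
Qed.

Lemma res_antipoder a :
  tens_lift (fun b c => b * res_antipode c) (res_comul a) = (res_counit a)%:A.
Proof.
apply: (can_inj iK); rewrite linearZ /= rmorph1 -[RHS](hopf_antipoder hD) -res_comulE.
rewrite [RHS](tens_lift_map i i _ (mul_bil idfun (antipode hD))) linear_lift.
by apply: eq_lift => b c; rewrite rmorphM /= res_antipodeE.
Qed.

Definition res_hopf : hopf Z :=
  @Hopf k Z res_comul res_counit res_antipode
    res_coassoc res_counitl res_counitr res_antipodel res_antipoder.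

Lemma res_hopf_morphism : hopf_morphism res_hopf hD i.
Proof.
split=> a //=; first exact/esym/res_comulE.
exact/esym/res_antipodeE.
Qed.

End HopfRestriction.

(** Along an isomorphism, the Hopf structure of A is restricted to B through the
    inverse B -> A. *)
Section HopfTransport.
Variables (k : fieldType) (A B : algType k) (hA : hopf A) (f : {lrmorphism A -> B}).

Lemma bij_inverse : bijective f -> exists2 g : {lrmorphism B -> A}, cancel f g & cancel g f.
Proof.
case=> g fK gK.
have gL : linear g by move=> c x y; apply: (can_inj fK); rewrite linearP /= !gK.
have gM : monoid_morphism g.
  split=> [|x y]; apply: (can_inj fK); rewrite ?rmorph1 ?rmorphM /= !gK //.
pose G : {lrmorphism B -> A} := HB.pack g (GRing.isLinear.Build k B A *:%R g gL)
  (GRing.isMonoidMorphism.Build B A g gM).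
by exists G.
Qed.

Lemma hopf_transport : bijective f -> exists hB : hopf B, hopf_morphism hA hB f.
Proof.
move=> /bij_inverse [g fK gK].
have gD z : exists w, comul hA (g z) = tens_map g g w.
  exists (tens_map f f (comul hA (g z))); rewrite tens_map_comp -[LHS]tens_map_id.
  by apply: eq_tens_map => a /=; rewrite fK.
have gS z : exists z', antipode hA (g z) = g z'.
  by exists (f (antipode hA (g z))); rewrite fK.
exists (res_hopf gK gD gS); have [H1 H2 H3] := res_hopf_morphism gK gD gS.
have ffgg t : tens_map f f (tens_map g g t) = t.
  by rewrite tens_map_comp -[RHS]tens_map_id; apply: eq_tens_map => b /=; rewrite gK.
split=> a.
- by rewrite -[in RHS](fK a) H1 ffgg.
- by rewrite -[in RHS](fK a) H2.
- by apply: (can_inj gK); rewrite fK -H3 fK.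
Qed.

End HopfTransport.

(** * Coproducts of the central generators *)

Lemma tens_mul (k : fieldType) (A B : algType k) (a c : A) (b d : B) :
  (a ⊗' b) * (c ⊗' d) = (a * c) ⊗' (b * d).
Proof. exact: tmulE. Qed.

Lemma tens_exp (k : fieldType) (A B : algType k) (a : A) (b : B) n :
  (a ⊗' b) ^+ n = a ^+ n ⊗' b ^+ n.
Proof. by elim: n => [//|n IH]; rewrite !exprS IH tens_mul. Qed.

Section Coproducts.
Variables (k : fieldType) (A : algType k) (c : double_gen -> A) (hA : hopf A).
Hypothesis cR : forall r, r \in double_rels c -> r.1 = r.2.
Hypothesis cD : double_coproduct hA c.
Variables (p : nat) (pcharp : p \in [pchar k]) (p_gt2 : (2 < p)%N).

Local Notation u := (c gen_u).
Local Notation v := (c gen_v).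
Local Notation zeta := (c gen_zeta).
Local Notation g := (c gen_g).
Local Notation gV := (c gen_gV).
Local Notation x := (c gen_x).
Local Notation y := (c gen_y).
Local Notation Delta := (comul hA).
Local Notation eps := (counit hA).

Lemma comul_g : Delta g = g ⊗' g. Proof. by case: cD. Qed.
Lemma comul_x : Delta x = x ⊗' 1 + g ⊗' x. Proof. by case: cD => _ []. Qed.
Lemma comul_y : Delta y = y ⊗' 1 + g ⊗' y. Proof. by case: cD => _ []. Qed.
Lemma comul_zeta : Delta zeta = zeta ⊗' 1 + 1 ⊗' zeta. Proof. by case: cD. Qed.
Lemma comul_u : Delta u = u ⊗' 1 + 1 ⊗' u. Proof. by case: cD. Qed.
Lemma comul_v : Delta v = v ⊗' 1 + 1 ⊗' v + zeta ⊗' u. Proof. by case: cD. Qed.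

Lemma comul_gV : Delta gV = gV ⊗' gV.
Proof.
have E : (g ⊗' g) * (gV ⊗' gV) = 1 by rewrite tens_mul (g_gV cR).
by rewrite -[LHS]mulr1 -E mulrA -comul_g -rmorphM (gV_g cR) rmorph1 mul1r.
Qed.

Let charAA : p \in [pchar (A ⊗ A)]. Proof. by rewrite pchar_lalg. Qed.

Lemma exprD_pchar_comm (R : nzRingType) (a b : R) : p \in [pchar R] -> a * b = b * a ->
  (a + b) ^+ p = a ^+ p + b ^+ p.
Proof. by move=> cR' ab; rewrite -!(pFrobenius_autE cR') pFrobenius_autD_comm. Qed.

Lemma comul_gp : Delta (g ^+ p) = g ^+ p ⊗' g ^+ p.
Proof. by rewrite rmorphXn /= comul_g tens_exp. Qed.
Lemma comul_gVp : Delta (gV ^+ p) = gV ^+ p ⊗' gV ^+ p.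
Proof. by rewrite rmorphXn /= comul_gV tens_exp. Qed.
Lemma comul_xp : Delta (x ^+ p) = x ^+ p ⊗' 1 + g ^+ p ⊗' x ^+ p.
Proof.
rewrite rmorphXn /= comul_x exprD_pchar_comm //; first by rewrite !tens_exp expr1n.
by rewrite !tens_mul mul1r mulr1 (g_x cR).
Qed.
Lemma comul_up : Delta (u ^+ p) = u ^+ p ⊗' 1 + 1 ⊗' u ^+ p.
Proof.
rewrite rmorphXn /= comul_u exprD_pchar_comm //; first by rewrite !tens_exp !expr1n.
by rewrite !tens_mul !mul1r !mulr1.
Qed.
Lemma comul_zetap : Delta (zeta ^+ p - zeta) = (zeta ^+ p - zeta) ⊗' 1 + 1 ⊗' (zeta ^+ p - zeta).
Proof.
rewrite rmorphB rmorphXn /= comul_zeta exprD_pchar_comm //.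
  rewrite !tens_exp !expr1n -!scaleN1r tensDl tensDr tensZl tensZr.
  by rewrite scalerDr addrACA.
by rewrite !tens_mul !mul1r !mulr1.
Qed.
Lemma comul_yp : Delta (y ^+ p) = y ^+ p ⊗' 1 + g ^+ p ⊗' y ^+ p.
Proof.
(* (y (x) 1, x (x) 1) is a Jordan pair, and moving y (x) 1 across g (x) y adds x (x) 1. *)
rewrite rmorphXn /= comul_y (@jordan_add_pchar _ _ _ pcharp p_gt2 _ (x ⊗' 1)).
- by rewrite !tens_exp expr1n.
- by rewrite expr2 !tens_mul !mulr1 (y_x cR) -expr2 -!scaleN1r !scalerA tensDl tensZl.
- by rewrite !tens_mul !mulr1 !mul1r (g_y cR) tensDl.
- by rewrite !tens_mul !mulr1 !mul1r (g_x cR).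
Qed.

Lemma comul_vp :
  Delta (v ^+ p) = v ^+ p ⊗' 1 + 1 ⊗' v ^+ p + (zeta ^+ p - zeta) ⊗' u ^+ p.
Proof.
pose X : A ⊗ A := 1 ⊗' u; pose z : A ⊗ A := zeta ⊗' 1; pose w : A ⊗ A := 1 ⊗' v.
(* 1 (x) v + zeta (x) u is a translate in the Jordan pair (1 (x) v, 1 (x) u), and *)
(* moving it across v (x) 1 turns zeta into zeta + 1, that is, adds 1 (x) u.       *)
have wX : w * X = X * w - 2^-1 *: X ^+ 2.
  by rewrite expr2 !tens_mul !mul1r (v_u cR) -expr2 -!scaleN1r !scalerA tensDr tensZr.
have zw : z * w = w * z by rewrite !tens_mul !mul1r !mulr1.
have zX : z * X = X * z by rewrite !tens_mul !mul1r !mulr1.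
have zXE : zeta ⊗' u = z * X by rewrite tens_mul mul1r mulr1.
rewrite rmorphXn /= comul_v -addrA addrC zXE.
rewrite (@jordan_add_pchar _ _ _ pcharp p_gt2 _ X).
- rewrite (jordan_translate_pchar pcharp p_gt2 wX zw zX) !tens_exp !expr1n addrC addrA.
  congr (_ + _); rewrite -!scaleN1r -tensZl -tensDl tens_mul mul1r mulr1.
  by [].
- exact: jordan_shift.
- rewrite mulrDr mulrDl !tens_mul !mul1r !mulr1 (v_zeta cR) tensDl.
  by rewrite -addrA.
- by rewrite !tens_mul !mul1r !mulr1.
Qed.

(** The counit is determined by the coproduct: it is 1 on group-like elements and 0 on
    skew-primitive ones. *)
Lemma counit_gen i : eps (c i) = double_aug k i.
Proof.
have B := (scale_bil eps).1.
have eg : eps g = 1.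
  have /eqP : (eps g : k) *: g = g.
    by rewrite -[RHS](hopf_counitl hA g) comul_g tens_liftE.
  rewrite -subr_eq0 -{3}[g]scale1r -scalerBl scaler_eq0 subr_eq0 => /orP[/eqP //|/eqP g0].
  by have := g_gV cR; rewrite g0 mul0r => /esym/eqP; rewrite oner_eq0.
have prim a b : (eps a : k) *: (1 : A) + b = b -> eps a = 0.
  by move/eqP; rewrite -subr_eq0 addrK scaler_eq0 oner_eq0 orbF => /eqP.
have e1 : eps 1 = 1 by exact: rmorph1.
have ez : eps zeta = 0.
  have := hopf_counitl hA zeta; rewrite comul_zeta tens_liftD // !tens_liftE // e1 scale1r.
  exact: prim.
case: i => //=.
- have := hopf_counitl hA u; rewrite comul_u tens_liftD // !tens_liftE // e1 scale1r.
  exact: prim.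
- have := hopf_counitl hA v; rewrite comul_v !tens_liftD // !tens_liftE // e1 ez scale0r addr0 scale1r.
  exact: prim.
- have : eps (g * gV) = 1 by rewrite (g_gV cR) rmorph1.
  by rewrite rmorphM /= eg mul1r.
- have := hopf_counitl hA x; rewrite comul_x tens_liftD // !tens_liftE // eg scale1r.
  exact: prim.
- have := hopf_counitl hA y; rewrite comul_y tens_liftD // !tens_liftE // eg scale1r.
  exact: prim.
Qed.

Local Notation Zs := (central_seq c p).
Local Notation inZ := (gen_subalg Zs).

Definition tens_in (t : A ⊗ A) := exists w : subalg Zs ⊗ subalg Zs,
  t = tens_map (@incl _ _ Zs) (@incl _ _ Zs) w.

Lemma tens_in_pure a b : a \in inZ -> b \in inZ -> tens_in (a ⊗' b).
Proof. by move=> aZ bZ; exists (Sub a aZ ⊗' Sub b bZ); rewrite tens_mapE. Qed.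
Lemma tens_inD s t : tens_in s -> tens_in t -> tens_in (s + t).
Proof. by move=> [w ->] [w' ->]; exists (w + w'); rewrite tens_mapD. Qed.
Lemma tens_inZ x0 s : tens_in s -> tens_in (x0 *: s).
Proof. by move=> [w ->]; exists (x0 *: w); rewrite [RHS]linearZ. Qed.
Lemma tens_inM s t : tens_in s -> tens_in t -> tens_in (s * t).
Proof. by move=> [w ->] [w' ->]; exists (w * w'); rewrite tens_map_mul. Qed.

Let mem s : s \in Zs -> s \in inZ := @mem_gen_subalg _ _ Zs s.
Let Zg : g ^+ p \in inZ. Proof. by apply: mem; rewrite !inE eqxx. Qed.
Let ZgV : gV ^+ p \in inZ. Proof. by apply: mem; rewrite !inE eqxx ?orbT. Qed.
Let Zx : x ^+ p \in inZ. Proof. by apply: mem; rewrite !inE eqxx ?orbT. Qed.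
Let Zy : y ^+ p \in inZ. Proof. by apply: mem; rewrite !inE eqxx ?orbT. Qed.
Let Zu : u ^+ p \in inZ. Proof. by apply: mem; rewrite !inE eqxx ?orbT. Qed.
Let Zv : v ^+ p \in inZ. Proof. by apply: mem; rewrite !inE eqxx ?orbT. Qed.
Let Zz : zeta ^+ p - zeta \in inZ. Proof. by apply: mem; rewrite !inE eqxx ?orbT. Qed.
Let Z1 : 1 \in inZ. Proof. exact: rpred1. Qed.

Lemma comul_central z : z \in inZ -> tens_in (Delta z).
Proof.
move: z; apply: gen_subalg_ind => [|x0 a b Ha Hb|a b Ha Hb|s].
- by rewrite rmorph1; exact: tens_in_pure.
- by rewrite linearP; apply: tens_inD => //; apply: tens_inZ.
- by rewrite rmorphM; apply: tens_inM.
rewrite !inE; do ![case/orP]; move/eqP->.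
- by rewrite comul_gp; exact: tens_in_pure.
- by rewrite comul_gVp; exact: tens_in_pure.
- by rewrite comul_xp; apply: tens_inD; exact: tens_in_pure.
- by rewrite comul_yp; apply: tens_inD; exact: tens_in_pure.
- by rewrite comul_up; apply: tens_inD; exact: tens_in_pure.
- by rewrite comul_vp; do ?apply: tens_inD; exact: tens_in_pure.
- by rewrite comul_zetap; apply: tens_inD; exact: tens_in_pure.
Qed.

Local Notation S := (antipode hA).

(** The antipodes of the generators are obtained by applying the antipode axiom to
    their coproducts. *)
Lemma antipode_central z : z \in inZ -> S z \in inZ.
Proof.
have p0 : (0 < p)%N by exact: ltnW (ltnW p_gt2).
have B := mul_bil S (@idfun A).
have epsX i : eps (c i ^+ p) = double_aug k i ^+ p by rewrite rmorphXn /= counit_gen.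
have S1 := antipode1 hA.
have anti a := hopf_antipodel hA a.
have Sg : S (g ^+ p) = gV ^+ p.
  have := anti (g ^+ p); rewrite comul_gp [X in X = _](tens_liftE _ _ B) epsX expr1n scale1r.
  by move/(congr1 (fun a => a * gV ^+ p)); rewrite mul1r -mulrA gp_gVp // mulr1.
have SgV : S (gV ^+ p) = g ^+ p.
  have := anti (gV ^+ p); rewrite comul_gVp [X in X = _](tens_liftE _ _ B) epsX expr1n scale1r.
  by move/(congr1 (fun a => a * g ^+ p)); rewrite mul1r -mulrA gVp_gp // mulr1.
have prim a b : Delta a = a ⊗' 1 + b -> eps a = 0 ->
    tens_lift (fun b c => S b * c) b \in inZ -> S a \in inZ.
  move=> Da ea dZ; have := anti a; rewrite Da ea scale0r tens_liftD // tens_liftE // mulr1.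
  by move/eqP; rewrite addr_eq0 => /eqP ->; rewrite rpredN.
have e0 i : double_aug k i = 0 -> eps (c i ^+ p) = 0.
  by move=> ci; rewrite epsX ci expr0n gtn_eqF.
have ez : eps (zeta ^+ p - zeta) = 0.
  by rewrite rmorphB /= e0 // counit_gen subrr.
move: z; apply: gen_subalg_ind => [|x0 a b Ha Hb|a b Ha Hb|s].
- by rewrite S1.
- by rewrite linearP; apply: rpredD => //; apply: rpredZ.
- by rewrite antipodeM; apply: rpredM.
move=> sZ; rewrite !inE in sZ; move: sZ; do ![case/orP]; move/eqP->.
- by rewrite Sg; exact: ZgV.
- by rewrite SgV; exact: Zg.
- apply: (prim _ _ comul_xp); rewrite ?e0 // (tens_liftE _ _ B) Sg; exact: rpredM.
- apply: (prim _ _ comul_yp); rewrite ?e0 // (tens_liftE _ _ B) Sg; exact: rpredM.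
- by apply: (prim _ _ comul_up); rewrite ?e0 // (tens_liftE _ _ B) S1 mul1r.
- have E : Delta (v ^+ p) = v ^+ p ⊗' 1 + (1 ⊗' v ^+ p + (zeta ^+ p - zeta) ⊗' u ^+ p).
    by rewrite addrA; exact: comul_vp.
  apply: (prim _ _ E); rewrite ?e0 // (tens_liftD _ _ B) !(tens_liftE _ _ B) S1 mul1r.
  apply: rpredD => //; apply: rpredM => //.
  by apply: (prim _ _ comul_zetap) => //; rewrite (tens_liftE _ _ B) S1 mul1r.
- by apply: (prim _ _ comul_zetap) => //; rewrite (tens_liftE _ _ B) S1 mul1r.
Qed.

End Coproducts.

(** * Coinvariants of a quotient by a central Hopf subalgebra *)

(** The coinvariants of D -> D/DZ^+ for a central Hopf subalgebra Z which is a
    Z-linear direct summand of D: the convolution product of the antipode with the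
    projection rho onto Z kills DZ^+, so that the map
    a (x) b |-> a S(b_1) rho(b_2) factors through D (x) D/DZ^+; it sends Delta(c)
    to rho(c) and c (x) 1 to c. *)
Section Coinvariants.
Variables (k : fieldType) (D Z H : algType k) (hD : hopf D).
Variables (i : {lrmorphism Z -> D}) (rho : {linear D -> Z}) (pr : {lrmorphism D -> H}).
Hypothesis iC : forall z a, i z * a = a * i z.
Hypothesis rhoZ : forall z a, rho (i z * a) = z * rho a.
Hypothesis rho1 : rho 1 = 1.
Hypothesis iDelta : forall z, exists w, comul hD (i z) = tens_map i i w.
Hypothesis iS : forall z, exists z', antipode hD (i z) = i z'.
Hypothesis pr_surj : forall b, exists c, pr c = b.
Hypothesis pr_ker : forall c, pr c = 0 -> exists2 s : seq (D * Z),
  all (fun t => counit hD (i t.2) == 0) s & c = \sum_(t <- s) t.1 * i t.2.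

Local Notation S := (antipode hD).

Let q : {linear D -> D} := conv hD S (i \o rho).

Let bilS a b : is_bilinear (fun c d => S (a * c) * i (rho (b * d))) :=
  mul_bil (S \o (a \*o idfun)) (i \o rho \o (b \*o idfun)).

Let qZ d z : q (d * i z) = (counit hD (i z) : k) *: q d.
Proof.
have [w Dw] := iDelta z.
have BZ : is_bilinear (fun a b => S a * (i \o rho) b) := mul_bil _ _.
rewrite -[LHS]/(conv hD S (i \o rho) (d * i z)) /conv comulM [LHS]lift_tmul //.
rewrite -[(_ : k) *: _]mulr_algr -[(counit hD (i z) : k)%:A](hopf_antipodel hD).
rewrite -[q d]/(conv hD S (i \o rho) d) /conv lift_mull; apply: eq_lift => a b.
rewrite lift_mulr Dw [LHS](tens_lift_map i i _ (bilS a b)).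
have B2 : is_bilinear (fun u v => S a * (i \o rho) b * (S u * v)).
  by have B := mul_bil S (@idfun D);
    split=> [v c x y|u c x y]; rewrite ?(bilDl B) ?(bilDr B) ?(bilZl B) ?(bilZr B) mulrDr -scalerAr.
rewrite [RHS](tens_lift_map i i _ B2); apply: eq_lift => u v.
have [u' Su] := iS u.
rewrite antipodeM Su -(iC v b) rhoZ rmorphM /=.
rewrite (iC u' (S a)) (iC v (i (rho b))) -!mulrA; congr (S a * _).
by rewrite mulrA (iC u' (i _)) -mulrA.
Qed.

Let q1 : q 1 = 1.
Proof.
rewrite -[LHS]/(conv hD S (i \o rho) 1) /conv rmorph1 tens_liftE; last exact: mul_bil.
by rewrite /= antipode1 rho1 rmorph1 mul1r.
Qed.

Let q_ker c : pr c = 0 -> q c = 0.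
Proof.
move=> /pr_ker[s s0 ->]; rewrite linear_sum big1_seq // => t /= /(allP s0)/eqP e0.
by rewrite qZ e0 scale0r.
Qed.

Lemma coinvariantP c : tens_map id pr (comul hD c) = c ⊗' 1 -> c = i (rho c).
Proof.
have [sec secK] := choice pr_surj.
have qsec d : q (sec (pr d)) = q d.
  by apply/eqP; rewrite -subr_eq0 -linearB q_ker // linearB /= secK subrr.
have q'L : linear (q \o sec).
  move=> a x y; rewrite /= -linearP; apply/eqP; rewrite -subr_eq0 -linearB q_ker //.
  by rewrite linearB linearP /= !secK subrr.
have bq' : exists2 q' : {linear H -> D}, is_bilinear (fun a h => a * q' h) & q' =1 q \o sec.
  pose q' : {linear H -> D} := HB.pack (q \o sec) (GRing.isLinear.Build k H D *:%R _ q'L).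
  exists q' => //; split=> [b a x y|a b x y]; first by rewrite mulrDl -scalerAl.
  by rewrite linearP mulrDr -scalerAr.
have [q' B q'E] := bq'.
move=> /(congr1 (tens_lift (fun a h => a * q' h))).
rewrite (tens_liftE _ _ B) (tens_lift_map idfun pr _ B).
have -> : q' 1 = 1 by rewrite -(rmorph1 pr) q'E; exact: etrans (qsec 1) q1.
rewrite mulr1 => Ec.
rewrite -[LHS]Ec.
transitivity (conv hD (conv hD idfun S) (i \o rho) c).
  by rewrite -convA; apply: eq_lift => a b; rewrite q'E; congr (_ * _); exact: qsec.
transitivity ((i \o rho) (tens_lift (fun b c => (counit hD b : k) *: c) (comul hD c))).
  rewrite linear_lift; apply: eq_lift => a b.
  apply: etrans (congr1 ( *%R^~ (i (rho b))) (conv_antipoder hD a)) _.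
  by rewrite mulr_algl linearZ.
by rewrite (hopf_counitl hD).
Qed.

End Coinvariants.

(** * Freeness over the central subalgebra *)

Lemma mul_shuffle (R : pzRingType) (t a s b : R) :
  a * s = s * a -> t * a * (s * b) = t * s * (a * b).
Proof. by move=> E; rewrite -!mulrA [a * (s * b)]mulrA E !mulrA. Qed.

Section LaurentDenominators.
Variable k : fieldType.

Lemma lp_TVTn n : lp_TV k ^+ n * lp_T k ^+ n = 1.
Proof.
by apply: etrans (esym (exprMn_comm n _)) _; [exact: lp_comm|rewrite lp_TVT expr1n].
Qed.

Lemma lp_T_reg n (a : laurent_poly k) : lp_T k ^+ n * a = 0 -> a = 0.
Proof.
move/(congr1 ( *%R (lp_TV k ^+ n))) => H; apply: etrans (etrans H (mulr0 _)).
by apply: esym; apply: etrans (mulrA _ _ _) _; rewrite lp_TVTn; exact: mul1r.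
Qed.

Lemma lp_common_denominator (I : finType) (a : I -> laurent_poly k) :
  exists n F, forall i, lp_T k ^+ n * a i = lp_poly (F i).
Proof.
have [n H] := choice (fun i => lp_normal (a i)); have [F {}H] := choice H.
exists (\sum_i n i)%N, (fun i => 'X_ord0 ^+ (\sum_(j | j != i) n j)%N * F i) => i.
rewrite H (bigD1 i) //= addnC exprD.
have E : lp_T k ^+ n i * (lp_TV k ^+ n i * lp_poly (F i)) = lp_poly (F i).
  apply: etrans (mulrA _ _ _) _; rewrite [_ ^+ _ * _ ^+ _]lp_comm lp_TVTn; exact: mul1r.
apply: etrans (esym (mulrA _ _ _)) _; rewrite E rmorphM rmorphXn /=; congr (_ ^+ _ * _).
exact/esym/lp_polyX0.
Qed.

End LaurentDenominators.

Section Free.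
Variables (k : closedFieldType) (p : nat) (pcharp : p \in [pchar k]) (p_gt2 : (2 < p)%N).

Local Notation D := (Dtilde k).
Local Notation Zs := (Zgens k p).
Local Notation Z := (subalg Zs).
Local Notation i_ := (@incl k D Zs).
Local Notation zlift := (zlift pcharp p_gt2).
Local Notation zpoly := (zpoly pcharp p_gt2).

Lemma lp_poly_inj (q : {mpoly k[6]}) : lp_poly q = 0 -> q = 0.
Proof.
move=> q0; have [i0 e0] := pbw_elt0 k p_gt2.
rewrite -(zpoly_indep (pcharp := pcharp) (p_gt2 := p_gt2) (F := fun i => if i == i0 then q else 0) _ i0) ?eqxx //.
rewrite big1 // => i _; case: eqP => _.
  by rewrite /zpoly q0 !rmorph0 mul0r.
by rewrite /zpoly !rmorph0 mul0r.
Qed.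

Lemma Z_domain (a b : Z) : a * b = 0 -> a = 0 \/ b = 0.
Proof.
have [a' <-] := zlift_surj pcharp p_gt2 a; have [b' <-] := zlift_surj pcharp p_gt2 b.
rewrite -rmorphM -[0 in X in X -> _](rmorph0 zlift) => /zlift_inj E.
have [n [F FE]] := lp_common_denominator (fun c : bool => if c then a' else b').
have : F true * F false = 0.
  apply: lp_poly_inj; apply: etrans (rmorphM _ _ _) _.
  apply: etrans (congr2 *%R (esym (FE true)) (esym (FE false))) _.
  apply: etrans (@mul_shuffle (laurent_poly k) _ _ _ _ (lp_comm a' _)) _.
  by apply: etrans (congr1 ( *%R _) E) _; exact: mulr0.
move/eqP; rewrite mulf_eq0 => /orP[] /eqP F0; [left|right].
  by rewrite (@lp_T_reg _ n a') ?rmorph0 //; have := FE true; rewrite F0 rmorph0.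
by rewrite (@lp_T_reg _ n b') ?rmorph0 //; have := FE false; rewrite F0 rmorph0.
Qed.

(** After multiplication by a power of g^p the coefficients become polynomials in the
    central generators, to which the independence of the monomials applies. *)
Lemma pbw_free (z : pbw_index p -> Z) :
  \sum_i i_ (z i) * pbw k i = 0 -> forall i, z i = 0.
Proof.
have [a aE] := choice (fun i => zlift_surj pcharp p_gt2 (z i)).
have [n [F FE]] := lp_common_denominator a.
move=> z0 i; rewrite -aE (@lp_T_reg _ n (a i)) ?rmorph0 // FE.
suff -> : F i = 0 by exact: rmorph0.
move: i; apply: (zpoly_indep (pcharp := pcharp) (p_gt2 := p_gt2)).
transitivity (i_ (zlift (lp_T k ^+ n)) * \sum_i i_ (z i) * pbw k i).
  rewrite mulr_sumr; apply: eq_bigr => j _.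
  apply: etrans _ (esym (mulrA _ _ _)); congr (_ * _).
  rewrite /zpoly -FE -aE -rmorphM; congr (incl _); exact: rmorphM.
rewrite z0; exact: mulr0.
Qed.

Lemma pbw_coord (a : D) : exists z : pbw_index p -> Z, a = \sum_i i_ (z i) * pbw k i.
Proof.
have [z [zZ ->]] := Dtilde_spans pcharp p_gt2 a.
by exists (fun i => Sub (z i) (zZ i)).
Qed.

Lemma pbw_coord_uniq (z z' : pbw_index p -> Z) :
  \sum_i i_ (z i) * pbw k i = \sum_i i_ (z' i) * pbw k i -> z =1 z'.
Proof.
move=> E i; apply/eqP; rewrite -subr_eq0; apply/eqP.
apply: (pbw_free (z := fun i => z i - z' i)).
rewrite -[RHS](subrr (\sum_i i_ (z' i) * pbw k i)) -[X in _ = X - _]E -sumrB.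
by apply: eq_bigr => j _; rewrite rmorphB mulrBl.
Qed.

Lemma Dtilde_free : fg_free_over Zs.
Proof.
exists #|pbw_index p|, (fun i => pbw k (enum_val i)) => a.
have [z ->] := pbw_coord a; exists [ffun i => z (enum_val i)].
split=> [|c /= E].
  by rewrite (reindex_onto (@enum_val _ _) enum_rank) /=;
    [apply: eq_big => j; rewrite ?enum_valK ?eqxx ?ffunE|move=> j _; rewrite enum_rankK].
apply/ffunP => i; rewrite ffunE.
have := @pbw_coord_uniq z (fun j => c (enum_rank j)).
move/(_ _ (enum_val i)); rewrite enum_valK; apply.
apply: etrans E _.
rewrite (reindex_onto (@enum_rank (pbw_index p)) enum_val) /=; last by move=> j _; exact: enum_valK.
by apply: eq_big => j; rewrite enum_rankK ?eqxx.
Qed.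

(** The coordinate at the monomial 1, which belongs to the basis. *)
Lemma central_projection : exists rho : {linear D -> Z},
  (forall z a, rho (i_ z * a) = z * rho a) /\ rho 1 = 1.
Proof.
have [z zE] := choice pbw_coord; have [i0 e0] := pbw_elt0 k p_gt2.
have zP (a : D) (z' : pbw_index p -> Z) : a = \sum_i i_ (z' i) * pbw k i -> z a i0 = z' i0.
  by move=> E; exact: (pbw_coord_uniq (etrans (esym (zE a)) E)).
have zL : linear (fun a => z a i0).
  move=> c a b; apply: (zP _ (fun i => c *: z a i + z b i)).
  apply: etrans (congr2 (fun a b => c *: a + b) (zE a) (zE b)) _.
  rewrite scaler_sumr -big_split; apply: eq_bigr => i _.
  by rewrite linearP mulrDl -scalerAl.
pose rho : {linear D -> Z} := HB.pack (fun a => z a i0) (GRing.isLinear.Build k D Z *:%R _ zL).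
exists rho; split=> [c a|].
  apply: (zP _ (fun i => c * z a i)); apply: etrans (congr1 ( *%R (i_ c)) (zE a)) _.
  rewrite mulr_sumr; apply: eq_bigr => i _.
  by apply: etrans (mulrA _ _ _) _; rewrite rmorphM.
apply: etrans (zP 1 (fun i => if i == i0 then 1 else 0) _) _; last by rewrite eqxx.
rewrite (bigD1 i0) //= eqxx big1 => [|i /negbTE ->]; last by rewrite rmorph0 mul0r.
by rewrite e0 rmorph1 mulr1 addr0.
Qed.

End Free.

(** * The exact sequence *)

Lemma comul_morph_gen (k : fieldType) (A B : algType k) (hA : hopf A) (hB : hopf B)
    (c : double_gen -> A) (d : double_gen -> B) (f : {lrmorphism A -> B}) :
  (forall r, r \in double_rels c -> r.1 = r.2) ->
  (forall r, r \in double_rels d -> r.1 = r.2) ->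
  double_coproduct hA c -> double_coproduct hB d -> (forall j, f (c j) = d j) ->
  forall j, comul hB (d j) = tens_map f f (comul hA (c j)).
Proof.
move=> cR dR cD dD fc.
have T a b : tens_map f f (a ⊗' b) = f a ⊗' f b := tens_mapE f f a b.
have f1 : f 1 = 1 by exact: rmorph1.
have DgV := comul_gV cR cD; have HgV := comul_gV dR dD.
have [Dg [Dx Dy] Dz Du Dv] := cD; have [Hg [Hx Hy] Hz Hu Hv] := dD.
case.
- by rewrite Du Hu tens_mapD !T !fc f1.
- by rewrite Dv Hv !tens_mapD !T !fc f1.
- by rewrite Dz Hz tens_mapD !T !fc f1.
- by rewrite Dg Hg !T !fc.
- by rewrite DgV HgV !T !fc.
- by rewrite Dx Hx tens_mapD !T !fc f1.
- by rewrite Dy Hy tens_mapD !T !fc f1.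
Qed.

Lemma central_scalar (k : fieldType) (A B : algType k) p
    (c : double_gen -> A) (d : double_gen -> B) (f : {lrmorphism A -> B}) (e : {lrmorphism A -> k^o}) :
  (forall r, r \in double_rels c -> r.1 = r.2) ->
  (forall r, r \in restricted_rels d p -> r.1 = r.2) -> (forall j, f (c j) = d j) ->
  (0 < p)%N -> (forall j, e (c j) = double_aug k j) ->
  forall z, z \in gen_subalg (central_seq c p) -> f z = (e z : k)%:A.
Proof.
move=> cR dR fc p0 ec; apply: gen_subalg_ind => [|x a b Ha Hb|a b Ha Hb|s].
- by rewrite !rmorph1 scale1r.
- by rewrite !linearP /= Ha Hb scalerDl scalerA.
- by rewrite !rmorphM /= Ha Hb mulr_algl scalerA.
have R r : r \in [:: (d gen_g ^+ p, 1); (d gen_x ^+ p, 0); (d gen_y ^+ p, 0); (d gen_u ^+ p, 0);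
    (d gen_v ^+ p, 0); (d gen_zeta ^+ p, d gen_zeta)] -> r.1 = r.2.
  by move=> rR; apply: dR; rewrite mem_cat rR orbT.
have gR r : r \in double_rels d -> r.1 = r.2 by move=> rR; apply: dR; rewrite mem_cat rR.
have aug j : e (c j ^+ p) = double_aug k j ^+ p by rewrite rmorphXn /= ec.
have fX j : f (c j ^+ p) = d j ^+ p by rewrite rmorphXn /= fc.
move=> sZ; rewrite !inE in sZ; move: sZ; do ![case/orP]; move/eqP->.
- by rewrite fX aug expr1n scale1r; apply: (R (_, _)); rewrite !inE eqxx.
- rewrite fX aug expr1n scale1r -(gVp_gp gR p).
  by have /= -> := R (_, _) (mem_head _ _); rewrite mulr1.
- by rewrite fX aug expr0n gtn_eqF // scale0r; apply: (R (_, _)); rewrite !inE eqxx ?orbT.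
- by rewrite fX aug expr0n gtn_eqF // scale0r; apply: (R (_, _)); rewrite !inE eqxx ?orbT.
- by rewrite fX aug expr0n gtn_eqF // scale0r; apply: (R (_, _)); rewrite !inE eqxx ?orbT.
- by rewrite fX aug expr0n gtn_eqF // scale0r; apply: (R (_, _)); rewrite !inE eqxx ?orbT.
- rewrite !rmorphB !rmorphXn /= fc ec /= expr0n gtn_eqF // subrr scale0r.
  apply/eqP; rewrite subr_eq0; apply/eqP.
  by apply: (R (_, _)); rewrite !inE eqxx ?orbT.
Qed.

(** The additional relators of the restricted double are central generators minus their
    counits. *)
Lemma restricted_rels_augmented (k : fieldType) (A : algType k) p
    (c : double_gen -> A) (e : {lrmorphism A -> k^o}) :
  (forall r, r \in double_rels c -> r.1 = r.2) ->
  (0 < p)%N -> (forall j, e (c j) = double_aug k j) ->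
  forall r, r \in restricted_rels c p ->
  r.1 - r.2 \in gen_subalg (central_seq c p) /\ e (r.1 - r.2) = 0.
Proof.
move=> cR p0 ec r rR; split; last first.
  apply/eqP; rewrite rmorphB subr_eq0; apply/eqP.
  apply: (@double_aug_rels k p (e r.1, e r.2)) => //.
  have E : double_aug k = e \o c by apply/funext => j; rewrite /= ec.
  by rewrite E -restricted_rels_map; apply/mapP; exists r.
move: rR; rewrite mem_cat => /orP[/cR ->|rR]; first by rewrite subrr rpred0.
have mem j : c j ^+ p \in central_seq c p -> c j ^+ p - 0 \in gen_subalg (central_seq c p).
  by rewrite subr0; exact: mem_gen_subalg.
rewrite !inE in rR; move: rR; do ![case/orP]; move/eqP->.
- by apply: rpredB; [apply: mem_gen_subalg; rewrite !inE eqxx|exact: rpred1].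
- by apply: mem; rewrite !inE eqxx ?orbT.
- by apply: mem; rewrite !inE eqxx ?orbT.
- by apply: mem; rewrite !inE eqxx ?orbT.
- by apply: mem; rewrite !inE eqxx ?orbT.
- by apply: mem_gen_subalg; rewrite !inE eqxx ?orbT.
Qed.

Section AugmentationIdeal.
Variables (k : fieldType) (D Z : algType k) (i : {lrmorphism Z -> D}) (e : Z -> k).
Hypothesis iC : forall z a, i z * a = a * i z.

(** The left ideal generated by i(Z^+), where Z^+ is the kernel of e. *)
Definition aug_ideal (d : D) := exists2 s : seq (D * Z),
  all (fun t => e t.2 == 0) s & d = \sum_(t <- s) t.1 * i t.2.

Lemma aug_ideal0 : aug_ideal 0. Proof. by exists [::]; rewrite ?big_nil. Qed.

Lemma aug_idealD a b : aug_ideal a -> aug_ideal b -> aug_ideal (a + b).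
Proof.
move=> [s s0 ->] [t t0 ->]; exists (s ++ t); first by rewrite all_cat s0.
by rewrite big_cat.
Qed.

Lemma aug_ideal_central a b z : e z = 0 -> aug_ideal (a * i z * b).
Proof.
move=> z0; exists [:: (a * b, z)]; first by rewrite /= z0 eqxx.
by rewrite big_seq1 -mulrA iC mulrA.
Qed.

Lemma aug_ideal_ker (B : algType k) (f : {lrmorphism D -> B}) :
  (forall z, f (i z) = (e z)%:A) -> forall d, aug_ideal d -> f d = 0.
Proof.
move=> fi _ [s /allP s0 ->]; rewrite rmorph_sum big1_seq // => t /= /s0/eqP e0.
apply: etrans (rmorphM f _ _) _.
by apply: etrans (congr1 ( *%R _) (fi _)) _; rewrite e0 scale0r mulr0.
Qed.

End AugmentationIdeal.

Lemma quot_map_ker (k : fieldType) (A : algType k) (rels1 rels2 : seq (A * A))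
    (c1 : consistent rels1) (c2 : consistent rels2) (sub12 : {subset rels1 <= rels2}) a :
  @quot_map _ _ _ _ c1 c2 sub12 (to_quot c1 a) = 0 -> in_ideal rels2 a.
Proof.
rewrite quot_mapE => a0; rewrite -[a]subr0; apply/(to_quotP c2).
by rewrite a0 rmorph0.
Qed.

(** As f is the counit on Z, the counit axiom gives
    (id (x) f) Delta(z) = z_1 (x) eps(z_2) = z (x) 1. *)
Lemma subalg_coinvariant (k : fieldType) (D Z H : algType k) (hD : hopf D)
    (i : {lrmorphism Z -> D}) (f : {lrmorphism D -> H}) :
  (forall z, exists w, comul hD (i z) = tens_map i i w) ->
  (forall z, f (i z) = (counit hD (i z) : k)%:A) ->
  forall z, tens_map id f (comul hD (i z)) = i z ⊗' 1.
Proof.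
move=> iD fi z; have [w Dw] := iD z; have B := (scale_bil (counit hD)).2.
have T := tens_map_bil (@idfun D) f.
rewrite -[in RHS](hopf_counitr hD (i z)) Dw.
rewrite [LHS](tens_lift_map i i w T) (tens_lift_map i i w B).
rewrite [in RHS]/tens_lift /tens_eval.
rewrite (big_morph (fun a : D => a ⊗' (1 : H)) (fun a b => tensDl a b 1) (tens0l _ 1)).
apply: eq_bigr => uv _; rewrite /= tensZl -tensZr; congr (_ ⊗' _); exact: fi.
Qed.

Section Exactness.
Variables (k : closedFieldType) (p : nat) (pcharp : p \in [pchar k]) (p_gt2 : (2 < p)%N).

Local Notation D := (Dtilde k).
Local Notation Zs := (Zgens k p).
Local Notation Z := (subalg Zs).
Local Notation H := (DH pcharp).
Local Notation i_ := (@incl k D Zs).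
Local Notation pr := (double_proj pcharp).
Local Notation c := (@Dtilde_gen k).

Lemma DH_restricted_rels r : r \in restricted_rels (DH_gen pcharp) p -> r.1 = r.2.
Proof.
have E : DH_gen pcharp = to_quot _ \o @free_gen k _ by [].
rewrite E -restricted_rels_map => /mapP[[a b] ab ->] /=.
by apply/to_quotP; exact: in_ideal_rel.
Qed.

Lemma DH_rels r : r \in double_rels (DH_gen pcharp) -> r.1 = r.2.
Proof. by move=> rR; apply: DH_restricted_rels; rewrite mem_cat rR. Qed.

Lemma double_proj_surj b : exists a, pr a = b.
Proof.
have [a ->] := to_quot_surj b; exists (to_quot _ a); exact: quot_mapE.
Qed.

Variables (hD : hopf D) (hH : hopf H).
Hypotheses (hD_comul : double_coproduct hD c) (hH_comul : double_coproduct hH (DH_gen pcharp)).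

Let p0 : (0 < p)%N. Proof. exact: ltnW (ltnW p_gt2). Qed.

Lemma Z_comul z : exists w, comul hD (i_ z) = tens_map i_ i_ w.
Proof.
move: z; rewrite (Zgens_central_seq pcharp) => z.
exact: (comul_central (@Dtilde_rels k) hD_comul pcharp p_gt2 (valP z)).
Qed.

Lemma Z_antipode z : exists z' : Z, antipode hD (i_ z) = i_ z'.
Proof.
move: z; rewrite (Zgens_central_seq pcharp) => z.
by exists (exist (fun a => a \in gen_subalg _) _ (antipode_central (@Dtilde_rels k) hD_comul pcharp p_gt2 (valP z))).
Qed.

Lemma Z_hopf_subalgebra : hopf_subalgebra hD (gen_subalg Zs).
Proof.
split=> [|z zZ|z zZ]; first exact: gen_subalg_closed.
  have [w E] := Z_comul (Sub z zZ); have [s ws] := tensorP w.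
  exists [seq (i_ t.1, i_ t.2) | t <- s].
    by apply/allP => _ /mapP[t _ ->] /=; apply/andP; split; exact: valP.
  rewrite big_map; apply: etrans E _; rewrite ws linear_sum.
  by apply: eq_bigr => t _; exact: tens_mapE.
by have [z' E] := Z_antipode (Sub z zZ); rewrite [antipode _ _]E; exact: valP.
Qed.

Lemma double_proj_comul a : comul hH (pr a) = tens_map pr pr (comul hD a).
Proof.
elim/Dtilde_ind: a => [|x a b Ha Hb|a b Ha Hb|j].
- by rewrite !rmorph1 [RHS]tens_mapE !rmorph1.
- by rewrite !linearP; congr (_ *: _ + _).
- apply: etrans (congr1 (comul hH) (rmorphM pr a b)) _.
  apply: etrans (rmorphM (comul hH) _ _) _.
  apply: etrans (congr2 *%R Ha Hb) _.
  by apply: etrans (esym (tens_map_mul pr pr _ _)) _; rewrite (comulM hD).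
rewrite double_projE.
exact: (comul_morph_gen (@Dtilde_rels k) DH_rels hD_comul hH_comul (double_projE pcharp)).
Qed.

Lemma double_proj_counit a : counit hH (pr a) = counit hD a.
Proof.
elim/Dtilde_ind: a => [|x a b Ha Hb|a b Ha Hb|j].
- by rewrite !rmorph1.
- by rewrite !linearP /= Ha Hb.
- by rewrite !rmorphM /= Ha Hb.
- rewrite double_projE (counit_gen DH_rels hH_comul).
  exact/esym/(counit_gen (@Dtilde_rels k) hD_comul).
Qed.

Lemma double_proj_hopf : hopf_morphism hD hH pr.
Proof.
split; [exact: double_proj_comul|exact: double_proj_counit|].
exact: hopf_antipode_morph double_proj_comul double_proj_counit.
Qed.

Lemma double_proj_Z (z : Z) : pr (i_ z) = (counit hD (i_ z) : k)%:A.
Proof.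
have := valP z; rewrite /= {2}(Zgens_central_seq pcharp).
apply: (central_scalar (@Dtilde_rels k) DH_restricted_rels (double_projE pcharp) p0).
exact: counit_gen (@Dtilde_rels k) hD_comul.
Qed.

(** An element of the kernel comes from the ideal of the restricted relations; those of
    the double vanish, and the others are central, so that the two-sided ideal that they
    generate is D Z^+. *)
Lemma double_proj_ker d : pr d = 0 <-> aug_ideal i_ (counit hD \o i_) d.
Proof.
have iC (z : Z) a : i_ z * a = a * i_ z by exact: (Z_central pcharp p_gt2 (valP z)).
split; last exact: (aug_ideal_ker (e := counit hD \o i_) double_proj_Z).
have [a ->] := to_quot_surj d => /quot_map_ker[s /allP sR ->]; rewrite linear_sum.
elim: s sR => [|t s IH] sR; first by rewrite big_nil; exact: aug_ideal0.
rewrite big_cons; apply: aug_idealD; last first.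
  by apply: IH => r rs; apply: sR; rewrite inE rs orbT.
have tR := sR t (mem_head _ _).
have qR : (to_quot (@double_rels_cons k) t.1.2.1, to_quot (@double_rels_cons k) t.1.2.2) \in
    restricted_rels c p.
  have E : c = to_quot _ \o @free_gen k _ by [].
  by rewrite E -restricted_rels_map; apply/mapP; exists t.1.2.
have ec := counit_gen (@Dtilde_rels k) hD_comul.
have [/= zZ z0] := restricted_rels_augmented (@Dtilde_rels k) p0 ec qR.
rewrite -(Zgens_central_seq pcharp) in zZ.
have := aug_ideal_central iC (to_quot (@double_rels_cons k) t.1.1) (to_quot _ t.2)
  (z := exist (fun a => a \in gen_subalg Zs) _ zZ) (e := counit hD \o i_) z0.
by rewrite /= !rmorphM rmorphB.
Qed.

Lemma Z_short_exact : exists2 hZ : hopf Z, hopf_morphism hZ hD i_ & short_exact hZ hD hH i_ pr.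
Proof.
have iC (z : Z) a : i_ z * a = a * i_ z by exact: (Z_central pcharp p_gt2 (valP z)).
have [rho [rhoZ rho1]] := central_projection pcharp p_gt2.
have iK : cancel i_ rho by move=> z; rewrite -[i_ z]mulr1 rhoZ rho1 mulr1.
pose hZ := res_hopf iK Z_comul Z_antipode.
have hZi : hopf_morphism hZ hD i_ by exact: res_hopf_morphism.
exists hZ; [exact: hZi|split].
- by split; last exact: double_proj_hopf.
- exact: can_inj iK.
- exact: double_proj_surj.
- exact: double_proj_ker.
- move=> d; split=> [[z <-]|dC].
    exact: subalg_coinvariant Z_comul double_proj_Z z.
  exists (rho d); apply: esym.
  apply: (coinvariantP iC rhoZ rho1 Z_comul Z_antipode double_proj_surj _ dC) => a.
  by move/double_proj_ker.
Qed.

End Exactness.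

(** * Regular functions on the group B *)

Lemma sdprod_coordl (k : fieldType) (N K : aff_group k) (act : group_action N K) f :
  f \in ag_coords N -> (fun s : sdprod_aff act => f s.1) \in ag_coords (sdprod_aff act).
Proof. by move=> fN; rewrite mem_cat; apply/orP; left; apply/mapP; exists f. Qed.

Lemma sdprod_coordr (k : fieldType) (N K : aff_group k) (act : group_action N K) f :
  f \in ag_coords K -> (fun s : sdprod_aff act => f s.2) \in ag_coords (sdprod_aff act).
Proof. by move=> fK; rewrite mem_cat; apply/orP; right; apply/mapP; exists f. Qed.

Lemma sdprod_coordP (k : fieldType) (N K : aff_group k) (act : group_action N K)
    (f : sdprod_aff act -> k) : f \in ag_coords (sdprod_aff act) ->
  (exists2 h, h \in ag_coords N & f = fun s => h s.1) \/
  (exists2 h, h \in ag_coords K & f = fun s => h s.2).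
Proof. by rewrite mem_cat => /orP[]/mapP[h hH ->]; [left|right]; exists h. Qed.

Lemma subalg_comm (k : fieldType) (A : algType k) (S : seq A) :
  (forall a b : A, a * b = b * a) -> forall a b : subalg S, a * b = b * a.
Proof. by move=> commA a b; apply: val_inj; rewrite !rmorphM; exact: commA. Qed.

Lemma subalg_mul1 (k : fieldType) (A : algType k) (S : seq A) (a b : subalg S) :
  incl a * incl b = 1 -> a * b = 1.
Proof. by move=> ab; apply: val_inj; rewrite rmorphM rmorph1. Qed.

Section CoordinatesB.
Variable k : fieldType.

Local Notation B := (groupB k).
Local Notation O := (regfun B).

Definition coordT (b : B) : k := val b.1.2.
Definition coordTV (b : B) : k := (val b.1.2)^-1.
(** In this order, the coordinates correspond to x^p, y^p, u^p, v^p and zeta^p - zeta. *)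
Definition coordX (j : 'I_5) (b : B) : k :=
  nth 0 [:: b.1.1.1 : k; b.1.1.2 : k; val b.2 1 2%:R; val b.2 0 2%:R; val b.2 0 1] j.

Lemma coordT_mem : (coordT : fun_alg k B) \in ag_coords B.
Proof.
apply: (@sdprod_coordl _ (sdprod_aff (scaling_action k)) (H3 k) _ (fun b => val b.2)).
exact: (@sdprod_coordr _ _ (Gm k) (scaling_action k) (fun a => val a)) (mem_head _ _).
Qed.

Lemma coordTV_mem : (coordTV : fun_alg k B) \in ag_coords B.
Proof.
apply: (@sdprod_coordl _ (sdprod_aff (scaling_action k)) (H3 k) _ (fun b => (val b.2)^-1)).
apply: (@sdprod_coordr _ _ (Gm k) (scaling_action k) (fun a => (val a)^-1)).
by rewrite inE mem_seq1 eqxx orbT.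
Qed.

Lemma coordX_mem j : (coordX j : fun_alg k B) \in ag_coords B.
Proof.
have r f : f \in ag_coords (dprod_aff (Ga k) (Ga k)) -> (fun b : B => f b.1.1) \in ag_coords B.
  move=> fG; apply: (@sdprod_coordl _ (sdprod_aff (scaling_action k)) (H3 k) _ (fun b => f b.1)).
  exact: (@sdprod_coordl _ _ (Gm k) (scaling_action k) f fG).
have m i l : (fun b : B => val b.2 i l : k) \in ag_coords B.
  apply: (@sdprod_coordr _ _ (H3 k) _ (fun M : H3_pt k => val M i l)).
  by apply/mapP; exists (i, l); rewrite ?mem_enum.
case: j => [[|[|[|[|[|//]]]]] j5].
- exact: r (@sdprod_coordl _ (Ga k) (Ga k) _ id (mem_head _ _)).
- exact: r (@sdprod_coordr _ (Ga k) (Ga k) _ id (mem_head _ _)).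
- exact: m.
- exact: m.
- exact: m.
Qed.

Definition regT : O := exist (fun a => a \in gen_subalg _) _ (mem_gen_subalg coordT_mem).
Definition regTV : O := exist (fun a => a \in gen_subalg _) _ (mem_gen_subalg coordTV_mem).
Definition regX j : O := exist (fun a => a \in gen_subalg _) _ (mem_gen_subalg (coordX_mem j)).

Lemma regfun_comm (G : aff_group k) (f h : regfun G) : f * h = h * f.
Proof. by apply: subalg_comm => a b; apply/funext => c; exact: mulrC. Qed.

Section EvalAt.
Variables (G : aff_group k) (b : G).
Definition fun_at (f : fun_alg k G) : k^o := f b.
Lemma fun_at_linear : linear fun_at. Proof. by []. Qed.
Lemma fun_at_monoid : monoid_morphism fun_at. Proof. by []. Qed.
HB.instance Definition _ := GRing.isLinear.Build k (fun_alg k G) k^o *:%R fun_at fun_at_linear.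
HB.instance Definition _ := GRing.isMonoidMorphism.Build (fun_alg k G) k^o fun_at fun_at_monoid.
(** regfun_eval with its arguments swapped, as a morphism to the algebra k. *)
Definition regfun_at : regfun G -> k^o := fun_at \o @incl k (fun_alg k G) (ag_coords G).
HB.instance Definition _ := GRing.LRMorphism.on regfun_at.
End EvalAt.

Lemma regT_regTV : regT * regTV = 1.
Proof. by apply: subalg_mul1; apply/funext => b; exact: mulfV (valP b.1.2). Qed.

Definition lp_regfun : laurent_poly k -> O := lp_lift (@regfun_comm B) regT_regTV regX.
HB.instance Definition _ := GRing.LRMorphism.on lp_regfun.

Lemma lp_regfunT : lp_regfun (lp_T k) = regT. Proof. exact: lp_liftT. Qed.
Lemma lp_regfunTV : lp_regfun (lp_TV k) = regTV. Proof. exact: lp_liftTV. Qed.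
Lemma lp_regfunX j : lp_regfun (lp_X k j) = regX j. Proof. exact: lp_liftX. Qed.

(** The entries of a unitriangular matrix on and below the diagonal are constant; all
    other coordinates are values of generators. *)
Lemma lp_regfun_surj f : exists a, lp_regfun a = f.
Proof.
apply: subalg_surj => s /sdprod_coordP[][h + ->] {s}.
  move=> /sdprod_coordP[][h' + ->] {h}.
    move=> /sdprod_coordP[][h + ->] {h'}; rewrite mem_seq1 => /eqP ->.
      by exists (lp_X k (@Ordinal 5 0 isT)); have H := congr1 (@incl _ _ _) (lp_regfunX (@Ordinal 5 0 isT)); exact: H.
    by exists (lp_X k (@Ordinal 5 1 isT)); have H := congr1 (@incl _ _ _) (lp_regfunX (@Ordinal 5 1 isT)); exact: H.
  rewrite inE mem_seq1 => /orP[]/eqP ->.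
    by exists (lp_T k); have H := congr1 (@incl _ _ _) lp_regfunT; exact: H.
  by exists (lp_TV k); have H := congr1 (@incl _ _ _) lp_regfunTV; exact: H.
move=> /mapP[[i l] _ ->] /=.
have [li|il] := leqP l i.
  exists (i == l)%:R%:A; rewrite linearZ rmorph1; apply/funext => b /=.
  rewrite (unitriangularP _ (valP b.2) i l li); exact: mulr1.
have [j jE] : exists j : 'I_5, forall b : B, coordX j b = val b.2 i l.
  case: i l il => [[|[|[|//]]] i3] [[|[|[|//]]] l3] // _.
  - by exists (@Ordinal 5 4 isT) => b; congr (val b.2 _ _); exact: val_inj.
  - by exists (@Ordinal 5 3 isT) => b; congr (val b.2 _ _); exact: val_inj.
  - by exists (@Ordinal 5 2 isT) => b; congr (val b.2 _ _); exact: val_inj.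
exists (lp_X k j); apply: etrans (congr1 (@incl _ _ _) (lp_regfunX _)) _.
by apply/funext => b; exact: jE.
Qed.

End CoordinatesB.

Lemma lp_hom_poly (k : fieldType) (f : {lrmorphism laurent_poly k -> k^o}) q :
  f (lp_poly q) = q.@[fun i => f (lp_poly 'X_i)].
Proof.
elim/mpoly_alg_ind: q => [|c x y Hx Hy|x y Hx Hy|i].
- by rewrite !rmorph1.
- by rewrite mevalD mevalZ -Hx -Hy !linearP.
- by rewrite mevalM -Hx -Hy !rmorphM.
- by rewrite mevalXU.
Qed.

Section Embedding.
Variable k : closedFieldType.
Local Notation B := (groupB k).

Definition pointB (b : B) (i : 'I_6) : k := if unlift ord0 i is Some j then coordX j b else coordT b.

Lemma lp_regfun_poly (b : B) q : regfun_at b (lp_regfun (lp_poly q)) = q.@[pointB b].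
Proof.
rewrite [LHS](lp_hom_poly (regfun_at b \o @lp_regfun k)); apply: meval_eq => i.
rewrite /pointB; case: unliftP => [j|] -> /=.
  by rewrite lp_polyXS lp_regfunX.
by rewrite lp_polyX0 lp_regfunT.
Qed.

Lemma pointB_surj (v : 'I_6 -> k) : v ord0 != 0 -> exists b, pointB b =1 v.
Proof.
move=> v0; pose w i := v (inord i).
(* Above the diagonal i + j tells the three entries apart: 1, 2, 3 for (0,1), (0,2), *)
(* (1,2).                                                                           *)
pose M : 'M[k]_3 := \matrix_(i, j) if (j <= i)%N then (i == j)%:R else nth 0 [:: 0; w 5; w 4; w 3] (i + j).
have MU : M \in @unitriangular k by apply/unitriangularP => i j ij; rewrite mxE ij.
pose b : B := (((w 1, w 2), exist (fun c => c != 0) (v ord0) v0), exist (fun M : 'M[k]_3 => M \in @unitriangular k) M MU).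
exists b => i; rewrite /pointB; case: unliftP => [j|] -> //.
have -> : v (lift ord0 j) = w j.+1 by congr v; apply: val_inj; rewrite /= inordK // ltnS.
by case: j => [[|[|[|[|[|//]]]]] j5]; rewrite /coordX /= ?mxE.
Qed.

(** The points of B realise all the values of the six variables with a nonzero first
    one, and X_0 q vanishes at the others. *)
Lemma lp_regfun_inj : injective (@lp_regfun k).
Proof.
apply: lp_lift_inj => q q0.
have H (v : 'I_6 -> k) : v ord0 != 0 -> q.@[v] = 0.
  move=> /pointB_surj[b bv]; rewrite -(meval_eq _ bv) -lp_regfun_poly.
  by rewrite [lp_regfun _]q0 rmorph0.
have : 'X_ord0 * q = 0.
  apply: mpoly_vanish => v; rewrite mevalM mevalXU.
  by have [->|/H ->] := eqVneq (v ord0) 0; rewrite ?mul0r ?mulr0.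
move/eqP; rewrite mulf_eq0 => /orP[|/eqP //].
by move/eqP/(congr1 (meval (fun=> 1))); rewrite mevalXU meval0 => /eqP; rewrite oner_eq0.
Qed.

End Embedding.

(** * The Hopf isomorphism with the regular functions *)

(** Coproducts in Z are read off from those in D, the inclusion being split. *)
Section PullBack.
Variables (k : fieldType) (D Z : algType k) (hD : hopf D) (hZ : hopf Z).
Variables (i : {lrmorphism Z -> D}) (rho : {linear D -> Z}).
Hypotheses (iK : cancel i rho) (hZi : hopf_morphism hZ hD i).

Let pull z w : comul hD (i z) = tens_map i i w -> comul hZ z = w.
Proof.
have [iD _ _] := hZi; rewrite iD => E.
by rewrite -[LHS](tens_iK iK) E (tens_iK iK).
Qed.
Let T a b : tens_map i i (a ⊗' b) = i a ⊗' i b := tens_mapE i i a b.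
Let i1 : i 1 = 1. Proof. exact: rmorph1. Qed.

Lemma comul_grouplike_pull a : comul hD (i a) = i a ⊗' i a -> comul hZ a = a ⊗' a.
Proof. by move=> E; apply: pull; rewrite T. Qed.

Lemma comul_skew_pull a b : comul hD (i a) = i a ⊗' 1 + i b ⊗' i a -> comul hZ a = a ⊗' 1 + b ⊗' a.
Proof. by move=> E; apply: pull; rewrite tens_mapD !T i1. Qed.

Lemma comul_prim_pull a : comul hD (i a) = i a ⊗' 1 + 1 ⊗' i a -> comul hZ a = a ⊗' 1 + 1 ⊗' a.
Proof. by move=> E; apply: comul_skew_pull; rewrite i1. Qed.

Lemma comul_heis_pull a b c : comul hD (i a) = i a ⊗' 1 + 1 ⊗' i a + i b ⊗' i c ->
  comul hZ a = a ⊗' 1 + 1 ⊗' a + b ⊗' c.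
Proof. by move=> E; apply: pull; rewrite !tens_mapD !T i1. Qed.

End PullBack.

Lemma lp_hom_ext (k : fieldType) (A : algType k) (f h : {lrmorphism laurent_poly k -> A}) :
  f (lp_T k) = h (lp_T k) -> f (lp_TV k) = h (lp_TV k) ->
  (forall j, f (lp_X k j) = h (lp_X k j)) -> f =1 h.
Proof.
move=> fT fTV fX; apply: lp_ind fT fTV fX => [|c a b Ha Hb|a b Ha Hb].
- exact: etrans (rmorph1 f) (esym (rmorph1 h)).
- exact: etrans (linearP f c a b) (etrans (congr2 (fun s t => c *: s + t) Ha Hb) (esym (linearP h c a b))).
- exact: etrans (rmorphM f a b) (etrans (congr2 *%R Ha Hb) (esym (rmorphM h a b))).
Qed.

Lemma H3_mulE (k : fieldType) (M N : H3_pt k) :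
  [/\ val (M * N)%g 0 1 = val M 0 1 + val N 0 1,
      val (M * N)%g 1 2%:R = val M 1 2%:R + val N 1 2%:R &
      val (M * N)%g 0 2%:R = val M 0 2%:R + val N 0 2%:R + val M 0 1 * val N 1 2%:R].
Proof.
have HM := unitriangularP _ (valP M); have HN := unitriangularP _ (valP N).
have sum3 (F : 'I_3 -> k) : \sum_m F m = F 0 + F 1 + F 2%:R.
  rewrite !big_ord_recl big_ord0 addr0 addrA.
  by congr (_ + F _ + F _); exact: val_inj.
split; rewrite [LHS]mxE sum3.
- by rewrite (HM 0 0) // (HN 1 1) // (HN 2%:R 1) //= mul1r mulr1 mulr0 addr0 addrC.
- by rewrite (HM 1 0) // (HM 1 1) // (HN 2%:R 2%:R) //= mul0r mul1r mulr1 add0r addrC.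
- by rewrite (HM 0 0) // (HN 2%:R 2%:R) //= mul1r mulr1 addrC addrA.
Qed.

Lemma GaGa_mulE (k : fieldType) (g h : groupB k) :
  ((g * h)%g.1.1.1 = (g.1.1.1 : k) + val g.1.2 * (h.1.1.1 : k)) *
  ((g * h)%g.1.1.2 = (g.1.1.2 : k) + val g.1.2 * (h.1.1.2 : k)).
Proof. by case: g => [[[? ?] ?] ?]; case: h => [[[? ?] ?] ?]. Qed.

Section FunctionAlgebra.
Variables (k : closedFieldType) (p : nat) (pcharp : p \in [pchar k]) (p_gt2 : (2 < p)%N).
Local Notation D := (Dtilde k).
Local Notation Z := (subalg (Zgens k p)).
Local Notation i_ := (@incl k D (Zgens k p)).
Local Notation zlift := (zlift pcharp p_gt2).
Local Notation B := (groupB k).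
Local Notation O := (regfun B).
Variables (hD : hopf D) (hD_comul : double_coproduct hD (@Dtilde_gen k)).
Variables (hZ : hopf Z) (hZi : hopf_morphism hZ hD i_).

Lemma zlift_inverse : exists2 psi : {lrmorphism Z -> laurent_poly k},
  cancel zlift psi & cancel psi zlift.
Proof.
apply: bij_inverse; have [psi psiK] := choice (zlift_surj pcharp p_gt2).
by exists psi => // a; apply: (zlift_inj (pcharp := pcharp) (p_gt2 := p_gt2)); exact: psiK.
Qed.

Lemma lp_regfun_inverse : exists2 psi : {lrmorphism O -> laurent_poly k},
  cancel (@lp_regfun k) psi & cancel psi (@lp_regfun k).
Proof.
apply: bij_inverse; have [psi psiK] := choice (@lp_regfun_surj k).
by exists psi => // a; apply: lp_regfun_inj; exact: psiK.
Qed.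

Local Notation Zg j := (Zgen k p j).
Local Notation zT := (Zg ord0).
Local Notation zTV := (Zg (lift ord0 ord0)).
Local Notation zX j := (Zg (lift ord0 (lift ord0 j))).
Local Notation "# n" := (@Ordinal 5 n isT) (at level 2).

Lemma Z_coproduct :
  [/\ comul hZ zT = zT ⊗' zT, comul hZ zTV = zTV ⊗' zTV,
      comul hZ (zX #0) = zX #0 ⊗' 1 + zT ⊗' zX #0 /\
      comul hZ (zX #1) = zX #1 ⊗' 1 + zT ⊗' zX #1,
      comul hZ (zX #2) = zX #2 ⊗' 1 + 1 ⊗' zX #2 /\
      comul hZ (zX #4) = zX #4 ⊗' 1 + 1 ⊗' zX #4 &
      comul hZ (zX #3) = zX #3 ⊗' 1 + 1 ⊗' zX #3 + zX #4 ⊗' zX #2].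
Proof.
have [rho [rhoZ rho1]] := central_projection pcharp p_gt2.
have iK : cancel i_ rho by move=> z; rewrite -[i_ z]mulr1 rhoZ rho1 mulr1.
have R := @Dtilde_rels k.
have zE : i_ (zX #4) = Dtilde_gen k gen_zeta ^+ p - Dtilde_gen k gen_zeta := zeta_pE pcharp.
have E4 : comul hD (i_ (zX #4)) = i_ (zX #4) ⊗' 1 + 1 ⊗' i_ (zX #4).
  by rewrite zE; exact: (comul_zetap hD_comul pcharp).
have E3 : comul hD (i_ (zX #3)) = i_ (zX #3) ⊗' 1 + 1 ⊗' i_ (zX #3) + i_ (zX #4) ⊗' i_ (zX #2).
  by rewrite zE; exact: (comul_vp R hD_comul pcharp p_gt2).
split; [| |split|split|].
- apply: (comul_grouplike_pull iK hZi); exact: (comul_gp hD_comul p).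
- apply: (comul_grouplike_pull iK hZi); exact: (comul_gVp R hD_comul p).
- apply: (comul_skew_pull iK hZi); exact: (comul_xp R hD_comul pcharp).
- apply: (comul_skew_pull iK hZi); exact: (comul_yp R hD_comul pcharp p_gt2).
- apply: (comul_prim_pull iK hZi); exact: (comul_up hD_comul pcharp).
- apply: (comul_prim_pull iK hZi); exact: E4.
- apply: (comul_heis_pull iK hZi); exact: E3.
Qed.

Variable (phi : {lrmorphism Z -> O}).
Hypothesis phiE : forall a, phi (zlift a) = lp_regfun a.

(** Both sides are algebra maps in z, and agree on the generators by comparing the
    coproducts with the multiplication of B: x^p and y^p are the coordinates of the
    vectors, scaled by g^p, while zeta^p - zeta, u^p and v^p are the entries (0,1),
    (1,2) and (0,2) of the unitriangular matrix. *)
Lemma phi_coproduct z (g h : B) :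
  tens_lift (fun u v => regfun_eval (phi u) g * regfun_eval (phi v) h : k^o) (comul hZ z)
  = regfun_eval (phi z) (g * h)%g.
Proof.
have [a <-] := zlift_surj pcharp p_gt2 z; move: a.
pose L := @tensor_lift k k^o Z Z (regfun_at g \o phi) (regfun_at h \o phi) (@mulrC k).
rewrite -/L.
pose F1 : {lrmorphism laurent_poly k -> k^o} := L \o comul hZ \o zlift.
pose F2 : {lrmorphism laurent_poly k -> k^o} := regfun_at (g * h)%g \o phi \o zlift.
have LE u v : L (u ⊗' v) = regfun_eval (phi u) g * regfun_eval (phi v) h.
  exact: tensor_liftE.
have L1 u : L (u ⊗' 1) = regfun_eval (phi u) g.
  by apply: etrans (LE u 1) _; rewrite rmorph1; exact: mulr1.
have L2 v : L (1 ⊗' v) = regfun_eval (phi v) h.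
  by apply: etrans (LE 1 v) _; rewrite rmorph1; exact: mul1r.
have LD s t : L (s + t) = L s + L t by exact: linearD.
have pT : phi zT = regT k by rewrite -(zliftT pcharp p_gt2) phiE; exact: lp_regfunT.
have pTV : phi zTV = regTV k by rewrite -(zliftTV pcharp p_gt2) phiE; exact: lp_regfunTV.
have pX j : phi (zX j) = @regX k j by rewrite -(zliftX pcharp p_gt2) phiE; exact: lp_regfunX.
have [DT DTV [D0 D1] [D2 D4] D3] := Z_coproduct.
have F12 a y : zlift a = y -> L (comul hZ y) = regfun_eval (phi y) (g * h)%g -> F1 a = F2 a.
  by move=> <-.
apply: (@lp_hom_ext k k^o F1 F2) => [||j].
- apply: F12 (zliftT _ _) _; rewrite DT LE pT.
  exact: erefl.
- apply: F12 (zliftTV _ _) _; rewrite DTV LE pTV.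
  exact/esym/invfM.
apply: F12 (zliftX _ _ _) _.
have [H01 H12 H02] := H3_mulE g.2 h.2.
case: j => [[|[|[|[|[|//]]]]] j5].
- rewrite (_ : Ordinal j5 = #0); last exact: val_inj.
  rewrite D0 LD L1 LE pT !pX; exact: esym (GaGa_mulE g h).1.
- rewrite (_ : Ordinal j5 = #1); last exact: val_inj.
  rewrite D1 LD L1 LE pT !pX; exact: esym (GaGa_mulE g h).2.
- rewrite (_ : Ordinal j5 = #2); last exact: val_inj.
  rewrite D2 LD L1 L2 !pX; exact: esym H12.
- rewrite (_ : Ordinal j5 = #3); last exact: val_inj.
  rewrite D3 !LD L1 L2 LE !pX; exact: esym H02.
- rewrite (_ : Ordinal j5 = #4); last exact: val_inj.
  rewrite D4 LD L1 L2 !pX; exact: esym H01.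
Qed.

End FunctionAlgebra.

Section FunctionAlgebraIso.
Variables (k : closedFieldType) (p : nat) (pcharp : p \in [pchar k]) (p_gt2 : (2 < p)%N).
Local Notation Z := (subalg (Zgens k p)).
Local Notation O := (regfun (groupB k)).
Variables (hD : hopf (Dtilde k)) (hD_comul : double_coproduct hD (@Dtilde_gen k)).
Variables (hZ : hopf Z) (hZi : hopf_morphism hZ hD (@incl k (Dtilde k) (Zgens k p))).

Lemma Z_function_algebra : exists2 hO : hopf O, regfun_coproduct hO &
  exists2 phi : {lrmorphism Z -> O}, bijective phi & hopf_morphism hZ hO phi.
Proof.
have [psi zK psiK] := zlift_inverse pcharp p_gt2.
have [chi rK chiK] := lp_regfun_inverse k.
pose phi : {lrmorphism Z -> O} := @lp_regfun k \o psi.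
have phi_bij : bijective phi.
  by apply: bij_comp; [exists chi; [exact: rK|exact: chiK]|exists (zlift pcharp p_gt2); [exact: psiK|exact: zK]].
have phiE a : phi (zlift pcharp p_gt2 a) = lp_regfun a by have H := congr1 (@lp_regfun k) (zK a); exact: H.
have [hO hphi] := hopf_transport hZ phi_bij.
exists hO; last by exists phi.
move=> f g h; have [phi' phiK phi'K] := phi_bij; rewrite -(phi'K f).
have [-> _ _] := hphi.
rewrite -(phi_coproduct hD_comul hZi phiE) tens_lift_map //.
exact: tensor_lift_bil (regfun_at g) (regfun_at h).
Qed.

End FunctionAlgebraIso.

Theorem proposition2p6 (k : closedFieldType) (p : nat)
    (pcharp : p \in [pchar k]) (p_gt2 : (2 < p)%N)
    (hD : hopf (Dtilde k)) (hH : hopf (DH pcharp))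
    (hD_comul : double_coproduct hD (@Dtilde_gen k))
    (hH_comul : double_coproduct hH (DH_gen pcharp)) :
  let Z : algType k := subalg (Zgens k p) in
  [/\ (* (i) *)
      central (gen_subalg (Zgens k p)) /\
      hopf_subalgebra hD (gen_subalg (Zgens k p)),
      (* (ii) *)
      fg_free_over (Zgens k p),
      (* (iii) and (v), for the Hopf algebra structure hZ of Z *)
      exists hZ : hopf Z,
        short_exact hZ hD hH (@incl k (Dtilde k) (Zgens k p)) (double_proj pcharp) /\
        exists2 hO : hopf (regfun (groupB k)), regfun_coproduct hO &
          exists2 phi : {lrmorphism Z -> regfun (groupB k)},
            bijective phi & hopf_morphism hZ hO phi,
      (* (iv) *)
      exists phi : {lrmorphism Z -> laurent k ⊗ {mpoly k[5]}}, bijective phi &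
      forall a b : Z, a * b = 0 -> a = 0 \/ b = 0].
Proof.
have [hZ hZi exactZ] := Z_short_exact p_gt2 hD_comul hH_comul.
have [psi zK psiK] := zlift_inverse pcharp p_gt2.
split.
- by split; [exact: (Z_central pcharp p_gt2)|exact: (Z_hopf_subalgebra pcharp p_gt2 hD_comul)].
- exact: (Dtilde_free pcharp p_gt2).
- exists hZ; split; first exact: exactZ.
  exact: (Z_function_algebra pcharp p_gt2 hD_comul hZi).
- by exists psi; exists (zlift pcharp p_gt2); [exact: psiK|exact: zK].
- exact: (Z_domain pcharp p_gt2).
Qed.
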